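(* The bigraded $\mathbb{F}_2$-vector space $\mathcal{U}_{\mathbf{P}}(1) = \{\mathcal{U}_{\mathbf{P}}(1)^{n,d}\}_{n\ge 1,\, d\ge 0}$ is non-trivial only in bidegrees $(n,d) = (4m+r,\, 8m+r)$ with $m \ge 0$ and $r \in \{1,2\}$, and in each of these bidegrees $\mathcal{U}_{\mathbf{P}}(1)^{n,d} \cong \mathbb{F}_2$. In other words, \[ \sum_{n\ge 1,\, d\ge 0} \dim_{\mathbb{F}_2}\bigl(\mathcal{U}_{\mathbf{P}}(1)^{n,d}\bigr)\, s^n t^d = \frac{st(1+st)}{1-s^4t^8}. \]
   Context: Let $\mathcal{A}$ be the mod $2$ Steenrod algebra, and for $k\ge 0$ let $\mathcal{A}(k)$ be the subalgebra of $\mathcal{A}$ generated by $Sq^{2^i}$, $0\le i\le k$. Let $P=\mathbb{F}_2[t]=H^*(\mathbb{R}P^\infty;\mathbb{F}_2)$, $|t|=1$, with its usual left $\mathcal{A}$-action $Sq^j t^i=\binom{i}{j}t^{i+j}$, and let $\widetilde{P}$ be the augmentation ideal of $P\to\mathbb{F}_2$ (spanned by $t^i$, $i\ge 1$). The tensor power $\widetilde{P}^{\otimes n}$ (over $\mathbb{F}_2$) is an $\mathcal{A}$-module via the Cartan formula, and $\widetilde{P}^{\otimes n}\cong \widetilde{H}^*((\mathbb{R}P^\infty)^{\wedge n};\mathbb{F}_2)$. Let $\mathbf{P}^{n,d}$ be the degree $d$ part of $\widetilde{P}^{\otimes n}$ and $\mathbf{P}=\{\mathbf{P}^{n,d}\}_{n\ge1,d\ge0}$.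 For a graded left $\mathcal{A}$-module (or $\mathcal{A}(k)$-module) $M$, define the graded $\mathbb{F}_2$-subspaces $\mathcal{I}_M(k)=\mathcal{A}(k)^+M=\sum_{i=0}^k \mathrm{im}(Sq^{2^i}\colon M^{*-2^i}\to M^* )$ and $\mathcal{D}_M(k)=\sum_{i=0}^k\ker(Sq^{2^{i+1}-1}\colon M^*\to M^{*+2^{i+1}-1})$. One has $\mathcal{I}_M(k)\subseteq\mathcal{D}_M(k)$, and $\mathcal{U}_M(k)=\mathcal{D}_M(k)/\mathcal{I}_M(k)$. $\mathcal{U}_{\mathbf{P}}(k)^{n,d}$ denotes the degree $d$ part of $\mathcal{U}_M(k)$ for $M=\widetilde{P}^{\otimes n}$. *)

(* Defs.v *)
From HB Require Import structures.
From mathcomp Require Import all_boot all_order all_algebra.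
From mathcomp Require Import ssrcomplements freeg mpoly.

Set Implicit Arguments.
Unset Strict Implicit.
Unset Printing Implicit Defensive.

Import GRing.Theory.
Import Quotient VectorInternalTheory.

Local Open Scope ring_scope.
Local Open Scope quotient_scope.

(* quotv D I is the vector space D / (I :&: D), that is D / I when            *)
(* (I <= D)%VS. It is built as a quotient of the type subvs_of D.             *)
Section QuotientSpace.
Variables (K : fieldType) (vT : vectType K) (D I : {vspace vT}).

Local Notation W := (subvs_of D).

Definition quotv_ker : {vspace W} := (linfun vsval @^-1: I)%VS.

Definition quotv : Type := {quot quotv_ker}.

HB.instance Definition _ := GRing.Zmodule.on quotv.

Definition quotv_pi (x : W) : quotv := \pi_({quot quotv_ker}) x.

Lemma mem_quotv_ker (x : W) : (x \in quotv_ker) = (vsval x \in I).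
Proof. by rewrite -memv_preim lfunE. Qed.

Lemma quotv_pi_is_zmod_morphism : zmod_morphism quotv_pi.
Proof. by move=> x y; rewrite /quotv_pi raddfB. Qed.

Lemma quotv_piP (x y : W) :
  reflect (quotv_pi x = quotv_pi y) (x - y \in quotv_ker).
Proof. by rewrite idealrBE; apply: eqP. Qed.

Lemma quotv_reprK (q : quotv) : quotv_pi (repr (q : {quot quotv_ker})) = q.
Proof. exact: reprK. Qed.

Definition quotv_scale (a : K) (q : quotv) : quotv :=
  quotv_pi (a *: repr (q : {quot quotv_ker})).

Lemma quotv_scale_pi a x : quotv_scale a (quotv_pi x) = quotv_pi (a *: x).
Proof.
apply/quotv_piP; rewrite -scalerBr memvZ //.
by apply/quotv_piP; rewrite quotv_reprK.
Qed.

Lemma quotv_scaleA a b q :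
  quotv_scale a (quotv_scale b q) = quotv_scale (a * b) q.
Proof. by rewrite -(quotv_reprK q) !quotv_scale_pi scalerA. Qed.

Lemma quotv_scale1 : left_id 1 quotv_scale.
Proof. by move=> q; rewrite -(quotv_reprK q) quotv_scale_pi scale1r. Qed.

HB.instance Definition _ :=
  GRing.isZmodMorphism.Build W quotv quotv_pi quotv_pi_is_zmod_morphism.

Lemma quotv_scaleDr : right_distributive quotv_scale +%R.
Proof.
move=> a p q; rewrite -(quotv_reprK p) -(quotv_reprK q) -raddfD.
by rewrite !quotv_scale_pi scalerDr raddfD.
Qed.

Lemma quotv_scaleDl q : {morph quotv_scale^~ q : a b / a + b}.
Proof.
by move=> a b; rewrite -(quotv_reprK q) !quotv_scale_pi scalerDl raddfD.
Qed.

HB.instance Definition _ := GRing.Zmodule_isLmodule.Build K quotv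
  quotv_scaleA quotv_scale1 quotv_scaleDr quotv_scaleDl.

Lemma quotv_pi_is_scalable : scalable quotv_pi.
Proof. by move=> a x; rewrite -quotv_scale_pi. Qed.

HB.instance Definition _ :=
  GRing.isScalable.Build K W quotv *:%R quotv_pi quotv_pi_is_scalable.

Lemma quotv_pi_eq0 x : (quotv_pi x == 0) = (vsval x \in I).
Proof.
by rewrite -mem_quotv_ker -[x in RHS]subr0 -(raddf0 quotv_pi);
   apply/eqP/quotv_piP.
Qed.

Let C := (quotv_ker^C)%VS.

Let coord (x : W) : subvs_of C := vsproj C (x - projv quotv_ker x).

Let coordK x : vsval (coord x) = x - projv quotv_ker x.
Proof. by rewrite /coord vsprojK ?memv_projC. Qed.

Let coord_pi x : coord (repr (\pi_({quot quotv_ker}) x)) = coord x.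
Proof.
apply: val_inj; rewrite /= !coordK; set y := repr _.
have xyK : y - x \in quotv_ker.
  by apply/quotv_piP; rewrite /quotv_pi /y reprK.
have := projv_id xyK; rewrite linearB /= => projB.
by apply/eqP; rewrite -subr_eq0 opprD addrACA -opprD projB subrr.
Qed.

Lemma quotv_vecaxiom : vector_axiom (\dim C) quotv.
Proof.
pose f (q : quotv) : 'rV[K]_(\dim C) :=
  @v2r K (subvs_of C) (coord (repr (q : {quot quotv_ker}))).
pose g (r : 'rV[K]_(\dim C)) : quotv :=
  quotv_pi (vsval (@r2v K (subvs_of C) r)).
have f_pi x : f (quotv_pi x) = v2r (coord x) by rewrite /f coord_pi.
exists f => [a p q|].
  rewrite -(quotv_reprK p) -(quotv_reprK q).
  set x := repr _; set y := repr _.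
  have -> : a *: quotv_pi x + quotv_pi y = quotv_pi (a *: x + y).
    by rewrite linearP.
  rewrite !f_pi; transitivity (v2r (a *: coord x + coord y)).
    apply: congr1; apply: val_inj.
    by rewrite linearP /= !coordK linearP /= scalerBr opprD addrACA.
  by rewrite linearP.
exists g => [q|r].
  rewrite /f /g v2rK coordK; rewrite -[RHS]quotv_reprK.
  by apply/quotv_piP; rewrite addrAC subrr add0r memvN memv_proj.
rewrite /g f_pi -[RHS](@r2vK K (subvs_of C)); apply: congr1; apply: val_inj.
rewrite /= coordK; set w := vsval _.
have /eqP -> : projv quotv_ker w == 0; last by rewrite subr0.
by rewrite -memv_ker lker_proj subvsP.
Qed.

HB.instance Definition _ := Lmodule_hasFinDim.Build K quotv quotv_vecaxiom.

End QuotientSpace.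

Lemma dim_quotv (K : fieldType) (vT : vectType K) (D I : {vspace vT}) :
  \dim {: quotv D I} = (\dim D - \dim (D :&: I))%N.
Proof.
rewrite dimvf /dim /= dimv_compl dimvf; congr (_ - _)%N.
rewrite -(limg_dim_eq (f := linfun vsval)); last first.
  apply/eqP; rewrite -subv0; apply/subvP=> x; rewrite memv_cap memv_ker lfunE /=.
  by case/andP=> _ /eqP x0; rewrite memv0; apply/eqP/val_inj.
congr (\dim _); apply/vspaceP=> v; rewrite memv_cap.
apply/memv_imgP/andP => [[x]|[vD vI]].
  by rewrite mem_quotv_ker lfunE => xI ->; rewrite subvsP.
exists (Subvs vD); last by rewrite lfunE.
by rewrite mem_quotv_ker.
Qed.

(* The n-th tensor power of the augmentation ideal of F_2[t] is identified    *)
(* with the span in F_2[t_1, ..., t_n] of the monomials t_1^m_1 ... t_n^m_n   *)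
(* (= t^m_1 (x) ... (x) t^m_n) in which all the m_i are positive.             *)

Definition tensor_mon n d (m : 'X_{1..n}) : bool :=
  (mdeg m == d) && [forall i, 0 < m i]%N.

Definition tensor_homog n d : {pred {mpoly 'F_2[n]}} :=
  [pred p | all (@tensor_mon n d) (msupp p)].

Section TensorPower.
Variables (n d : nat).

Lemma tensor_homogP (p : {mpoly 'F_2[n]}) :
  reflect (forall m, p@_m != 0 -> tensor_mon d m) (p \in @tensor_homog n d).
Proof.
apply: (iffP allP) => H m; first by rewrite -mcoeff_msupp; apply: H.
by rewrite mcoeff_msupp; apply: H.
Qed.

Lemma tensor_homog_submod_closed : submod_closed (@tensor_homog n d).
Proof.
split=> [|a p q /tensor_homogP Hp /tensor_homogP Hq].
  by apply/tensor_homogP => m; rewrite mcoeff0 eqxx.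
apply/tensor_homogP => m; rewrite mcoeffD mcoeffZ.
have [q0|/Hq //] := eqVneq q@_m 0.
by rewrite q0 addr0 mulf_eq0 negb_or; case/andP=> _ /Hp.
Qed.

HB.instance Definition _ :=
  GRing.isSubmodClosed.Build 'F_2 {mpoly 'F_2[n]} (@tensor_homog n d)
    tensor_homog_submod_closed.

Record tensorP : predArgType := TensorP {
  tensorP_val :> {mpoly 'F_2[n]};
  _ : tensorP_val \in @tensor_homog n d
}.

HB.instance Definition _ := [isSub for tensorP_val].
HB.instance Definition _ := [Choice of tensorP by <:].
HB.instance Definition _ := [SubChoice_isSubLmodule of tensorP by <:].

Definition tensor_basis : {set 'X_{1..n < d.+1}} := [set m | tensor_mon d (bmnm m)].

Lemma tensorP_vecaxiom : vector_axiom #|tensor_basis| tensorP.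
Proof.
pose f (p : tensorP) : 'rV['F_2]_(#|tensor_basis|) :=
  \row_i (val p)@_(bmnm (enum_val i)).
exists f => [a p q|].
  by apply/rowP => i; rewrite !mxE /= mcoeffD mcoeffZ.
pose g0 (r : 'rV['F_2]_(#|tensor_basis|)) : {mpoly 'F_2[n]} :=
  \sum_i r 0 i *: 'X_[bmnm (enum_val i)].
have g0P r : g0 r \in @tensor_homog n d.
  rewrite rpred_sum // => i _; rewrite rpredZ //.
  have := enum_valP i; rewrite inE => Hi.
  by apply/tensor_homogP => m; rewrite mcoeffX; case: (_ =P m) => [<-|] //=.
exists (fun r => TensorP (g0P r)) => [p|r]; last first.
  apply/rowP => i; rewrite mxE /= raddf_sum (bigD1 i) //= mcoeffZ mcoeffX eqxx.
  rewrite mulr1 big1 ?addr0 // => j neq_ji; rewrite mcoeffZ mcoeffX.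
  by rewrite -(inj_eq enum_val_inj) in neq_ji; rewrite -bmeqP (negPf neq_ji) mulr0.
apply: val_inj; apply/mpolyP => m /=; rewrite /g0 raddf_sum /=.
have [Hm|Hm] := boolP (tensor_mon d m); last first.
  rewrite big1 => [|i _].
    by apply/esym/eqP; apply: contraNT Hm; apply/tensor_homogP/valP.
  rewrite mcoeffZ mcoeffX; have := enum_valP i; rewrite inE => Hi.
  by case: (_ =P m) => [E|_]; [rewrite -E Hi in Hm|rewrite mulr0].
have ltmd : (mdeg m < d.+1)%N by case/andP: Hm => /eqP ->.
have mB : BMultinom ltmd \in tensor_basis by rewrite inE.
rewrite (bigD1 (enum_rank_in mB (BMultinom ltmd))) //= mxE enum_rankK_in //=.
rewrite mcoeffZ mcoeffX eqxx mulr1 big1 ?addr0 // => i ne_i.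
rewrite mcoeffZ mcoeffX; case: (_ =P m) => [E|]; last by rewrite mulr0.
case/eqP: ne_i; apply: enum_val_inj; rewrite enum_rankK_in //.
exact: val_inj.
Qed.

HB.instance Definition _ := Lmodule_hasFinDim.Build 'F_2 tensorP tensorP_vecaxiom.

End TensorPower.

(* Iterated Cartan formula: Sq^j (t^m_1 (x) ... (x) t^m_n) is the sum over    *)
(* b_1 + ... + b_n = j of Sq^b_1 t^m_1 (x) ... (x) Sq^b_n t^m_n, where        *)
(* Sq^b t^m = 'C(m, b) t^(m + b).                                             *)
Definition sq_mon n (j : nat) (m : 'X_{1..n}) : {mpoly 'F_2[n]} :=
  \sum_(b : 'X_{1..n < j.+1} | mdeg b == j)
     (\prod_(i < n) 'C(m i, b i))%:R *: 'X_[(m + b)%MM].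

Definition sq n (j : nat) (p : {mpoly 'F_2[n]}) : {mpoly 'F_2[n]} :=
  \sum_(m <- msupp p) p@_m *: sq_mon j m.

Lemma sqwE n j k (p : {mpoly 'F_2[n]}) : (msize p <= k)%N ->
  sq j p = \sum_(m : 'X_{1..n < k}) p@_m *: sq_mon j m.
Proof.
move=> le_pk; pose I : subFinType _ := 'X_{1..n < k}.
rewrite /sq (big_mksub I) ?msupp_uniq //=; first last.
  by move=> m /msize_mdeg_lt /leq_trans; apply.
rewrite big_rmcond //= => m /memN_msupp_eq0 ->.
by rewrite scale0r.
Qed.

Lemma sq_is_linear n j : linear (@sq n j).
Proof.
move=> a p q; pose k := maxn (msize (a *: p + q)) (maxn (msize p) (msize q)).
rewrite !(@sqwE _ _ k) ?leq_max ?leqnn ?orbT //.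
rewrite scaler_sumr -big_split /=; apply: eq_bigr => m _.
by rewrite mcoeffD mcoeffZ scalerDl scalerA.
Qed.

HB.instance Definition _ n j := GRing.isLinear.Build
  'F_2 {mpoly 'F_2[n]} {mpoly 'F_2[n]} _ (@sq n j) (@sq_is_linear n j).

Lemma sqX n j (m : 'X_{1..n}) : sq j 'X_[m] = sq_mon j m.
Proof. by rewrite /sq msuppX big_seq1 mcoeffX eqxx scale1r. Qed.

Lemma sq_tensor_homog n j d (p : {mpoly 'F_2[n]}) :
  p \in @tensor_homog n d -> sq j p \in @tensor_homog n (d + j).
Proof.
move=> /tensor_homogP Hp; rewrite /sq big_seq rpred_sum // => m.
rewrite mcoeff_msupp => /Hp /andP[/eqP dm /forallP m_gt0].
rewrite rpredZ // rpred_sum // => b /eqP db; rewrite rpredZ //.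
apply/tensor_homogP => m'; rewrite mcoeffX; case: (_ =P m') => [<- _|] //.
rewrite /tensor_mon mdegD dm db eqxx; apply/forallP => i.
by rewrite mnmDE ltn_addr.
Qed.

(* The component of Sq^j from degree d to degree e, which is Sq^j when        *)
(* e = d + j (lemma sq_homE); having e free avoids casts between degrees that *)
(* are only provably equal.                                                   *)
Definition sq_hom n (j d e : nat) : 'Hom(tensorP n d, tensorP n e) :=
  linfun (fun p : tensorP n d =>
            if e == (d + j)%N then insubd (0 : tensorP n e) (sq j (val p))
            else 0).

Lemma sq_homE n j d e (p : tensorP n d) :
  e = (d + j)%N -> val (sq_hom n j d e p) = sq j (val p).
Proof.
move=> ->{e}; pose f (p : tensorP n d) : tensorP n (d + j) :=
  if (d + j == d + j)%N then insubd (0 : tensorP n (d + j)) (sq j (val p)) else 0.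
have valf q : val (f q) = sq j (val q).
  by rewrite /f eqxx val_insubd sq_tensor_homog //; apply: valP.
have lin_f : linear f.
  by move=> a x y; apply: val_inj; rewrite linearP /= !valf linearP.
pose fL := GRing.isLinear.Build _ _ _ _ f lin_f.
pose F : {linear tensorP n d -> tensorP n (d + j)} := HB.pack f fL.
by rewrite -valf -[f p]/(F p) -(lfunE F).
Qed.

(* Isub k n d and Dsub k n d are the degree d parts of I_M(k) and D_M(k) for  *)
(* M the n-th tensor power. As M vanishes in negative degrees, Sq^(2^i)       *)
(* contributes to I_M(k) in degree d only if 2^i <= d.                        *)
Definition Isub (k n d : nat) : {vspace tensorP n d} :=
  (\sum_(i < k.+1 | (2 ^ i <= d)%N) limg (sq_hom n (2 ^ i) (d - 2 ^ i) d))%VS.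

Definition Dsub (k n d : nat) : {vspace tensorP n d} :=
  (\sum_(i < k.+1)
     lker (sq_hom n (2 ^ i.+1 - 1) d (d + (2 ^ i.+1 - 1))))%VS.

(* I_M(k) is contained in D_M(k) since Sq^(2^(i+1)-1) Sq^(2^i) = 0.           *)
Definition U (k n d : nat) : vectType 'F_2 := quotv (Dsub k n d) (Isub k n d).

(* Formal power series over Z in s and t: f n d is the coefficient of s^n t^d *)
Definition series2 := nat -> nat -> int.

Definition series2_mul (f g : series2) : series2 := fun n d =>
  \sum_(i < n.+1) \sum_(j < d.+1) f i j * g (n - i)%N (d - j)%N.

(* Polynomials in s and t are represented in {poly {poly int}}, with s the    *)
(* outer variable 'X and t the inner variable 'X%:P.                          *)
Definition series2_of_poly (p : {poly {poly int}}) : series2 :=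
  fun n d => p`_n`_d.

(* U is only considered for n >= 1: the terms with n = 0 are set to 0.        *)
Definition poincareU (k : nat) : series2 := fun n d =>
  if (1 <= n)%N then (\dim {: U k n d})%:Z else 0.

(* Main.v *)
Require Import Defs.
From HB Require Import structures.
From mathcomp Require Import all_boot all_order all_algebra.
From mathcomp Require Import ring zify.
From mathcomp Require Import mpoly.

(** Write a = Sq^1 and b = Sq^2. Then Sq^3 = ab, and A(1) is generated by a and b
subject to aa = 0 and bb = aba. Let V_n be the n-th tensor power of the
augmentation ideal, that is, the span of the monomials of F_2[t_1, ..., t_n]
in which every t_i occurs. The theorem concerns
U(M) = (ker a + ker ab) / (im a + im b) for M = V_n.

On the free module A(1) one has ker a = im a and ker ab = im b, so U vanishes
there, and U(M) only depends on M up to free summands. A bounded below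
A(1)-module is free as soon as it has no homology with respect to a and to
Q = ab + ba (Adams and Margolis). Hence, if W is a submodule of V_n such that
V_n / W has no such homology, then U(W) = U(V_n). The consequence of freeness
that matters is the equality ker ab = im b in V_n / W, which [ker_ab_im_b]
derives from the vanishing of the two homologies by an induction on the degree
([ker_bb]); W is then compared with V_n by [ker_ab_mod_im_b] and [sub_hit].

A homotopy in one variable shows that V_n has no a-homology, and homotopies in
all of the variables that its Q-homology is the line spanned by
t_1^2 ... t_n^2 ([q1_homology], [sqr_class_not_q1]). So one may take
W = E (x) V_1 for any finite submodule E of V_(n-1) in which the Q-homology is
again spanned by a representative of the product of the squares. If
n - 1 = 4m + r with r < 4, then E is the product of m copies of an element of
V_4 and of a module X_r:

- the sum of the monomial symmetric functions of t_1^4 t_2^2 t_3 t_4 and of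
  t_1^2 t_2^2 t_3^2 t_4^2 in four variables has degree 8, is killed by a and b,
  and represents the product of the squares ([Sq1_bott], [Sq2_bott], [bott_Q1]).
  This element is the source of the periodicity;

- X_0 = F_2, X_1 is spanned by t, t^2, t^4 (the question mark), X_2 is generated
  by t_1 t_2 (the joker A(1) / A(1) Sq^3), and X_3 is generated by
  a(t_1 t_2 t_3) (the upside-down question mark).

It remains to compute U(E (x) V_1), which is a calculation with the exponents
modulo 4 in F_2[t]. Modulo hit elements every element of E (x) V_1 can be moved
onto the generator xi of E, and the outcome is that xi (x) t is the only class
for r = 0 and r = 1 ([invariant_ker_sq3], [question_mark_ker_sq3]) and that
there is none for r = 2 and r = 3 ([joker_ker_sq3],
[dual_question_mark_ker_sq3]). The degree of xi (x) t is 8m + 1 for r = 0 and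
8m + 2 for r = 1. *)

Set Implicit Arguments.
Unset Strict Implicit.
Unset Printing Implicit Defensive.

Import GRing.Theory.
Local Open Scope ring_scope.

(** * Exactness in modules over Sq^1 and Sq^2 *)

Lemma addr_pair_eq (C : zmodType) (char2 : forall x : C, x + x = 0) (x y : C) :
  x + y = 0 -> x = y.
Proof. by move/eqP; rewrite addr_eq0 => /eqP ->; apply/eqP; rewrite eq_sym -addr_eq0 char2. Qed.

Lemma addr_pairK (C : zmodType) (char2 : forall x : C, x + x = 0) (x y : C) :
  x + y + y = x.
Proof. by rewrite -addrA char2 addr0. Qed.

Lemma mulrn_char2 (V : zmodType) (char2 : forall x : V, x + x = 0) (x : V) k :
  x *+ k = if odd k then x else 0.
Proof.
elim: k => [|k IH] //=; rewrite mulrSr IH.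
by case: (odd k); rewrite /= ?char2 ?add0r.
Qed.

(** Equations between sums in characteristic 2 are proved by moving everything to
    one side and cancelling equal terms in pairs. *)
Ltac cancel_last H x :=
  lazymatch goal with
  | |- context [ x + x ] => rewrite (H x) ?add0r
  | |- context [ ?S + x + x ] => rewrite (addr_pairK H S x)
  | |- context [ ?S + ?y + x ] => rewrite (addrAC S y x); cancel_last H x
  end.
Ltac cancel_pairs H :=
  apply: (addr_pair_eq H); rewrite ?addr0 ?add0r ?addrA;
  repeat (lazymatch goal with |- _ + ?x = 0 => cancel_last H x end); try reflexivity.

Section AbstractA1Module.
Variables (C : zmodType) (a b : {additive C -> C}).
Hypothesis char2 : forall x : C, x + x = 0.
Hypothesis aa : forall x, a (a x) = 0.
Hypothesis bb : forall x, b (b x) = a (b (a x)).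

Let moveC (x y z : C) : x + y = z -> x = z + y.
Proof. by move=> <-; rewrite addr_pairK. Qed.

Let abb x : a (b (b x)) = 0. Proof. by rewrite bb aa. Qed.
Let bba x : b (b (a x)) = 0. Proof. by rewrite bb aa !raddf0. Qed.

(** The Milnor primitive Q1 = Sq^3 + Sq^2 Sq^1. *)
Definition q1 (x : C) := a (b x) + b (a x).

Lemma q1D : {morph q1 : x y / x + y}.
Proof. by move=> x y; rewrite /q1 !raddfD /= addrACA. Qed.

Lemma a_q1 x : a (q1 x) = b (b x).
Proof. by rewrite raddfD /= aa add0r bb. Qed.

Lemma q1_a x : q1 (a x) = b (b x).
Proof. by rewrite /q1 aa raddf0 addr0 bb. Qed.

Lemma q1_b x : q1 (b x) = b (q1 x).
Proof. by rewrite /q1 raddfD /= abb bba add0r addr0. Qed.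

Lemma q1_q1 x : q1 (q1 x) = 0.
Proof. by rewrite {1}/q1 a_q1 -q1_b a_q1 char2. Qed.

Section ExteriorFree.
Variable B : nat -> C -> Prop.
Hypothesis B0 : forall x, B 0 x -> x = 0.
Hypothesis Bex : forall x, exists d, B d x.
Hypothesis q0_exact : forall x, a x = 0 -> exists y, x = a y.
Hypothesis q1_exact : forall d x,
  B d x -> q1 (a x) = 0 -> exists2 y, B d.-1 y & a x = q1 y.

(** Freeness over the exterior algebra on a and Q, in the form
    ker aQ = im a + im Q (note that aQ = bb). If aQx = 0, then Q kills ax, so
    ax = Qy with y of lower degree than x, and aQy = 0. By induction
    y = as + Qt, whence ax = Qas = aQs, and x - Qs is in ker a = im a.
    The predicate B d stands for the elements of degree less than d. *)
Lemma ker_bb x : b (b x) = 0 -> exists p q, x = a p + q1 q.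
Proof.
have [d] := Bex x; elim: d x => [|d IH] x Bx bbx.
  by exists 0, 0; rewrite (B0 Bx) /q1 !raddf0 !addr0.
have [|y By axy] := q1_exact Bx; first by rewrite q1_a.
have [|p [q Dy]] := IH y By; first by rewrite -a_q1 -axy aa.
have : a (x + q1 p) = 0.
  by rewrite raddfD /= axy Dy q1D q1_q1 addr0 q1_a a_q1 char2.
by case/q0_exact=> r /moveC ->; exists r, p.
Qed.
End ExteriorFree.

Hypothesis ker_bb_im : forall x, b (b x) = 0 -> exists p q, x = a p + q1 q.

(** The socle of A(1) is spanned by bbb, so this says that the module is free.
    It follows from freeness over the exterior algebra because bb = aQ: from
    bx = ay + Qz one gets aQ(ax + y + bz) = 0, which lets one rewrite
    bx = b(bq + az), and then x + bq + az is in ker bb. *)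
Lemma ker_top x : b (b (b x)) = 0 -> exists p q, x = a p + b q.
Proof.
move/ker_bb_im => [y [z Dbx]].
have [|p [q Dt]] := ker_bb_im (x := a x + y + b z).
  have := congr1 (fun u => a (b u)) Dbx.
  by rewrite /= abb !raddfD /= !bba raddf0 addr0 add0r -!bb => <-.
have Dy : a y = a (b z) + b (b q).
  have := congr1 a Dt; rewrite [RHS]raddfD a_q1 aa add0r => <-.
  by rewrite !raddfD /= aa; cancel_pairs char2.
have Du : b (x + b q + a z) = 0.
  by rewrite !raddfD /= Dbx Dy /q1; cancel_pairs char2.
have [|r [s Dr]] := ker_bb_im (x := x + b q + a z); first by rewrite Du raddf0.
exists (r + b s + z), (q + a s).
by rewrite !raddfD /=; move: Dr; rewrite /q1 => /moveC/moveC ->; cancel_pairs char2.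
Qed.

(** In A(1), the right annihilator of ab is the right ideal generated by b. *)
Lemma ker_ab_im_b x : a (b x) = 0 -> exists y, x = b y.
Proof.
move=> abx; have [|p [q Dx]] := ker_top (x := x); first by rewrite bb -bb bb abx !raddf0.
have bbp : b (b p) = 0.
  by have := abx; rewrite Dx !raddfD /= abb addr0 -bb.
have [|p1 [p2 Dp]] := ker_top (x := p); first by rewrite bbp raddf0.
have [|r [s Ds]] := ker_top (x := p2).
  by have := abx; rewrite Dx Dp !raddfD /= aa abb raddf0 raddf0 add0r addr0 bb.
exists (b r + q); rewrite Dx Dp Ds !raddfD /= aa add0r -bb abb addr0 //.
Qed.
End AbstractA1Module.

Section Comparison.
Import Quotient.
Local Open Scope quotient_scope.
Variables (N : zmodType) (a b : {additive N -> N}) (W : zmodClosed N).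
Hypothesis char2 : forall x : N, x + x = 0.
Hypothesis aa : forall x, a (a x) = 0.
Hypothesis bb : forall x, b (b x) = a (b (a x)).
Hypothesis aW : forall x, x \in W -> a x \in W.
Hypothesis bW : forall x, x \in W -> b x \in W.
Hypothesis q0_exact : forall x, a x \in W -> exists y, x - a y \in W.
Variable B : nat -> N -> Prop.
Hypothesis B0 : forall x, B 0 x -> x = 0.
Hypothesis Bex : forall x, exists d, B d x.
Hypothesis q1_exact : forall d x,
  B d x -> q1 a b (a x) \in W -> exists2 y, B d.-1 y & a x - q1 a b y \in W.

Local Notation C := {quot W}.

Lemma pi_eq0 (x : N) : (\pi_C x == 0) = (x \in W).
Proof. by rewrite -[0](raddf0 \pi_C) -idealrBE subr0. Qed.

Lemma pi_eq (x y : N) : (\pi_C x == \pi_C y) = (x - y \in W).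
Proof. by rewrite -idealrBE. Qed.

Lemma induced_additive (f : {additive N -> N}) :
  (forall x, x \in W -> f x \in W) ->
  exists g : {additive C -> C}, forall x, g (\pi_C x) = \pi_C (f x).
Proof.
move=> fW; pose g (c : C) : C := \pi_C (f (repr c)).
have gE x : g (\pi_C x) = \pi_C (f x).
  by apply/eqP; rewrite pi_eq -raddfB fW // -pi_eq reprK.
have gB : zmod_morphism g.
  by move=> c d; rewrite -(reprK c) -(reprK d) -raddfB !gE !raddfB.
pose gA : {additive C -> C} := HB.pack g (GRing.isZmodMorphism.Build C C g gB).
by exists gA.
Qed.

(** The elements killed by ab come from W, up to im b: the quotient by W has no
    homology for a and q1, so that [ker_ab_im_b] applies to it. *)
Lemma ker_ab_mod_im_b x : a (b x) \in W -> exists y, x - b y \in W.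
Proof.
have [aC aCE] := induced_additive aW; have [bC bCE] := induced_additive bW.
have q1CE z : q1 aC bC (\pi_C z) = \pi_C (q1 a b z).
  by rewrite /q1 bCE !aCE bCE [RHS]raddfD.
have char2C (c : C) : c + c = 0 by rewrite -(reprK c) -raddfD char2 raddf0.
have aaC (c : C) : aC (aC c) = 0 by rewrite -(reprK c) !aCE aa raddf0.
have bbC (c : C) : bC (bC c) = aC (bC (aC c)).
  by rewrite -(reprK c) !(aCE, bCE) bb.
have ker_bbC c : bC (bC c) = 0 -> exists p q, c = aC p + q1 aC bC q.
  apply: (@ker_bb _ _ _ char2C aaC bbC (fun d c => exists2 x, B d x & \pi_C x = c)).
  - by move=> _ [y /B0 -> <-]; rewrite raddf0.
  - move=> {}c; have [d Bd] := Bex (repr c).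
    by exists d, (repr c) => //; rewrite reprK.
  - move=> {}c; rewrite -(reprK c) aCE => /eqP; rewrite pi_eq0 => /q0_exact[y].
    by rewrite -pi_eq => /eqP ->; exists (\pi_C y); rewrite aCE.
  - move=> d _ [y By <-] /eqP; rewrite aCE q1CE pi_eq0 => /(q1_exact By)[z Bz].
    by rewrite -pi_eq => /eqP ->; exists (\pi_C z); [exists z | rewrite q1CE].
rewrite -pi_eq0 -aCE -bCE => /eqP /(ker_ab_im_b char2C aaC bbC ker_bbC) [c Dx].
by exists (repr c); rewrite -pi_eq Dx -{1}(reprK c) bCE.
Qed.

(** The elements of W that are hit in N are hit in W. If w = au + bv, then ab
    kills v modulo W, so v = bs modulo W; then a(u + bas) is in W, and u + bas
    is in W + im a. *)
Lemma sub_hit w u v : w \in W -> w = a u + b v ->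
  exists p q, [/\ p \in W, q \in W & w = a p + b q].
Proof.
move=> Ww Dw.
have [|s Ws] := ker_ab_mod_im_b (x := v).
  by have := aW Ww; rewrite Dw raddfD /= aa add0r.
set z := v - b s in Ws.
have Dv : b v = b z + a (b (a s)) by rewrite -bb -raddfD subrK.
have [|r Wr] := q0_exact (x := u + b (a s)).
  have := rpredB Ww (bW Ws); rewrite Dw Dv raddfD /=.
  by rewrite [b z + _]addrC addrA addrK.
exists (u + b (a s) - a r), z; split => //.
rewrite Dw Dv raddfB raddfD /= aa subr0.
by rewrite [b z + _]addrC addrA.
Qed.
End Comparison.

(** * The Cartan formula and the Adem relations *)

Lemma mpoly_char2 n (x : {mpoly 'F_2[n]}) : x + x = 0.
Proof. have two0 : 1 + 1 = 0 :> 'F_2 by apply: val_inj.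
by rewrite -[x]scale1r -scalerDl two0 scale0r. Qed.

Lemma mcoeffXM n (R : comNzRingType) (u k : 'X_{1..n}) (p : {mpoly R[n]}) :
  ('X_[u] * p)@_k = if (u <= k)%MM then p@_(k - u) else 0.
Proof.
rewrite mulrC; have [le_uk|nle_uk] := boolP (u <= k)%MM.
  by rewrite -{1}(submK le_uk) addmC mcoeffMX.
have := perm_mem (msuppMX p u) k => Ek; apply/eqP; rewrite mcoeff_eq0 Ek.
by apply: contra nle_uk => /mapP[m _ ->]; apply: lem_addr.
Qed.

(** At most one summand of the Cartan expansion contributes to a given monomial. *)
Lemma mcoeff_sq_mon n j (m k : 'X_{1..n}) :
  (sq_mon j m)@_k = if (m <= k)%MM && (mdeg (k - m) == j) then
     (\prod_(i < n) 'C(m i, (k - m)%MM i))%:R else 0.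
Proof.
rewrite /sq_mon raddf_sum /=; case: ifP => [/andP[le_mk /eqP dj]|cond].
  have lt_j : (mdeg (k - m) < j.+1)%N by rewrite dj.
  rewrite (bigD1 (BMultinom lt_j)) /= ?dj ?eqxx // mcoeffZ mcoeffX.
  rewrite addmC submK // eqxx mulr1 [X in _ + X]big1 ?addr0 // => b /andP[_ neq_b].
  rewrite mcoeffZ mcoeffX; case: eqP => [E|]; last by rewrite mulr0.
  by case/eqP: neq_b; apply: val_inj; rewrite /= -E addmC addmK.
rewrite big1 // => b /eqP db; rewrite mcoeffZ mcoeffX.
case: eqP => [E|]; last by rewrite mulr0.
by move: cond; rewrite -E lem_addr [(m + b)%MM]addmC addmK db eqxx.
Qed.

(** The Cartan formula for multiplication by a variable is Pascal's rule for the
    exponent of that variable. *)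
Lemma sq_mon_mulX n j i (m : 'X_{1..n}) :
  sq_mon j.+1 (U_(i) + m)%MM =
  'X_i * sq_mon j.+1 m + 'X_i ^+ 2 * sq_mon j m :> {mpoly 'F_2[n]}.
Proof.
apply/mpolyP => k; rewrite mcoeffD expr2 -mpolyXD !mcoeffXM !mcoeff_sq_mon.
have guard (u : 'X_{1..n}) X (c : 'F_2) :
    (if (u <= k)%MM then if (m <= k - u)%MM && X then c else 0 else 0) =
    if (u + m <= k)%MM && X then c else 0.
  case: (boolP (u <= k)%MM) => /mnm_lepP le_uk.
    suff -> : (m <= k - u)%MM = (u + m <= k)%MM by [].
    by apply/mnm_lepP/mnm_lepP => H l; move: (H l) (le_uk l);
       rewrite ?mnmDE ?mnmBE; lia.
  rewrite (_ : (u + m <= k)%MM = false) //; apply/negbTE.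
  by apply/mnm_lepP => H; case: le_uk => l; move: (H l); rewrite mnmDE; lia.
rewrite !guard.
have [le_k|nle_k] := boolP (U_(i) + m <= k)%MM; last first.
  rewrite (_ : (U_(i) + U_(i) + m <= k)%MM = false) ?addr0 //=; apply/negbTE.
  apply: contra nle_k => /mnm_lepP H; apply/mnm_lepP => l.
  by move: (H l); rewrite !mnmDE; lia.
have Dk : k = (U_(i) + m + (k - (U_(i) + m)))%MM by rewrite addmC submK.
move: (k - (U_(i) + m))%MM Dk => d ->; rewrite /=.
have Ed1 : (U_(i) + m + d - U_(i))%MM = (m + d)%MM.
  by rewrite -addmA addmC addmK.
have Ed2 : (m + d - m)%MM = d by rewrite addmC addmK.
rewrite Ed1 Ed2.
have splitP u v : (\prod_(l < n) 'C(u l, v l) =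
    'C(u i, v i) * \prod_(l < n | l != i) 'C(u l, v l))%N.
  by rewrite (bigD1 i).
have [d0|d_gt0] := posnP (d i).
  rewrite [X in _ + X](_ : _ = 0) ?addr0; last first.
    case: ifP => // /andP[/mnm_lepP/(_ i)].
    by rewrite !mnmDE mnm1E eqxx d0; lia.
  case: ifP => // _; congr (_%:R); apply: eq_bigr => l _.
  rewrite mnmDE mnm1E; case: eqP => [<-|] //=; by rewrite d0 !bin0.
have Dd : d = (U_(i) + (d - U_(i)))%MM by rewrite addmC submK // lep1mP -lt0n.
move: (d - U_(i))%MM Dd => e Dd; rewrite Dd {d Ed1 Ed2 d_gt0 Dd}; rename e into d.
have -> : (U_(i) + U_(i) + m <= U_(i) + m + (U_(i) + d))%MM.
  by apply/mnm_lepP => l; rewrite !mnmDE; lia.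
have -> : (U_(i) + m + (U_(i) + d) - (U_(i) + U_(i)))%MM = (m + d)%MM.
  by apply/mnmP => l; rewrite !(mnmBE, mnmDE); lia.
have -> : (m + d - m)%MM = d by rewrite addmC addmK.
rewrite mdegD mdeg1 add1n eqSS /=; case: ifP => _; last by rewrite addr0.
rewrite -natrD; congr (_%:R); rewrite !splitP !mnmDE mnm1E eqxx !add1n binS.
rewrite mulnDl; congr (_ * _ + _ * _)%N.
  by apply: eq_bigr => l; rewrite !mnmDE mnm1E eq_sym => /negbTE ->.
by apply: eq_bigr => l; rewrite !mnmDE mnm1E eq_sym => /negbTE ->.
Qed.

Lemma sqS_mulX n j i (p : {mpoly 'F_2[n]}) :
  sq j.+1 ('X_i * p) = 'X_i * sq j.+1 p + 'X_i ^+ 2 * sq j p.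
Proof.
elim/mpolyind: p => [|c m p _ _ IH]; first by rewrite mulr0 !linear0 !mulr0 addr0.
rewrite mulrDr -scalerAr -mpolyXD !linearP /= IH !sqX sq_mon_mulX.
by rewrite !mulrDr scalerDr -!scalerAr addrACA.
Qed.

Lemma sq0 n (p : {mpoly 'F_2[n]}) : sq 0 p = p.
Proof.
elim/mpolyind: p => [|c m p _ _ IH]; first by rewrite linear0.
rewrite linearP /= IH sqX; congr (_ *: _ + _); apply/mpolyP => k.
rewrite mcoeff_sq_mon mcoeffX; have [<-|neq_mk] := eqVneq m k.
  have -> : (m - m)%MM = 0%MM by apply/mnmP => i; rewrite mnmBE subnn mnm0E.
  by rewrite lepm_refl mdeg0 big1 // => i _; rewrite mnm0E bin0.
case: ifP => // /andP[le_mk]; rewrite mdeg_eq0 => /eqP km0.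
by rewrite -(submK le_mk) km0 add0m eqxx in neq_mk.
Qed.

Lemma sqS_1 n j : sq j.+1 (1 : {mpoly 'F_2[n]}) = 0.
Proof.
rewrite -mpolyX0 sqX; apply/mpolyP => k; rewrite mcoeff_sq_mon mcoeff0.
case: ifP => // /andP[_]; rewrite mdegE => dk.
have [i ki] : exists i, (0 < (k - 0)%MM i)%N.
  apply/existsP; apply: contraTT dk => /existsPn k0.
  by rewrite big1 // => i _; apply/eqP; rewrite -leqn0 leqNgt k0.
by rewrite (bigD1 i) //= mnm0E bin0n eqn0Ngt ki mul0n.
Qed.

(** Opaque copy of [sq], which keeps the sums over monomials folded. *)
HB.lock Definition Sq n j (p : {mpoly 'F_2[n]}) : {mpoly 'F_2[n]} := sq j p.

Lemma SqE n j (p : {mpoly 'F_2[n]}) : Sq j p = sq j p.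
Proof. by rewrite Sq.unlock. Qed.

Lemma Sq_is_linear n j : linear (@Sq n j).
Proof. by move=> c p q; rewrite !SqE linearP. Qed.
HB.instance Definition _ n j := GRing.isLinear.Build
  'F_2 {mpoly 'F_2[n]} {mpoly 'F_2[n]} _ (@Sq n j) (@Sq_is_linear n j).

Lemma SqD n j (p q : {mpoly 'F_2[n]}) : Sq j (p + q) = Sq j p + Sq j q.
Proof. exact: linearD. Qed.

Lemma Sq_0 n j : Sq j (0 : {mpoly 'F_2[n]}) = 0.
Proof. exact: linear0. Qed.

Lemma SqZ n j c (p : {mpoly 'F_2[n]}) : Sq j (c *: p) = c *: Sq j p.
Proof. exact: linearZ. Qed.

Lemma Sq0 n (p : {mpoly 'F_2[n]}) : Sq 0 p = p.
Proof. by rewrite SqE sq0. Qed.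

Lemma SqS_1 n j : Sq j.+1 (1 : {mpoly 'F_2[n]}) = 0.
Proof. by rewrite SqE sqS_1. Qed.

Lemma SqS_mulX n j i (p : {mpoly 'F_2[n]}) :
  Sq j.+1 ('X_i * p) = 'X_i * Sq j.+1 p + 'X_i ^+ 2 * Sq j p.
Proof. by rewrite !SqE sqS_mulX. Qed.

(** Over F_2 there are no scalars to consider besides 0 and 1. *)
Lemma mpoly_F2_ind n (P : {mpoly 'F_2[n]} -> Prop) :
    P 1 -> (forall p q, P p -> P q -> P (p + q)) ->
    (forall i p, P p -> P ('X_i * p)) ->
  forall p, P p.
Proof.
move=> P1 PD PX; have P0 : P 0 by rewrite -(mpoly_char2 1); apply: PD.
elim/mpolyind => [//|c m p _ _ IH]; apply: PD => //.
have [->|->] : c = 0 \/ c = 1.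
  by case: c => -[|[|//]] lt; [left | right]; apply: val_inj.
  by rewrite scale0r.
rewrite scale1r mpolyXE_id; elim/big_rec: _ => // i q _ Pq.
by elim: (m i) => [|e IHe]; rewrite ?mul1r // exprS -mulrA; apply: PX.
Qed.

Lemma Sq1M n (p q : {mpoly 'F_2[n]}) : Sq 1 (p * q) = Sq 1 p * q + p * Sq 1 q.
Proof.
elim/mpoly_F2_ind: p => [|p p' IH IH'|i p IH].
- by rewrite SqS_1 !mul1r mul0r add0r.
- by rewrite mulrDl !SqD IH IH'; ring.
- by rewrite -mulrA !SqS_mulX !Sq0 IH; ring.
Qed.

Lemma Sq2M n (p q : {mpoly 'F_2[n]}) :
  Sq 2 (p * q) = Sq 2 p * q + Sq 1 p * Sq 1 q + p * Sq 2 q.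
Proof.
elim/mpoly_F2_ind: p => [|p p' IH IH'|i p IH].
- by rewrite !SqS_1 !mul1r !mul0r !add0r.
- by rewrite mulrDl !SqD IH IH'; ring.
- by rewrite -mulrA !SqS_mulX !Sq0 IH Sq1M; ring.
Qed.

Lemma Sq1X n i : Sq 1 ('X_i : {mpoly 'F_2[n]}) = 'X_i ^+ 2.
Proof. by rewrite -['X_i in LHS]mulr1 SqS_mulX SqS_1 Sq0; ring. Qed.

Lemma Sq2X n i : Sq 2 ('X_i : {mpoly 'F_2[n]}) = 0.
Proof. by rewrite -['X_i in LHS]mulr1 SqS_mulX !SqS_1; ring. Qed.

Lemma Sq1_sqr n (p : {mpoly 'F_2[n]}) : Sq 1 (p ^+ 2) = 0.
Proof. by rewrite expr2 Sq1M mulrC mpoly_char2. Qed.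

Lemma Sq2_sqr n (p : {mpoly 'F_2[n]}) : Sq 2 (p ^+ 2) = Sq 1 p ^+ 2.
Proof. by rewrite expr2 Sq2M addrAC [Sq 2 p * p]mulrC mpoly_char2 add0r. Qed.

Lemma Sq1_Sq1 n (p : {mpoly 'F_2[n]}) : Sq 1 (Sq 1 p) = 0.
Proof.
elim/mpoly_F2_ind: p => [|p q IHp IHq|i p IH].
- by rewrite !SqS_1 Sq_0.
- by rewrite !SqD IHp IHq addr0.
by rewrite !(Sq1M, SqD, Sq1X, Sq1_sqr) IH mulr0 mul0r addr0 add0r mpoly_char2.
Qed.

(** Both sides satisfy the same rule for multiplication by a variable, since
    Sq^2 Sq^2 + Sq^3 Sq^1 is a primitive element of the Steenrod algebra; it
    vanishes on the variables. *)
Lemma Sq2_Sq2 n (p : {mpoly 'F_2[n]}) : Sq 2 (Sq 2 p) = Sq 1 (Sq 2 (Sq 1 p)).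
Proof.
elim/mpoly_F2_ind: p => [|p q IHp IHq|i p IH].
- by rewrite !SqS_1 !Sq_0.
- by rewrite !SqD IHp IHq.
rewrite !(Sq2M, Sq1M, SqD, Sq1X, Sq2X, Sq1_sqr, Sq2_sqr, Sq1_Sq1, Sq_0) IH.
by ring.
Qed.

Lemma Sq3_Sq1_Sq2 n (p : {mpoly 'F_2[n]}) : Sq 3 p = Sq 1 (Sq 2 p).
Proof.
elim/mpoly_F2_ind: p => [|p q IHp IHq|i p IH].
- by rewrite !SqS_1 !Sq_0.
- by rewrite !SqD IHp IHq.
rewrite SqS_mulX !(Sq2M, Sq1M, SqD, Sq1X, Sq2X, Sq1_sqr, Sq1_Sq1, Sq_0) IH.
by ring.
Qed.

(** * The Milnor primitive, truncation and positivity *)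

Lemma mpoly_oppr n (x : {mpoly 'F_2[n]}) : - x = x.
Proof. by apply/eqP; rewrite eq_sym -addr_eq0 mpoly_char2. Qed.

HB.lock Definition Q1 n (x : {mpoly 'F_2[n]}) : {mpoly 'F_2[n]} :=
  Sq 1 (Sq 2 x) + Sq 2 (Sq 1 x).

Lemma Q1E n (x : {mpoly 'F_2[n]}) : Q1 x = Sq 1 (Sq 2 x) + Sq 2 (Sq 1 x).
Proof. by rewrite Q1.unlock. Qed.

Lemma Q1D n (x y : {mpoly 'F_2[n]}) : Q1 (x + y) = Q1 x + Q1 y.
Proof. by rewrite !Q1E !SqD addrACA. Qed.

Lemma Q1Z n c (x : {mpoly 'F_2[n]}) : Q1 (c *: x) = c *: Q1 x.
Proof. by rewrite !Q1E !linearZ /= scalerDr. Qed.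

Lemma Q1_0 n : Q1 (0 : {mpoly 'F_2[n]}) = 0.
Proof. by rewrite !Q1E !Sq_0 addr0. Qed.

Lemma Q1M n (x y : {mpoly 'F_2[n]}) : Q1 (x * y) = Q1 x * y + x * Q1 y.
Proof.
rewrite !Q1E Sq2M Sq1M !SqD !Sq1M !Sq2M !Sq1_Sq1.
have D2 := mpoly_char2 (Sq 1 x * Sq 2 y + Sq 2 x * Sq 1 y).
by rewrite -[RHS]addr0 -[X in _ = _ + X]D2; ring.
Qed.

Lemma Q1X n i : Q1 ('X_i : {mpoly 'F_2[n]}) = 'X_i ^+ 4.
Proof. by rewrite !Q1E Sq2X Sq1X Sq2_sqr Sq1X Sq_0; ring. Qed.

Lemma Q1_1 n : Q1 (1 : {mpoly 'F_2[n]}) = 0.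
Proof. by rewrite !Q1E !SqS_1 !Sq_0 addr0. Qed.

Lemma Q1_sqr n (x : {mpoly 'F_2[n]}) : Q1 (x ^+ 2) = 0.
Proof. by rewrite expr2 Q1M mulrC mpoly_char2. Qed.

Lemma Q1_Q1 n (x : {mpoly 'F_2[n]}) : Q1 (Q1 x) = 0.
Proof.
rewrite !Q1E; exact: (@q1_q1 _ (@Sq n 1) (@Sq n 2) (@mpoly_char2 n) (@Sq1_Sq1 n) (@Sq2_Sq2 n)).
Qed.

HB.lock Definition trunc n d (p : {mpoly 'F_2[n]}) : {mpoly 'F_2[n]} :=
  \sum_(m : 'X_{1..n < d}) p@_m *: 'X_[m].

Lemma mcoeff_trunc n d (p : {mpoly 'F_2[n]}) m :
  (trunc d p)@_m = if (mdeg m < d)%N then p@_m else 0.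
Proof.
rewrite trunc.unlock raddf_sum /=; case: ifP => [lt_md|ge_md].
  rewrite (bigD1 (BMultinom lt_md)) //= mcoeffZ mcoeffX eqxx mulr1.
  rewrite big1 ?addr0 // => k neq_k; rewrite mcoeffZ mcoeffX.
  by rewrite -[m]/(bmnm (BMultinom lt_md)) -bmeqP (negbTE neq_k) mulr0.
rewrite big1 // => k _; rewrite mcoeffZ mcoeffX; case: eqP => [E|]; last by rewrite mulr0.
by move: ge_md; rewrite -E bmdeg.
Qed.

Lemma trunc_is_linear n d : linear (@trunc n d).
Proof.
move=> c p q; apply/mpolyP => m; rewrite !(mcoeffD, mcoeffZ, mcoeff_trunc).
by case: ifP; rewrite // mulr0 addr0.
Qed.
HB.instance Definition _ n d := GRing.isLinear.Build
  'F_2 {mpoly 'F_2[n]} {mpoly 'F_2[n]} _ (@trunc n d) (@trunc_is_linear n d).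

Lemma trunc0 n (p : {mpoly 'F_2[n]}) : trunc 0 p = 0.
Proof. by apply/mpolyP => m; rewrite mcoeff_trunc mcoeff0. Qed.

Lemma trunc_msize n (p : {mpoly 'F_2[n]}) : trunc (msize p) p = p.
Proof.
apply/mpolyP => m; rewrite mcoeff_trunc; case: ifP => // ge_m.
apply/esym/memN_msupp_eq0/negP => /msize_mdeg_lt; by rewrite ge_m.
Qed.

Lemma trunc_trunc n d e (p : {mpoly 'F_2[n]}) : (d <= e)%N ->
  trunc e (trunc d p) = trunc d p.
Proof.
move=> le_de; apply/mpolyP => m; rewrite !mcoeff_trunc.
by case: (ltnP (mdeg m) e) => // le_em; rewrite ltnNge (leq_trans le_de le_em).
Qed.

Lemma trunc_Sq n j d (p : {mpoly 'F_2[n]}) :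
  trunc d (Sq j p) = Sq j (trunc (d - j) p).
Proof.
rewrite !SqE.
elim/mpolyind: p => [|c m p _ _ IH]; first by rewrite !linear0.
rewrite !linearP /= IH; congr (_ *: _ + _); rewrite sqX.
have -> : trunc (d - j) 'X_[m] = if (mdeg m < d - j)%N then 'X_[m] else 0.
  apply/mpolyP => k; rewrite mcoeff_trunc; have [<-|neq_mk] := eqVneq m k.
    by case: ifP; rewrite ?mcoeff0.
  by rewrite mcoeffX (negbTE neq_mk); do 2?case: ifP => _;
     rewrite ?mcoeffX ?mcoeff0 ?(negbTE neq_mk).
have -> : sq j (if (mdeg m < d - j)%N then 'X_[m] else 0) =
    if (mdeg m < d - j)%N then sq_mon j m else 0.
  by case: ifP; rewrite ?sqX ?linear0.
apply/mpolyP => k; rewrite mcoeff_trunc.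
have [cond|] := boolP ((m <= k)%MM && (mdeg (k - m) == j)); last first.
  by move/negbTE => cond; do 2?case: ifP => _; rewrite ?mcoeff_sq_mon ?cond ?mcoeff0.
have -> : mdeg k = (mdeg m + j)%N.
  by case/andP: cond => le_mk /eqP <-; rewrite addnC -mdegD submK.
by rewrite ltn_subRL addnC; case: ifP; rewrite ?mcoeff0.
Qed.

(** The tensor power of the augmentation ideal, all degrees together: every
    variable occurs in every monomial. *)
Definition positive n : {pred {mpoly 'F_2[n]}} :=
  [pred p | all (fun m : 'X_{1..n} => [forall i, 0 < m i]%N) (msupp p)].
Arguments positive n : clear implicits.

Lemma positiveP n (p : {mpoly 'F_2[n]}) :
  reflect (forall m, p@_m != 0 -> forall i, (0 < m i)%N) (p \in positive n).
Proof.
apply: (iffP allP) => H m; first by rewrite -mcoeff_msupp => /H /forallP.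
by rewrite mcoeff_msupp => /H Hm; apply/forallP.
Qed.

Lemma positive_submod_closed n : submod_closed (positive n).
Proof.
split=> [|a p q /positiveP Hp /positiveP Hq].
  by apply/positiveP => m; rewrite mcoeff0 eqxx.
apply/positiveP => m; rewrite mcoeffD mcoeffZ.
have [q0|/Hq //] := eqVneq q@_m 0.
by rewrite q0 addr0 mulf_eq0 negb_or; case/andP=> _ /Hp.
Qed.
HB.instance Definition _ n := GRing.isSubmodClosed.Build 'F_2 {mpoly 'F_2[n]}
  (positive n) (@positive_submod_closed n).

Lemma positive_Sq n j p : p \in positive n -> Sq j p \in positive n.
Proof.
rewrite SqE.
move=> /positiveP Hp; rewrite /sq big_seq rpred_sum // => m.
rewrite mcoeff_msupp => /Hp m_gt0.
rewrite rpredZ // rpred_sum // => b _; rewrite rpredZ //.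
apply/positiveP => m'; rewrite mcoeffX; case: (_ =P m') => [<- _|] // i.
by rewrite mnmDE ltn_addr.
Qed.

Lemma positive_trunc n d p : p \in positive n -> trunc d p \in positive n.
Proof.
move/positiveP => Hp; apply/positiveP => m; rewrite mcoeff_trunc.
by case: ifP; rewrite ?eqxx // => _ /Hp.
Qed.

Lemma positive_dvd n (p : {mpoly 'F_2[n]}) :
  (forall i, exists q, p = 'X_i * q) -> p \in positive n.
Proof.
move=> dvp; apply/positiveP => m nz i; case: (dvp i) nz => q ->.
by rewrite mcoeffXM lep1mP lt0n; case: (m i == 0%N); rewrite ?eqxx.
Qed.

(** * Expansion in the last variable *)

Local Notation widen := (widen_ord (leqnSn _)).

Lemma ord_last_case n (i : 'I_n.+1) : i = ord_max \/ exists j : 'I_n, i = widen j.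
Proof.
case: (unliftP ord_max i) => [j ->|->]; [right | by left].
by exists j; apply: val_inj; rewrite /= /bump leqNgt ltn_ord.
Qed.

(** The inclusion of F_2[t_1, ..., t_n] in F_2[t_1, ..., t_(n+1)]. *)
HB.lock Definition incl n (k : {mpoly 'F_2[n]}) : {mpoly 'F_2[n.+1]} := mwiden k.
Lemma inclE n (k : {mpoly 'F_2[n]}) : incl k = mwiden k.
Proof. by rewrite incl.unlock. Qed.

(** With its inverse [to_coefs], the identification of F_2[t_1, ..., t_(n+1)]
    with the polynomials in the last variable over F_2[t_1, ..., t_n]. *)
HB.lock Definition of_coefs n (P : {poly {mpoly 'F_2[n]}}) : {mpoly 'F_2[n.+1]} :=
  (map_poly (@incl n) P).['X_ord_max].

HB.lock Definition to_coefs n (x : {mpoly 'F_2[n.+1]}) : {poly {mpoly 'F_2[n]}} :=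
  muni x.

Section LastVariable.
Variable n : nat.
Implicit Types (x y : {mpoly 'F_2[n.+1]}) (k : {mpoly 'F_2[n]}) (j d : nat).

Local Notation T := ('X_ord_max : {mpoly 'F_2[n.+1]}).

Lemma incl_is_zmod_morphism : zmod_morphism (@incl n).
Proof. by move=> p q; rewrite !inclE raddfB. Qed.
HB.instance Definition _ := GRing.isZmodMorphism.Build
  {mpoly 'F_2[n]} {mpoly 'F_2[n.+1]} (@incl n) incl_is_zmod_morphism.
Lemma incl_is_monoid_morphism : monoid_morphism (@incl n).
Proof. by split=> [|p q]; rewrite !inclE ?mwiden1 ?mwidenM. Qed.
HB.instance Definition _ := GRing.isMonoidMorphism.Build
  {mpoly 'F_2[n]} {mpoly 'F_2[n.+1]} (@incl n) incl_is_monoid_morphism.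

Lemma inclD k k' : incl (k + k') = incl k + incl k'. Proof. exact: rmorphD. Qed.
Lemma inclM k k' : incl (k * k') = incl k * incl k'. Proof. exact: rmorphM. Qed.
Lemma incl0 : incl (0 : {mpoly 'F_2[n]}) = 0. Proof. exact: rmorph0. Qed.
Lemma incl1 : incl (1 : {mpoly 'F_2[n]}) = 1. Proof. exact: rmorph1. Qed.
Lemma inclZ c k : incl (c *: k) = c *: incl k. Proof. by rewrite !inclE mwidenZ. Qed.

Lemma incl_X (i : 'I_n) : incl 'X_i = 'X_(widen i) :> {mpoly 'F_2[n.+1]}.
Proof. by rewrite inclE mwidenX mnmwiden1. Qed.

Lemma muni_widen (i : 'I_n) : muni ('X_(widen i) : {mpoly 'F_2[n.+1]}) = ('X_i)%:P.
Proof.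
rewrite muniE msuppX big_seq1 mcoeffX eqxx scale1r mnm1E.
rewrite (negbTE (_ : widen i != ord_max)) ?expr0 ?alg_polyC; last first.
  by rewrite -val_eqE /= neq_ltn ltn_ord.
by congr ('X_[_]%:P); apply/mnmP => l; rewrite mnmE !mnm1E.
Qed.

Lemma muni_last : muni T = 'X.
Proof.
rewrite muniE msuppX big_seq1 mcoeffX eqxx scale1r mnm1E eqxx expr1.
rewrite (_ : [multinom _ | _ < _] = 0%MM) ?mpolyX0 ?scale1r //.
apply/mnmP => i; rewrite mnmE mnm0E mnm1E -val_eqE /=.
by rewrite gtn_eqF.
Qed.

Lemma to_coefsD x y : to_coefs (x + y) = to_coefs x + to_coefs y.
Proof. by rewrite to_coefs.unlock muniD. Qed.
Lemma to_coefsB x y : to_coefs (x - y) = to_coefs x - to_coefs y.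
Proof. by rewrite to_coefs.unlock muniB. Qed.
Lemma to_coefsM x y : to_coefs (x * y) = to_coefs x * to_coefs y.
Proof. by rewrite to_coefs.unlock muniM. Qed.
Lemma to_coefs1 : to_coefs (1 : {mpoly 'F_2[n.+1]}) = 1.
Proof. by rewrite to_coefs.unlock muni1. Qed.
Lemma to_coefs_widen (i : 'I_n) : to_coefs ('X_(widen i) : {mpoly 'F_2[n.+1]}) = ('X_i)%:P.
Proof. by rewrite to_coefs.unlock muni_widen. Qed.
Lemma to_coefs_last : to_coefs T = 'X.
Proof. by rewrite to_coefs.unlock muni_last. Qed.

Lemma to_coefs_incl k : to_coefs (incl k) = k%:P.
Proof.
elim/mpoly_F2_ind: k => [|p q IHp IHq|i p IH].
- by rewrite incl1 to_coefs1.
- by rewrite inclD to_coefsD polyCD IHp IHq.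
by rewrite inclM to_coefsM polyCM incl_X to_coefs_widen IH.
Qed.

Lemma of_coefsK : cancel (@of_coefs n) (@to_coefs n).
Proof.
move=> P; rewrite of_coefs.unlock; elim/poly_ind: P => [|P c IH].
  by rewrite map_poly0 horner0 -incl0 to_coefs_incl.
rewrite [map_poly _ _]rmorphD [X in (X + _).[_]]rmorphM /= map_polyX map_polyC.
by rewrite hornerMXaddC to_coefsD to_coefsM IH to_coefs_last to_coefs_incl.
Qed.

Lemma to_coefsK : cancel (@to_coefs n) (@of_coefs n).
Proof.
move=> x; rewrite of_coefs.unlock; elim/mpoly_F2_ind: x => [|p q IHp IHq|i p IH].
- by rewrite to_coefs1 [map_poly _ _]rmorph1 hornerC.
- by rewrite to_coefsD [map_poly _ _]rmorphD hornerD; congr (_ + _).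
rewrite to_coefsM [map_poly _ _]rmorphM hornerM; congr (_ * _); last exact: IH.
case: (ord_last_case i) => [->|[j ->]]; first by rewrite /= to_coefs_last map_polyX hornerX.
by rewrite /= to_coefs_widen map_polyC hornerC /= incl_X.
Qed.

Definition cf j x : {mpoly 'F_2[n]} := (to_coefs x)`_j.

Lemma cf_inj x y : (forall j, cf j x = cf j y) -> x = y.
Proof. by move=> E; apply: (can_inj to_coefsK); apply/polyP. Qed.

Lemma cf_is_zmod_morphism j : zmod_morphism (cf j).
Proof. by move=> x y; rewrite /cf to_coefsB coefB. Qed.
HB.instance Definition _ j := GRing.isZmodMorphism.Build
  {mpoly 'F_2[n.+1]} {mpoly 'F_2[n]} (cf j) (cf_is_zmod_morphism j).

Lemma cfD j x y : cf j (x + y) = cf j x + cf j y.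
Proof. exact: raddfD. Qed.

Lemma cf0 j : cf j 0 = 0.
Proof. exact: raddf0. Qed.

Lemma cf_incl_mul j k x : cf j (incl k * x) = k * cf j x.
Proof. by rewrite /cf to_coefsM to_coefs_incl coefCM. Qed.

Lemma cf_last_mul j x : cf j (T * x) = if j is j'.+1 then cf j' x else 0.
Proof. by rewrite /cf to_coefsM to_coefs_last coefXM; case: j. Qed.

Lemma cf1 j : cf j 1 = (j == 0%N)%:R.
Proof. by rewrite /cf to_coefs1 coef1. Qed.

Lemma Sq_incl j k : Sq j (incl k) = incl (Sq j k).
Proof.
elim/mpoly_F2_ind: k j => [|p q IHp IHq|i p IH] [|j]; rewrite ?Sq0 //.
- by rewrite incl1 !SqS_1 incl0.
- by rewrite inclD !SqD inclD; congr (_ + _).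
by rewrite inclM incl_X !SqS_mulX inclD expr2 !inclM incl_X !IH.
Qed.

Lemma Q1_incl k : Q1 (incl k) = incl (Q1 k).
Proof. by rewrite !Q1E !Sq_incl inclD. Qed.

Lemma cf_Sq1 j x :
  cf j (Sq 1 x) = Sq 1 (cf j x) + (if j is j1.+1 then cf j1 x *+ j1 else 0).
Proof.
elim/mpoly_F2_ind: x j => [|p q IHp IHq|i p IH] j.
- rewrite SqS_1 cf0 cf1; case: j => [|j]; first by rewrite SqS_1 addr0.
  by rewrite Sq_0 add0r cf1; case: j => //= j; rewrite mul0rn.
- rewrite SqD !cfD SqD; etransitivity; first exact: (congr2 +%R (IHp j) (IHq j)).
  rewrite addrACA; congr (_ + _).
  by case: j => [|j]; rewrite ?addr0 // cfD mulrnDl.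
rewrite SqS_mulX Sq0 cfD expr2 -mulrA.
case: (ord_last_case i) => [->|[l ->]]; last first.
  rewrite -incl_X !cf_incl_mul IH SqS_mulX Sq0 mulrDr -!addrA expr2 mulrA.
  congr (_ + _); rewrite addrC; congr (_ + _).
  by case: j => [|j]; rewrite ?mulr0 // cf_incl_mul mulrnAr.
rewrite !cf_last_mul; case: j => [|j]; first by rewrite Sq_0 !addr0.
rewrite IH -addrA; congr (_ + _); rewrite cf_last_mul.
by case: j => [|j]; rewrite ?addr0 // -mulrSr.
Qed.

Lemma cf_Sq2 j x :
  cf j (Sq 2 x) = Sq 2 (cf j x) +
    (if j is j1.+1 then Sq 1 (cf j1 x) *+ j1 else 0) +
    (if j is j2.+2 then cf j2 x *+ 'C(j2, 2) else 0).
Proof.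
elim/mpoly_F2_ind: x j => [|p q IHp IHq|i p IH] j.
- rewrite SqS_1 cf0 cf1; case: j => [|[|j]] /=; rewrite ?SqS_1 ?Sq_0 ?mulr0n ?addr0 //.
  by rewrite !cf1 /= ?Sq_0 mul0rn !add0r; case: j => //= j; rewrite mul0rn.
- rewrite SqD !cfD SqD; etransitivity; first exact: (congr2 +%R (IHp j) (IHq j)).
  rewrite addrACA; congr (_ + _); first (rewrite addrACA; congr (_ + _)).
    by case: j => [|j]; rewrite ?addr0 // cfD SqD mulrnDl.
  by case: j => [|[|j]]; rewrite ?addr0 // cfD mulrnDl.
rewrite SqS_mulX cfD expr2 -mulrA.
case: (ord_last_case i) => [->|[l ->]]; last first.
  rewrite -incl_X !cf_incl_mul IH cf_Sq1 SqS_mulX !mulrDr.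
  case: j => [|[|j]]; rewrite ?mulr0 ?addr0 ?mulr0n ?cf_incl_mul ?expr2 ?mulrA //.
  rewrite SqS_mulX Sq0 !mulrnDl !mulrnAr expr2 addrA.
  by rewrite [LHS](ACl (1*4*(2*5)*3))%AC.
rewrite !cf_last_mul; case: j => [|j]; first by rewrite Sq_0 !addr0.
rewrite IH cf_last_mul; case: j => [|j]; first by rewrite !mulr0n !addr0.
rewrite cf_Sq1 cf_last_mul.
case: j => [|j]; first by rewrite !mulr0n !addr0 mulr1n.
rewrite cf_last_mul binS bin1 mulrnDr [Sq 1 _ *+ j.+2]mulrSr.
by rewrite [LHS]addrA [LHS](ACl (1*(2*4)*(3*5)))%AC.
Qed.
End LastVariable.

Section LastVariableCoefficients.
Variable n : nat.
Implicit Types (x y : {mpoly 'F_2[n.+1]}) (k : {mpoly 'F_2[n]}) (j d : nat).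

Local Notation T := ('X_ord_max : {mpoly 'F_2[n.+1]}).

Lemma cf_Q1 j x :
  cf j (Q1 x) = Q1 (cf j x) + (if j is j3.+3 then cf j3 x *+ j3 else 0).
Proof.
elim/mpoly_F2_ind: x j => [|p q IHp IHq|i p IH] j.
- rewrite Q1_1 cf0 cf1; case: j => [|[|[|j]]]; rewrite ?Q1_1 ?Q1_0 ?addr0 //.
  by rewrite !cf1 /= add0r; case: j => //= j; rewrite mul0rn.
- rewrite Q1D !cfD Q1D; etransitivity; first exact: (congr2 +%R (IHp j) (IHq j)).
  rewrite addrACA; congr (_ + _).
  by case: j => [|[|[|j]]]; rewrite ?addr0 // cfD mulrnDl.
rewrite Q1M Q1X cfD.
case: (ord_last_case i) => [->|[l ->]]; last first.
  rewrite -incl_X -rmorphXn !cf_incl_mul IH Q1M Q1X mulrDr -!addrA; congr (_ + _).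
  congr (_ + _); case: j => [|[|[|j]]]; rewrite ?mulr0 // cf_incl_mul mulrnAr //.
rewrite !exprS expr0 mulr1 -!mulrA !cf_last_mul.
case: j => [|j]; first by rewrite Q1_0 !addr0.
rewrite IH !cf_last_mul; case: j => [|[|[|j]]];
  rewrite ?cf_last_mul ?mulr0n ?add0r ?addr0 ?Q1_0 //.
by rewrite addrCA -mulrS.
Qed.

Definition mext (m : 'X_{1..n}) (j : nat) : 'X_{1..n.+1} := [multinom of rcons m j].

Lemma mext_last m j : mext m j ord_max = j.
Proof. by rewrite /mext multinomE (tnth_nth 0%N) /= nth_rcons size_tuple ltnn eqxx. Qed.

Lemma mext_widen m j i : mext m j (widen i) = m i.
Proof.
rewrite /mext multinomE (tnth_nth 0%N) /= nth_rcons size_tuple ltn_ord.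
by rewrite -tnth_nth.
Qed.

Lemma mcoeff_cf j x (m : 'X_{1..n}) : (cf j x)@_m = x@_(mext m j).
Proof.
elim/mpolyind: x => [|c k p _ _ IH]; first by rewrite cf0 !mcoeff0.
rewrite cfD !mcoeffD IH; congr (_ + _); rewrite mcoeffZ mcoeffX.
rewrite /cf to_coefs.unlock muniZ muniE msuppX big_seq1 mcoeffX eqxx scale1r.
rewrite coefZ coefZ coefXn mcoeffCM; congr (_ * _).
have -> : (k == mext m j) = (j == k ord_max) &&
    ([multinom k (widen i) | i < n] == m).
  apply/eqP/andP => [->|[/eqP -> /eqP <-]].
    split; first by rewrite mext_last.
    by apply/eqP/mnmP => i; rewrite mnmE mext_widen.
  apply/mnmP => i; case: (ord_last_case i) => [->|[l ->]]; first by rewrite mext_last.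
  by rewrite mext_widen mnmE.
by case: eqP => _; rewrite ?mulr0 ?mcoeff0 // mulr1 mcoeffX.
Qed.

Lemma mdeg_mext m j : mdeg (mext m j) = (mdeg m + j)%N.
Proof.
rewrite !mdegE big_ord_recr /= mext_last; congr (_ + _)%N.
by apply: eq_bigr => i _; rewrite mext_widen.
Qed.

Lemma cf_trunc d j x : cf j (trunc d x) = trunc (d - j) (cf j x).
Proof.
apply/mpolyP => m; rewrite mcoeff_cf !mcoeff_trunc mcoeff_cf mdeg_mext.
by rewrite addnC ltn_subRL.
Qed.

Lemma positive_cfP x :
  reflect (cf 0 x = 0 /\ forall j, cf j x \in positive n) (x \in positive n.+1).
Proof.
apply: (iffP (positiveP _)) => [H|[H0 H] m nz i].
  split=> [|j].
    apply/mpolyP => m; rewrite mcoeff_cf mcoeff0; apply/eqP.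
    by apply: contraT => /H/(_ ord_max); rewrite mext_last.
  apply/positiveP => m; rewrite mcoeff_cf => /H Hm i.
  by rewrite -(mext_widen m j).
pose m' : 'X_{1..n} := [multinom m (widen i) | i < n].
have Dm : m = mext m' (m ord_max).
  apply/mnmP => l; case: (ord_last_case l) => [->|[l' ->]].
    by rewrite mext_last.
  by rewrite mext_widen mnmE.
move: nz; rewrite Dm -mcoeff_cf => nz.
case: (ord_last_case i) => [->|[l ->]]; last first.
  by rewrite mext_widen; move/positiveP: (H (m ord_max)) => /(_ _ nz l).
rewrite mext_last lt0n; apply: contraNneq nz => ->.
by rewrite H0 mcoeff0.
Qed.
End LastVariableCoefficients.

(** * Contracting homotopies *)

Lemma mpoly_mulrn n (x : {mpoly 'F_2[n]}) k : x *+ k = if odd k then x else 0.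
Proof. exact: mulrn_char2 (@mpoly_char2 n) x k. Qed.

(** Division of the even powers of the last variable t by t^s, the odd powers being
    sent to 0 (s is odd). For s = 1 this inverts Sq^1 t^(2k+1) = t^(2k+2), and
    for s = 3 it inverts Q1 t^(2k+1) = t^(2k+4). *)
Definition shift_odd n s (x : {mpoly 'F_2[n.+1]}) : {mpoly 'F_2[n.+1]} :=
  of_coefs (\poly_(j < size (to_coefs x)) (if odd j then cf (j + s) x else 0)).

Lemma cf_shift_odd n s (x : {mpoly 'F_2[n.+1]}) j :
  cf j (shift_odd s x) = if odd j then cf (j + s) x else 0.
Proof.
rewrite {1}/cf of_coefsK coef_poly; case: ltnP => // le_j.
by case: ifP => // _; rewrite /cf nth_default // (leq_trans le_j) ?leq_addr.
Qed.

Lemma positive_shift_odd n s (x : {mpoly 'F_2[n.+1]}) :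
  x \in positive n.+1 -> shift_odd s x \in positive n.+1.
Proof.
case/positive_cfP => _ Hx; apply/positive_cfP; rewrite cf_shift_odd /=.
by split=> // j; rewrite cf_shift_odd; case: ifP => _; rewrite ?rpred0.
Qed.

(** The module V_1 has no Sq^1-homology, hence neither has V_n. *)
Lemma sq1_homotopy n (x : {mpoly 'F_2[n.+1]}) : cf 0 x = 0 ->
  Sq 1 (shift_odd 1 x) + shift_odd 1 (Sq 1 x) = x.
Proof.
move=> x0; apply: cf_inj => -[|j]; rewrite cfD cf_Sq1 !cf_shift_odd /=.
  by rewrite Sq_0 !addr0 x0.
rewrite cf_Sq1 !addn1 !mpoly_mulrn /=.
case: (odd j); rewrite /= ?addr0 ?Sq_0 ?add0r //.
by rewrite addrA mpoly_char2 add0r.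
Qed.

Lemma cf_last_sqr n j : cf j ('X_ord_max ^+ 2 : {mpoly 'F_2[n.+1]}) = (j == 2)%:R.
Proof.
rewrite expr2 cf_last_mul; case: j => [|j] //.
rewrite -['X_ord_max]mulr1 cf_last_mul; case: j => [|j] //.
by rewrite cf1; case: j.
Qed.

(** The Q1-homology of V_1 is spanned by t^2, which is the only even power that is
    not of the form t^(2k+4). *)
Lemma q1_homotopy n (x : {mpoly 'F_2[n.+1]}) : cf 0 x = 0 ->
  Q1 (shift_odd 3 x) + shift_odd 3 (Q1 x) + incl (cf 2 x) * 'X_ord_max ^+ 2 = x.
Proof.
move=> x0; apply: cf_inj => j; rewrite !cfD cf_Q1 !cf_shift_odd cf_incl_mul.
rewrite cf_last_sqr.
case: j => [|[|[|j]]] /=; rewrite ?Q1_0 ?mulr0 ?addr0 ?add0r ?mulr1 ?x0 //.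
  by rewrite cf_Q1 /= mulr1n addrA mpoly_char2 add0r.
rewrite cf_Q1 !addn3 cf_shift_odd !mpoly_mulrn addn3 /=.
case: (odd j); rewrite /= ?addr0 ?Q1_0 ?add0r //.
by rewrite addrA mpoly_char2 add0r.
Qed.

Definition sqr_class n : {mpoly 'F_2[n]} := \prod_(i < n) 'X_i ^+ 2.

Lemma sqr_classS n : sqr_class n.+1 = incl (sqr_class n) * 'X_ord_max ^+ 2.
Proof.
rewrite /sqr_class big_ord_recr /=; congr (_ * _).
by rewrite rmorph_prod; apply: eq_bigr => i _; rewrite rmorphXn /= incl_X.
Qed.

Lemma Q1_last2 n k : Q1 (incl k * 'X_ord_max ^+ 2) = incl (Q1 k) * 'X_ord_max ^+ 2
  :> {mpoly 'F_2[n.+1]}.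
Proof. by rewrite Q1M Q1_sqr mulr0 addr0 Q1_incl. Qed.

Lemma positive_last2 n k :
  k \in positive n -> incl k * 'X_ord_max ^+ 2 \in positive n.+1.
Proof.
move=> Pk; apply/positive_cfP; split=> [|j]; rewrite cf_incl_mul cf_last_sqr ?mulr0 //.
by case: (j == 2%N); rewrite ?mulr1 // mulr0 rpred0.
Qed.

(** The Q1-homology of V_n is generated by the product of the squares, by the
    homotopy in the last variable and induction on n. *)
Lemma q1_homology n (x : {mpoly 'F_2[n]}) : x \in positive n -> Q1 x = 0 ->
  exists c, exists2 y, y \in positive n & x = c *: sqr_class n + Q1 y.
Proof.
elim: n x => [|n IH] x Px Qx0.
  exists (x@_0), 0; rewrite ?rpred0 // Q1_0 addr0 /sqr_class big_ord0.
  apply/mpolyP => m; rewrite mcoeffZ mcoeff1.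
  by rewrite (_ : m = 0%MM) ?eqxx ?mulr1 //; apply/mnmP => -[].
have [x0 Hx] := positive_cfP _ Px.
have Dx := q1_homotopy x0; rewrite Qx0 in Dx.
have S0 : shift_odd 3 0 = 0 :> {mpoly 'F_2[n.+1]}.
  by apply: cf_inj => j; rewrite cf_shift_odd !cf0 if_same.
have [|c [y Py Dy]] := IH (cf 2 x) (Hx 2%N).
  by have := cf_Q1 2 x; rewrite Qx0 cf0 addr0.
exists c, (shift_odd 3 x + incl y * 'X_ord_max ^+ 2).
  by rewrite rpredD ?positive_shift_odd ?positive_last2.
rewrite sqr_classS Q1D Q1_last2 -{1}Dx S0 addr0 Dy inclD inclZ mulrDl -scalerAl.
by rewrite addrCA.
Qed.

(** The coefficient of t^2 in Q1 y is the value of Q1 on the coefficient of t^2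
    in y, so that one may remove the variables one by one. *)
Lemma sqr_class_not_q1 n (y : {mpoly 'F_2[n]}) : Q1 y != sqr_class n.
Proof.
elim: n y => [|n IH] y.
  rewrite /sqr_class big_ord0 (_ : y = (y@_0)%:MP); last first.
    apply/mpolyP => m; rewrite mcoeffC (_ : m = 0%MM) ?eqxx ?mulr1 //.
    by apply/mnmP => -[].
  by rewrite -[(y@_0)%:MP]mulr1 mul_mpolyC Q1Z Q1_1 scaler0 eq_sym oner_neq0.
apply: contraNneq (IH (cf 2 y)) => E.
have := congr1 (cf 2) E; rewrite cf_Q1 addr0 => ->.
by rewrite sqr_classS cf_incl_mul cf_last_sqr mulr1.
Qed.

(** * Extending a submodule by one variable *)

(** The type of the elements of V_n, as a module over Sq^1 and Sq^2. *)
Record positiveT (n : nat) : predArgType := PositiveT {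
  positiveT_val :> {mpoly 'F_2[n]};
  _ : positiveT_val \in positive n
}.
HB.instance Definition _ n := [isSub for @positiveT_val n].
HB.instance Definition _ n := [Choice of positiveT n by <:].
HB.instance Definition _ n := [SubChoice_isSubZmodule of positiveT n by <:].

Definition positiveT_Sq n j (x : positiveT n) : positiveT n := PositiveT (positive_Sq j (valP x)).
Lemma positiveT_Sq_is_zmod_morphism n j : zmod_morphism (@positiveT_Sq n j).
Proof. by move=> x y; apply: val_inj; rewrite /= raddfB. Qed.
HB.instance Definition _ n j := GRing.isZmodMorphism.Build (positiveT n) (positiveT n)
  (@positiveT_Sq n j) (@positiveT_Sq_is_zmod_morphism n j).

Section Extension.
Variables (n : nat) (E : zmodClosed {mpoly 'F_2[n]}).
Hypothesis E_positive : {subset E <= positive n}.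
Hypothesis E_Sq1 : forall k, k \in E -> Sq 1 k \in E.
Hypothesis E_Sq2 : forall k, k \in E -> Sq 2 k \in E.
Hypothesis E_trunc : forall d k, k \in E -> trunc d k \in E.
Hypothesis E_q1 : forall k, k \in positive n -> Q1 k \in E ->
  exists2 y, y \in positive n & k + Q1 y \in E.

(** The module E (x) V_1, for E a submodule of V_n: the elements all of whose
    coefficients in the last variable belong to E. *)
Definition extension : {pred {mpoly 'F_2[n.+1]}} :=
  [pred x | (cf 0 x == 0) && (to_coefs x \is a polyOver E)].

Lemma extensionP x :
  reflect (cf 0 x = 0 /\ forall j, cf j x \in E) (x \in extension).
Proof.
apply: (iffP andP) => [[/eqP x0 /polyOverP Ex] | [x0 Ex]]; first by [].
by split; [apply/eqP | apply/polyOverP].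
Qed.

Lemma extension_zmod_closed : zmod_closed extension.
Proof.
split=> [|x y /extensionP[x0 Ex] /extensionP[y0 Ey]]; apply/extensionP.
  by rewrite cf0; split=> // j; rewrite cf0 rpred0.
rewrite raddfB /= x0 y0 subr0; split=> // j.
by rewrite raddfB; apply: rpredB; [apply: Ex | apply: Ey].
Qed.
HB.instance Definition _ := GRing.isZmodClosed.Build {mpoly 'F_2[n.+1]}
  extension extension_zmod_closed.

Lemma extension_positive x : x \in extension -> x \in positive n.+1.
Proof.
case/extensionP => x0 Ex; apply/positive_cfP; split=> // j.
exact: E_positive (Ex j).
Qed.

Lemma extension_Sq1 x : x \in extension -> Sq 1 x \in extension.
Proof.
case/extensionP => x0 Ex; apply/extensionP; split=> [|j]; rewrite cf_Sq1.
  by rewrite x0 Sq_0 addr0.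
apply: rpredD; first exact: E_Sq1 (Ex j).
by case: j => [|j]; [apply: rpred0 | apply: rpredMn (Ex j)].
Qed.

Lemma extension_Sq2 x : x \in extension -> Sq 2 x \in extension.
Proof.
case/extensionP => x0 Ex; apply/extensionP; split=> [|j]; rewrite cf_Sq2.
  by rewrite x0 Sq_0 !addr0.
apply: rpredD; first apply: rpredD; first exact: E_Sq2 (Ex j).
  by case: j => [|j]; [apply: rpred0 | apply: rpredMn (E_Sq1 (Ex j))].
by case: j => [|[|j]]; [apply: rpred0 | apply: rpred0 | apply: rpredMn (Ex j)].
Qed.

Lemma extension_trunc d x : x \in extension -> trunc d x \in extension.
Proof.
case/extensionP => x0 Ex; apply/extensionP; rewrite cf_trunc x0 linear0.
by split=> // j; rewrite cf_trunc; apply: E_trunc (Ex j).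
Qed.

Lemma extension_shift_odd s x : x \in extension -> shift_odd s x \in extension.
Proof.
case/extensionP => _ Ex; apply/extensionP; rewrite cf_shift_odd.
by split=> // j; rewrite cf_shift_odd; case: ifP => _; [apply: Ex | apply: rpred0].
Qed.

Lemma extension_last2 k : k \in E -> incl k * 'X_ord_max ^+ 2 \in extension.
Proof.
move=> Ek; apply/extensionP; split=> [|j]; rewrite cf_incl_mul cf_last_sqr ?mulr0 //.
by case: (j == 2%N); [rewrite mulr1 | rewrite mulr0; apply: rpred0].
Qed.

Let W : {pred positiveT n.+1} := [pred x | val x \in extension].
Let WE (x : positiveT n.+1) : (x \in W) = (val x \in extension).
Proof. by []. Qed.
Let W_zmod_closed : zmod_closed W.
Proof.
by split=> [|x y]; rewrite !WE ?raddfB; [apply: rpred0 | apply: rpredB].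
Qed.
Let Wz : zmodClosed (positiveT n.+1) :=
  HB.pack W (GRing.isZmodClosed.Build (positiveT n.+1) W W_zmod_closed).

Let char2 (x : positiveT n.+1) : x + x = 0.
Proof. by apply: val_inj; apply: mpoly_char2. Qed.

Let q1val (x : positiveT n.+1) : val (q1 (@positiveT_Sq n.+1 1) (@positiveT_Sq n.+1 2) x) = Q1 (val x).
Proof. by rewrite Q1E. Qed.

Let q0_exact (x : positiveT n.+1) : positiveT_Sq 1 x \in W -> exists y, x - positiveT_Sq 1 y \in W.
Proof.
move=> Wx; have [x0 _] := positive_cfP _ (valP x).
exists (PositiveT (positive_shift_odd 1 (valP x))); rewrite WE /=.
by rewrite -{1}(sq1_homotopy x0) addrC addKr extension_shift_odd.
Qed.

Let q1_exact d (x : positiveT n.+1) : trunc d (val x) = val x ->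
    q1 (@positiveT_Sq n.+1 1) (@positiveT_Sq n.+1 2) (positiveT_Sq 1 x) \in W ->
  exists2 y, trunc d.-1 (val y) = val y &
    positiveT_Sq 1 x - q1 (@positiveT_Sq n.+1 1) (@positiveT_Sq n.+1 2) y \in W.
Proof.
rewrite !WE q1val /=; set z := Sq 1 _ => Tx Wz1.
have Pz : z \in positive n.+1 by rewrite positive_Sq ?(valP x).
have [z0 Hz] := positive_cfP _ Pz.
have [Q0 EQ] := extensionP _ Wz1.
have [|y Py Ey] := E_q1 (Hz 2%N); first by have := EQ 2%N; rewrite cf_Q1 addr0.
(* The homotopy reduces the question to the coefficient of t^2, where y is
   provided by the assumption on E; truncation then bounds the degree. *)
pose u := shift_odd 3 z + incl y * 'X_ord_max ^+ 2.
have Pu : u \in positive n.+1 by rewrite rpredD ?positive_shift_odd ?positive_last2.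
have Wu : z - Q1 u \in extension.
  rewrite mpoly_oppr -{1}(q1_homotopy z0) Q1D Q1_last2.
  rewrite [X in X \in _](_ : _ = shift_odd 3 (Q1 z) +
    incl (cf 2 z + Q1 y) * 'X_ord_max ^+ 2); last first.
    rewrite inclD mulrDl !addrA; congr (_ + _).
    by rewrite addrAC; congr (_ + _); rewrite addrAC mpoly_char2 add0r.
  by rewrite rpredD ?extension_shift_odd ?extension_last2.
exists (PositiveT (positive_trunc (d - 2) Pu)).
  by rewrite /= trunc_trunc // -subn1 leq_sub2l.
suff : z - Q1 (trunc (d - 2) u) \in extension.
  by rewrite WE raddfB /= -[Q1 _](q1val (PositiveT (positive_trunc (d - 2) Pu))).
have := extension_trunc d.+1 Wu.
rewrite linearB /= {1}/z trunc_Sq subSS subn0 Tx !Q1E linearD /= !trunc_Sq.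
by rewrite !subnS !subn0.
Qed.

(** The quotient of V_(n+1) by E (x) V_1 is (V_n / E) (x) V_1. It has no
    Sq^1-homology because of the factor V_1, and no Q1-homology because V_n / E
    has none, which is the assumption [E_q1]. So [ker_ab_mod_im_b] applies. *)
Theorem ker_sq3_extension x : x \in positive n.+1 -> Sq 1 (Sq 2 x) = 0 ->
  exists2 y, y \in positive n.+1 & x - Sq 2 y \in extension.
Proof.
move=> Px Kx.
have [|||||||y Wy] := @ker_ab_mod_im_b _ (@positiveT_Sq n.+1 1) (@positiveT_Sq n.+1 2) Wz char2 _ _ _ _
  q0_exact (fun d z => trunc d (val z) = val z) _ _ q1_exact (PositiveT Px).
- by move=> z; apply: val_inj; apply: Sq1_Sq1.
- by move=> z; apply: val_inj; apply: Sq2_Sq2.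
- by move=> z; rewrite !WE => Wx; apply: extension_Sq1.
- by move=> z; rewrite !WE => Wx; apply: extension_Sq2.
- by move=> z; rewrite trunc0 => /esym z0; apply: val_inj.
- by move=> z; exists (msize (val z)); apply: trunc_msize.
- by rewrite WE /= Kx rpred0.
- by exists (val y); [apply: valP | rewrite WE in Wy].
Qed.

Theorem hit_extension x u v : x \in extension ->
    u \in positive n.+1 -> v \in positive n.+1 -> x = Sq 1 u + Sq 2 v ->
  exists p q, [/\ p \in extension, q \in extension & x = Sq 1 p + Sq 2 q].
Proof.
move=> Wx Pu Pv Dx; pose X := PositiveT (extension_positive Wx).
have DX : X = positiveT_Sq 1 (PositiveT Pu) + positiveT_Sq 2 (PositiveT Pv) by apply: val_inj.
have [|||||||p [q [Wp Wq Dpq]]] := @sub_hit _ (@positiveT_Sq n.+1 1) (@positiveT_Sq n.+1 2) Wz char2 _ _ _ _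
  q0_exact (fun d z => trunc d (val z) = val z) _ _ q1_exact X _ _ _ DX.
- by move=> z; apply: val_inj; apply: Sq1_Sq1.
- by move=> z; apply: val_inj; apply: Sq2_Sq2.
- by move=> z; rewrite !WE => Wz1; apply: extension_Sq1.
- by move=> z; rewrite !WE => Wz1; apply: extension_Sq2.
- by move=> z; rewrite trunc0 => /esym z0; apply: val_inj.
- by move=> z; exists (msize (val z)); apply: trunc_msize.
- by [].
- by exists (val p), (val q); split=> //; have := congr1 val Dpq.
Qed.
End Extension.

(** * Finite spans over F_2 *)

Lemma F2_cases (c : 'F_2) : c = 0 \/ c = 1.
Proof. by case: c => -[|[|//]] lt; [left | right]; apply: val_inj. Qed.

Section Span.
Variable n : nat.
Local Notation K := {mpoly 'F_2[n]}.
Implicit Types (k x : K) (s : seq K).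

(** Boolean membership in the span of s: over F_2, the coefficient of the first
    generator is 0 or 1. *)
Fixpoint span s : pred K :=
  if s is k :: s' then fun x => span s' x || span s' (x + k) else pred1 0.

Definition span_pred s : {pred K} := [pred x | span s x].

Lemma span_nil x : (x \in span_pred [::]) = (x == 0).
Proof. by []. Qed.

Lemma span_cons k s x :
  (x \in span_pred (k :: s)) = (x \in span_pred s) || (x + k \in span_pred s).
Proof. by []. Qed.

Lemma span_zmod_closed s : zmod_closed (span_pred s).
Proof.
elim: s => [|k s [IH0 IHB]].
  by split=> [|x y]; rewrite !span_nil // => /eqP -> /eqP ->; rewrite subr0.
split=> [|x y]; first by rewrite span_cons IH0.
rewrite !span_cons => /orP[Sx|Sx] /orP[Sy|Sy]; apply/orP.
- by left; apply: IHB.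
- by right; rewrite -[k]mpoly_oppr -addrA -opprD; apply: IHB.
- by right; rewrite addrAC; apply: IHB.
- by left; have := IHB _ _ Sx Sy; rewrite opprD addrACA subrr addr0.
Qed.
HB.instance Definition _ s := GRing.isZmodClosed.Build K (span_pred s) (span_zmod_closed s).

Lemma span0 s : 0 \in span_pred s.
Proof. exact: rpred0. Qed.

Lemma spanD s x y : x \in span_pred s -> y \in span_pred s -> x + y \in span_pred s.
Proof. exact: rpredD. Qed.

Lemma mem_span k s : k \in s -> k \in span_pred s.
Proof.
elim: s => //= l s IH; rewrite in_cons span_cons => /orP[/eqP ->|/IH -> //].
by rewrite mpoly_char2 span0 orbT.
Qed.

Lemma span_sub s (P : K -> Prop) :
    P 0 -> (forall x y, P x -> P y -> P (x + y)) ->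
    (forall k, k \in s -> P k) ->
  forall x, x \in span_pred s -> P x.
Proof.
move=> P0 PD; elim: s => [|k s IH] Ps x; first by rewrite span_nil => /eqP ->.
have Ps' l : l \in s -> P l by move=> sl; apply: Ps; rewrite in_cons sl orbT.
rewrite span_cons => /orP[/IH|/(IH Ps') Px]; first by apply.
rewrite -[x]addr0 -(mpoly_char2 k) addrA; apply: PD => //.
by apply: Ps; rewrite mem_head.
Qed.

(** Independence of the generators is tested with operators, in place of a
    comparison of degrees. *)
Lemma notin_span (phi : K -> K) k s :
    (forall x y, phi (x + y) = phi x + phi y) -> phi 0 = 0 ->
  phi k != 0 -> all (fun l => phi l == 0) s -> k \notin span_pred s.
Proof.
move=> phiD phi0 nz /allP s0; apply: contra nz => Sk; apply/eqP.
apply: (span_sub (P := fun x => phi x = 0)) Sk => [//|x y|l /s0/eqP //].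
by rewrite phiD => -> ->; rewrite addr0.
Qed.

(** Homogeneity of degree d, phrased so that it is inherited by the values of Sq. *)
Definition homogeneous d (p : K) := forall e, trunc e p = if (d < e)%N then p else 0.

Lemma hom_Sq d j p : homogeneous d p -> homogeneous (d + j) (Sq j p).
Proof.
move=> Hp e; rewrite trunc_Sq Hp ltn_subRL addnC.
by case: ifP; rewrite ?Sq_0.
Qed.

Lemma dhomog_hom d (p : K) : p \is d.-homog -> homogeneous d p.
Proof.
move=> /dhomogP Hp e; apply/mpolyP => m; rewrite mcoeff_trunc.
have [/Hp <-|nm] := boolP (m \in msupp p).
  by case: ifP; rewrite ?mcoeff0.
by rewrite (memN_msupp_eq0 nm); do 2?case: ifP; rewrite ?mcoeff0 ?(memN_msupp_eq0 nm).
Qed.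

Lemma dhomog_Sq d j (p : K) : p \is d.-homog -> Sq j p \is (d + j).-homog.
Proof.
move=> /dhomogP Hp; rewrite SqE /sq big_seq rpred_sum // => m /Hp dm.
rewrite rpredZ // rpred_sum // => b /eqP db; rewrite rpredZ //.
by rewrite dhomogX /= mdegD dm db.
Qed.

(** If the Q1-homology of the span E of s is generated by a class c that represents
    the product of the squares, then V_n / E has no Q1-homology. Indeed
    Q1 k = Q1 e' + c is excluded as c is not in the image of Q1, and when
    Q1 k = Q1 e' the cycle k + e' is a multiple of c up to the image of Q1. *)
Lemma span_q1_exact s (c kappa : K) :
    {subset s <= positive n} -> c \in span_pred s ->
    kappa \in positive n -> c = sqr_class n + Q1 kappa ->
    (forall e, e \in span_pred s -> Q1 e = 0 ->
       exists2 e', e' \in span_pred s & e = Q1 e' \/ e = Q1 e' + c) ->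
  forall k, k \in positive n -> Q1 k \in span_pred s ->
    exists2 y, y \in positive n & k + Q1 y \in span_pred s.
Proof.
move=> Ps Sc Pkap Dc ker_q1 k Pk Sk.
have Pspan e : e \in span_pred s -> e \in positive n.
  apply: (span_sub (P := fun x => x \in positive n)) => [|x y Px Py|].
  - exact: rpred0.
  - exact: rpredD.
  - exact: Ps.
have [|e' Se' De] := ker_q1 _ Sk; first by rewrite Q1_Q1.
have {De} De : Q1 k = Q1 e'.
  case: De => // De; have /eqP[] := sqr_class_not_q1 (k + e' + kappa).
  rewrite !Q1D De Dc; rewrite [Q1 e' + _]addrC -!addrA.
  by rewrite [Q1 e' + (Q1 e' + _)]addrA mpoly_char2 add0r mpoly_char2 addr0.
(* Now k + e' is a cycle of Q1. *)
have [||d [y Py Dy]] := q1_homology (x := k + e').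
- by rewrite rpredD // Pspan.
- by rewrite Q1D De mpoly_char2.
have Dk : k = e' + (d *: sqr_class n + Q1 y).
  by rewrite -Dy [k + e']addrC addrA mpoly_char2 add0r.
case: (F2_cases d) Dk => -> Dk.
  exists y => //; rewrite Dk scale0r add0r -addrA mpoly_char2 addr0 //.
exists (y + kappa); first exact: rpredD.
rewrite Dk Q1D scale1r; rewrite [X in X \in _](_ : _ = e' + c); first exact: spanD.
rewrite -!addrA; congr (_ + _); rewrite Dc; congr (_ + _).
by rewrite addrA mpoly_char2 add0r.
Qed.
End Span.

(** * Sq^1 and Sq^2 on F_2[t] *)

Section PolyF2.
Implicit Types f g : {poly 'F_2}.

(** The action of Sq^j on f in F_2[t] is t^(2j) times the j-th divided derivative
    of f. *)
Definition sq1_poly f : {poly 'F_2} := 'X^2 * f^`().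
Definition sq2_poly f : {poly 'F_2} := 'X^4 * f^`N(2).

Lemma polyF2_char2 f : f + f = 0.
Proof.
apply/polyP => j; rewrite coefD coef0.
by case: (F2_cases f`_j) => ->; apply: val_inj.
Qed.

Lemma F2_mulrn (c : 'F_2) k : c *+ k = if odd k then c else 0.
Proof. by apply: mulrn_char2 => x; case: (F2_cases x) => ->; apply: val_inj. Qed.

(** Lucas' congruence for binomials over 2: the digit of weight 2 of j decides. *)
Lemma odd_bin2 j : odd 'C(j, 2) = odd j./2.
Proof.
elim/ltn_ind: j => -[|[|j]] // IH.
have -> : 'C(j.+2, 2) = ('C(j, 2) + j.*2.+1)%N.
  by rewrite binS (binS j) !bin1 -addnn; lia.
by rewrite oddD IH //= odd_double addbT.
Qed.

Lemma coef_sq1_polyS f j : (sq1_poly f)`_j.+1 = if odd j then f`_j else 0.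
Proof.
rewrite /sq1_poly coefXnM; case: j => [|j] //=.
by rewrite coef_deriv subSS subn1 F2_mulrn.
Qed.

Lemma coef_sq1_poly0 f : (sq1_poly f)`_0 = 0.
Proof. by rewrite /sq1_poly coefXnM. Qed.

Lemma coef_sq2_polySS f j : (sq2_poly f)`_j.+2 = if odd j./2 then f`_j else 0.
Proof.
rewrite /sq2_poly coefXnM; case: j => [|[|j]] //.
by rewrite coef_nderivn !subSS subn0 F2_mulrn add2n odd_bin2.
Qed.

Lemma coef_sq2_poly0 f : (sq2_poly f)`_0 = 0. Proof. by rewrite /sq2_poly coefXnM. Qed.
Lemma coef_sq2_poly1 f : (sq2_poly f)`_1 = 0. Proof. by rewrite /sq2_poly coefXnM. Qed.

Lemma sq1_polyD f g : sq1_poly (f + g) = sq1_poly f + sq1_poly g.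
Proof. by rewrite /sq1_poly derivD mulrDr. Qed.
Lemma sq2_polyD f g : sq2_poly (f + g) = sq2_poly f + sq2_poly g.
Proof. by rewrite /sq2_poly nderivnD mulrDr. Qed.
Lemma sq1_poly0 : sq1_poly 0 = 0. Proof. by rewrite /sq1_poly deriv0 mulr0. Qed.
Lemma sq1_sq1_poly f : sq1_poly (sq1_poly f) = 0.
Proof.
apply/polyP => -[|[|j]]; rewrite coef0 ?coef_sq1_poly0 // coef_sq1_polyS //= coef_sq1_polyS.
by case: (odd j).
Qed.

(** Sq^2 t^j is nonzero for j = 2, 3 modulo 4, and its exponent is then 0 or 1
    modulo 4. *)
Lemma sq2_sq2_poly f : sq2_poly (sq2_poly f) = 0.
Proof.
apply/polyP => -[|[|[|[|j]]]]; rewrite coef0 ?coef_sq2_poly0 ?coef_sq2_poly1 // coef_sq2_polySS //=.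
by rewrite coef_sq2_polySS; case: (odd j./2).
Qed.

Lemma sq1_sq2_sq1_poly f : sq1_poly (sq2_poly (sq1_poly f)) = 0.
Proof.
apply/polyP => -[|[|[|[|j]]]]; rewrite coef0 ?coef_sq1_poly0 // coef_sq1_polyS //=.
  by rewrite coef_sq2_poly1.
by rewrite coef_sq2_polySS coef_sq1_polyS; case: (odd j) => //=; case: ifP.
Qed.

Lemma ker_sq1_poly f : f`_0 = 0 -> sq1_poly f = 0 -> exists2 g : {poly 'F_2}, g`_0 = 0 & f = sq1_poly g.
Proof.
move=> f0 af0; exists (\poly_(j < size f) (if odd j then f`_j.+1 else 0)).
  by rewrite coef_poly if_same.
apply/polyP => -[|j]; first by rewrite f0 coef_sq1_poly0.
rewrite coef_sq1_polyS coef_poly; have := coef_sq1_polyS f j.+1; rewrite af0 coef0 /=.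
case: (odd j) => /= [_|<- //]; case: ltnP => // le_j.
by rewrite nth_default // ltnW.
Qed.

(** The kernel of Sq^2 is spanned by the t^j with j = 0, 1 modulo 4, which are values
    of Sq^2 except for t. *)
Lemma ker_sq2_poly f : f`_0 = 0 -> sq2_poly f = 0 ->
  exists2 g : {poly 'F_2}, g`_0 = 0 & f = sq2_poly g + f`_1 *: 'X.
Proof.
move=> f0 bf0; exists (\poly_(j < size f) (if odd j./2 then f`_j.+2 else 0)).
  by rewrite coef_poly if_same.
apply/polyP => -[|[|j]]; rewrite coefD coefZ coefX ?mulr0 ?addr0 ?mulr1.
- by rewrite coef_sq2_poly0.
- by rewrite coef_sq2_poly1 add0r.
rewrite coef_sq2_polySS coef_poly; have := coef_sq2_polySS f j.+2; rewrite bf0 coef0 /=.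
case: (odd j./2) => /= [_|<- //]; case: ltnP => // le_j.
by rewrite nth_default //; lia.
Qed.

(** The exponents in the image of Sq^2 are 0 or 1 modulo 4, those in the image
    of Sq^3 are 2 modulo 4. *)
Lemma sq2_poly_eq_sq3_poly f g : sq2_poly f = sq1_poly (sq2_poly g) -> sq2_poly f = 0.
Proof.
move=> E; apply/polyP => -[|[|j]]; rewrite coef0 ?coef_sq2_poly0 ?coef_sq2_poly1 //.
have := congr1 (fun p : {poly 'F_2} => p`_j.+2) E.
rewrite /= => ->; rewrite coef_sq1_polyS; case: j => [|j]; first by rewrite /= coef_sq2_poly1.
have := coef_sq2_polySS f j.+1; rewrite E coef_sq1_polyS coef_sq2_polySS /= uphalf_half oddD.
by case: (odd j); case: (odd j./2).
Qed.

Lemma sq2_polyX c : sq2_poly (c *: 'X) = 0.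
Proof. by apply/polyP => -[|[|[|j]]]; rewrite coef0 ?coef_sq2_poly0 ?coef_sq2_poly1 // coef_sq2_polySS coefZ coefX /= ?mulr0 ?if_same //; case: j => [|j]; rewrite ?mulr0 ?if_same. Qed.

(** U(V_1) is spanned by t. The even part of f is in the image of Sq^1, and its odd
    part is killed by Sq^2, as Sq^1 is injective on odd powers. *)
Lemma ker_sq3_poly f : f`_0 = 0 -> sq1_poly (sq2_poly f) = 0 ->
  exists p q : {poly 'F_2}, [/\ p`_0 = 0, q`_0 = 0 & f = sq1_poly p + sq2_poly q + f`_1 *: 'X].
Proof.
move=> f0 abf0; pose p := \poly_(j < size f) (if odd j then f`_j.+1 else 0).
have p0 : p`_0 = 0 by rewrite coef_poly if_same.
have coef_p j : p`_j = if odd j then f`_j.+1 else 0.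
  by rewrite coef_poly; case: ltnP => // le_j; rewrite nth_default ?if_same // ltnW.
have even0 j : ~~ odd j -> (f + sq1_poly p)`_j = 0.
  rewrite coefD; case: j => [|j]; first by rewrite f0 coef_sq1_poly0 addr0.
  rewrite coef_sq1_polyS coef_p /= negbK => ->.
  by rewrite -coefD polyF2_char2 coef0.
have [||q q0 Df] := @ker_sq2_poly (f + sq1_poly p).
- by rewrite even0.
- apply/polyP => -[|[|j]]; rewrite coef0 ?coef_sq2_poly0 ?coef_sq2_poly1 // coef_sq2_polySS.
  have [oj|/even0 ->] := boolP (odd j); last by rewrite if_same.
  have : sq1_poly (sq2_poly (f + sq1_poly p)) = 0 by rewrite sq2_polyD sq1_polyD abf0 sq1_sq2_sq1_poly addr0.
  move/(congr1 (fun u : {poly 'F_2} => u`_j.+3)).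
  by rewrite coef0 coef_sq1_polyS /= oj coef_sq2_polySS => ->.
exists p, q; split=> //; rewrite -[LHS]addr0 -(polyF2_char2 (sq1_poly p)) addrA Df.
rewrite coefD coef_sq1_polyS addr0 addrC addrA //.
Qed.

Lemma ker_sq1_ker_sq2_poly f : f`_0 = 0 -> sq1_poly f = 0 -> sq2_poly f = 0 ->
  exists2 g : {poly 'F_2}, g`_0 = 0 & f = sq2_poly (sq1_poly g).
Proof.
move=> f0 af0 bf0; have [g g0 Df] := ker_sq2_poly f0 bf0.
have f1 : f`_1 = 0.
  by have := coef_sq1_polyS f 1; rewrite af0 coef0.
rewrite f1 scale0r addr0 in Df.
have [p [q [p0 q0 Dg]]] := ker_sq3_poly g0 (etrans (congr1 sq1_poly (esym Df)) af0).
by exists p; rewrite // Df Dg !sq2_polyD sq2_sq2_poly sq2_polyX !addr0.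
Qed.
End PolyF2.

(** * Tensoring with F_2[t] *)

(** The element k (x) f of V_n (x) F_2[t]. *)
HB.lock Definition tens n (k : {mpoly 'F_2[n]}) (f : {poly 'F_2}) : {mpoly 'F_2[n.+1]} :=
  of_coefs (\poly_(j < size f) (f`_j *: k)).

Section Tensor.
Variable n : nat.
Local Notation K := {mpoly 'F_2[n]}.
Implicit Types (k l : K) (s : seq K) (f g : {poly 'F_2}) (x y : {mpoly 'F_2[n.+1]}).

Lemma cf_tens k f j : cf j (tens k f) = f`_j *: k.
Proof.
rewrite tens.unlock /cf of_coefsK coef_poly; case: ltnP => // le_j.
by rewrite nth_default // scale0r.
Qed.

Lemma tensDr k f g : tens k (f + g) = tens k f + tens k g.
Proof. by apply: cf_inj => j; rewrite cfD !cf_tens coefD scalerDl. Qed.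
Lemma tens0l f : tens 0 f = 0 :> {mpoly 'F_2[n.+1]}.
Proof. by apply: cf_inj => j; rewrite cf0 !cf_tens scaler0. Qed.
Lemma tens0r k : tens k 0 = 0.
Proof. by apply: cf_inj => j; rewrite cf0 !cf_tens coef0 scale0r. Qed.

Lemma Sq1_tens k f : Sq 1 (tens k f) = tens (Sq 1 k) f + tens k (sq1_poly f).
Proof.
apply: cf_inj => j; rewrite cf_Sq1 cfD !cf_tens SqZ; congr (_ + _).
case: j => [|j]; first by rewrite coef_sq1_poly0 scale0r.
by rewrite cf_tens coef_sq1_polyS -F2_mulrn scalerMnl.
Qed.

Lemma Sq2_tens k f :
  Sq 2 (tens k f) = tens (Sq 2 k) f + tens (Sq 1 k) (sq1_poly f) + tens k (sq2_poly f).
Proof.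
apply: cf_inj => j; rewrite cf_Sq2 !cfD !cf_tens SqZ; congr (_ + _ + _).
  case: j => [|j]; first by rewrite coef_sq1_poly0 scale0r.
  by rewrite cf_tens SqZ coef_sq1_polyS -F2_mulrn scalerMnl.
case: j => [|[|j]]; rewrite ?coef_sq2_poly0 ?coef_sq2_poly1 ?scale0r //.
by rewrite cf_tens coef_sq2_polySS -odd_bin2 -F2_mulrn scalerMnl.
Qed.

Lemma Sq12_tens k f : Sq 1 (Sq 2 (tens k f)) =
  tens (Sq 1 (Sq 2 k)) f + tens (Sq 2 k) (sq1_poly f) + tens (Sq 1 k) (sq2_poly f) + tens k (sq1_poly (sq2_poly f)).
Proof.
by rewrite Sq2_tens !SqD !Sq1_tens Sq1_Sq1 sq1_sq1_poly tens0l tens0r !addr0 -!addrA.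
Qed.

Lemma homogeneous_tens_X d k : homogeneous d k -> homogeneous d.+1 (tens k 'X).
Proof.
move=> Hk e; apply: cf_inj => j; rewrite cf_trunc cf_tens coefX.
have [->|/negbTE nj] := eqVneq j 1%N.
  rewrite scale1r Hk ltn_subRL add1n; case: ifP => _; rewrite ?cf0 //.
  by rewrite cf_tens coefX scale1r.
by rewrite scale0r linear0; case: ifP => _; rewrite ?cf0 ?cf_tens ?coefX ?nj ?scale0r.
Qed.

Definition ext s := extension (span_pred s).

Lemma tens_ext s k f : k \in span_pred s -> f`_0 = 0 -> tens k f \in ext s.
Proof.
move=> Sk f0; apply/extensionP; split=> [|j]; rewrite cf_tens ?f0 ?scale0r //.
by case: (F2_cases f`_j) => ->; rewrite ?scale0r ?scale1r ?span0.
Qed.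

Lemma ext_nil x : x \in ext [::] -> x = 0.
Proof.
case/extensionP => _ Ex; apply: cf_inj => j; rewrite cf0.
by have := Ex j; rewrite span_nil => /eqP.
Qed.

(** An element of E (x) V_1 is expanded along the generators of E. *)
Lemma ext_cons k s x : x \in ext (k :: s) ->
  exists2 f : {poly 'F_2}, f`_0 = 0 & exists2 y, y \in ext s & x = tens k f + y.
Proof.
case/extensionP => x0 Ex.
pose f : {poly 'F_2} := \poly_(j < size (to_coefs x)) (cf j x \notin span_pred s)%:R.
have fj j : f`_j = (cf j x \notin span_pred s)%:R.
  rewrite coef_poly; case: ltnP => // le_j.
  by rewrite /cf nth_default // span0.
have f0 : f`_0 = 0 by rewrite fj x0 span0.
exists f => //; exists (x + tens k f); last by rewrite addrCA mpoly_char2 addr0.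
apply/extensionP; rewrite cfD cf_tens f0 scale0r addr0; split=> // j.
rewrite cfD cf_tens fj; have := Ex j; rewrite span_cons.
by case: (boolP (cf j x \in span_pred s)) => /= Sx; rewrite ?scale0r ?addr0 ?scale1r.
Qed.

(** Comparison of the components along linearly independent generators. *)
Lemma tens_inj k s f y : k \notin span_pred s -> y \in ext s ->
  tens k f + y = 0 -> f = 0 /\ y = 0.
Proof.
move=> nSk /extensionP[_ Ey] E.
have f0 : f = 0.
  apply/polyP => j; rewrite coef0; have := congr1 (cf j) E.
  rewrite cfD cf_tens cf0; case: (F2_cases f`_j) => -> // /eqP.
  by rewrite scale1r addr_eq0 mpoly_oppr => /eqP Dk; case/negP: nSk; rewrite Dk; apply: Ey.
by split=> //; rewrite f0 tens0r add0r in E.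
Qed.
End Tensor.

(** * The four small modules *)

(** A finite submodule of V_n, given by homogeneous generators s, whose inclusion
    in V_n induces an isomorphism of Q1-homologies; c is a generator of the
    latter. *)
Record q1_model n (s : seq {mpoly 'F_2[n]}) (c : {mpoly 'F_2[n]}) : Prop := Q1Model {
  model_positive : {subset s <= positive n};
  model_hom : forall k, k \in s -> exists d, homogeneous d k;
  model_Sq1 : forall k, k \in s -> Sq 1 k \in span_pred s;
  model_Sq2 : forall k, k \in s -> Sq 2 k \in span_pred s;
  model_class : c \in span_pred s;
  model_sqr : exists2 kappa, kappa \in positive n & c = sqr_class n + Q1 kappa;
  model_ker : forall e, e \in span_pred s -> Q1 e = 0 ->
    exists2 e', e' \in span_pred s & e = Q1 e' \/ e = Q1 e' + c
}.

Section Model.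
Variables (n : nat) (s : seq {mpoly 'F_2[n]}) (c : {mpoly 'F_2[n]}).
Hypothesis M : q1_model s c.

Let span_positive : {subset span_pred s <= positive n}.
Proof.
apply: span_sub => [|x y Px Py|]; [exact: rpred0 | exact: rpredD | exact: model_positive M].
Qed.

Let span_Sq1 k : k \in span_pred s -> Sq 1 k \in span_pred s.
Proof.
apply: (span_sub (P := fun k => Sq 1 k \in span_pred s)) => [|x y Sx Sy|].
- by rewrite Sq_0 span0.
- by rewrite SqD spanD.
exact: model_Sq1 M.
Qed.

Let span_Sq2 k : k \in span_pred s -> Sq 2 k \in span_pred s.
Proof.
apply: (span_sub (P := fun k => Sq 2 k \in span_pred s)) => [|x y Sx Sy|].
- by rewrite Sq_0 span0.
- by rewrite SqD spanD.
exact: model_Sq2 M.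
Qed.

Let span_trunc d k : k \in span_pred s -> trunc d k \in span_pred s.
Proof.
apply: (span_sub (P := fun k => trunc d k \in span_pred s)) => [|x y Sx Sy|l sl].
- by rewrite linear0 span0.
- by rewrite linearD spanD.
have [e ->] := model_hom M sl.
by case: ifP => _; [apply: mem_span | apply: span0].
Qed.

Let span_q1 k : k \in positive n -> Q1 k \in span_pred s ->
  exists2 y, y \in positive n & k + Q1 y \in span_pred s.
Proof.
have [kap Pk Dk] := model_sqr M.
exact: (span_q1_exact (model_positive M) (model_class M) Pk Dk (model_ker M)).
Qed.

Lemma model_ker_sq3 x : x \in positive n.+1 -> Sq 1 (Sq 2 x) = 0 ->
  exists2 y, y \in positive n.+1 & x + Sq 2 y \in ext s.
Proof.
move=> Px Kx.
have [y Py Wy] := ker_sq3_extension span_Sq1 span_Sq2 span_trunc span_q1 Px Kx.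
by exists y => //; rewrite -[Sq 2 y]mpoly_oppr.
Qed.

Lemma model_hit x u v : x \in ext s ->
    u \in positive n.+1 -> v \in positive n.+1 -> x = Sq 1 u + Sq 2 v ->
  exists p q, [/\ p \in ext s, q \in ext s & x = Sq 1 p + Sq 2 q].
Proof. exact: (hit_extension span_positive span_Sq1 span_Sq2 span_trunc span_q1). Qed.

Lemma ext_positive x : x \in ext s -> x \in positive n.+1.
Proof. exact: (extension_positive span_positive). Qed.

Lemma class_neq0 : c != 0.
Proof.
have [kap _ Dc] := model_sqr M; apply/eqP => c0.
have /eqP[] := sqr_class_not_q1 kap; rewrite -[LHS]add0r -c0 Dc -addrA.
by rewrite mpoly_char2 addr0.
Qed.
End Model.

Lemma ext0 n (s : seq {mpoly 'F_2[n]}) : 0 \in ext s.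
Proof. by apply/extensionP; rewrite cf0; split=> // j; rewrite cf0 span0. Qed.

Lemma extD n (s : seq {mpoly 'F_2[n]}) x y : x \in ext s -> y \in ext s -> x + y \in ext s.
Proof.
case/extensionP => x0 Ex /extensionP[y0 Ey]; apply/extensionP.
by rewrite cfD x0 y0 addr0; split=> // j; rewrite cfD; apply: spanD; [apply: Ex | apply: Ey].
Qed.

Lemma span_consE n k s (x : {mpoly 'F_2[n]}) : x \in span_pred (k :: s) ->
  exists c : 'F_2, exists2 y, y \in span_pred s & x = c *: k + y.
Proof.
rewrite span_cons => /orP[Sx|Sx]; first by exists 0, x; rewrite ?scale0r ?add0r.
by exists 1, (x + k); rewrite // scale1r addrCA mpoly_char2 addr0.
Qed.

Lemma spanZ n s (c : 'F_2) (x : {mpoly 'F_2[n]}) :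
  x \in span_pred s -> c *: x \in span_pred s.
Proof. by case: (F2_cases c) => -> Sx; rewrite ?scale0r ?span0 ?scale1r. Qed.

Lemma scale_eq0 n (c : 'F_2) (x : {mpoly 'F_2[n]}) : c *: x = 0 -> x != 0 -> c = 0.
Proof. by case: (F2_cases c) => -> //; rewrite scale1r => -> /eqP. Qed.

Lemma tensZr n (k : {mpoly 'F_2[n]}) c f : tens k (c *: f) = c *: tens k f.
Proof. by case: (F2_cases c) => ->; rewrite ?scale0r ?tens0r ?scale1r. Qed.

Ltac in_ext :=
  repeat first [apply: extD | apply: tens_ext];
  rewrite ?coefD ?coef_sq1_poly0 ?coef_sq2_poly0 ?addr0 ?add0r //;
  by rewrite mem_span // !inE eqxx ?orbT.

Section Relations.
Variable n : nat.
Implicit Type x : {mpoly 'F_2[n]}.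
Lemma Sq1_Sq2_Sq2 x : Sq 1 (Sq 2 (Sq 2 x)) = 0.
Proof. by rewrite Sq2_Sq2 Sq1_Sq1. Qed.
Lemma Sq2_Sq2_Sq1 x : Sq 2 (Sq 2 (Sq 1 x)) = 0.
Proof. by rewrite Sq2_Sq2 Sq1_Sq1 !Sq_0. Qed.
Lemma Sq2_Sq2_Sq2 x : Sq 2 (Sq 2 (Sq 2 x)) = Sq 1 (Sq 2 (Sq 1 (Sq 2 x))).
Proof. by rewrite Sq2_Sq2. Qed.
Lemma Sq2_Sq1_Sq2_Sq1 x : Sq 2 (Sq 1 (Sq 2 (Sq 1 x))) = Sq 2 (Sq 2 (Sq 2 x)).
Proof. by rewrite -Sq2_Sq2. Qed.
End Relations.

Section Cases.
Variables (n d : nat) (xi : {mpoly 'F_2[n]}).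
Hypotheses (xi_positive : xi \in positive n) (xi_hom : homogeneous d xi).

Section Invariant.
Hypotheses (a_xi : Sq 1 xi = 0) (b_xi : Sq 2 xi = 0).
Hypothesis xi_sqr : exists2 kappa, kappa \in positive n & xi = sqr_class n + Q1 kappa.

Lemma invariant_model : q1_model [:: xi] xi.
Proof.
split=> //.
- by move=> k; rewrite inE => /eqP ->.
- by move=> k; rewrite inE => /eqP ->; exists d.
- by move=> k; rewrite inE => /eqP ->; rewrite a_xi span0.
- by move=> k; rewrite inE => /eqP ->; rewrite b_xi span0.
- by rewrite mem_span ?mem_head.
move=> e /span_consE[c [y]]; rewrite span_nil => /eqP -> -> _.
exists 0; first exact: span0.
by rewrite Q1_0 !add0r addr0; case: (F2_cases c) => ->; [left | right];
   rewrite ?scale0r ?scale1r.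
Qed.

(** Here E (x) V_1 is a copy of V_1. *)
Lemma invariant_ker_sq3 x : x \in ext [:: xi] -> Sq 1 (Sq 2 x) = 0 ->
  exists p q (c : 'F_2), [/\ p \in ext [:: xi], q \in ext [:: xi] &
    x = Sq 1 p + Sq 2 q + c *: tens xi 'X].
Proof.
have nxi : xi \notin span_pred [::].
  by rewrite span_nil; apply: class_neq0 invariant_model.
have Sxi : xi \in span_pred [:: xi] by rewrite mem_span ?mem_head.
case/ext_cons => f f0 [y /ext_nil -> ->]; rewrite addr0.
rewrite Sq12_tens a_xi b_xi Sq_0 !tens0l !add0r => E.
have [||abf _] := @tens_inj n xi [::] (sq1_poly (sq2_poly f)) 0 nxi.
- exact: ext0.
- by rewrite addr0.
have [p [q [p0 q0 Df]]] := ker_sq3_poly f0 abf.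
exists (tens xi p), (tens xi q), f`_1; split; try exact: tens_ext.
rewrite Sq1_tens Sq2_tens a_xi b_xi !tens0l !add0r {1}Df !tensDr; congr (_ + _).
exact: tensZr.
Qed.
End Invariant.

Section QuestionMark.
Hypothesis b_xi : Sq 2 xi = 0.
Let xi1 := Sq 1 xi.
Let xi2 := Sq 2 xi1.
Hypothesis xi2_neq0 : xi2 != 0.
Hypothesis xi_sqr : exists2 kappa, kappa \in positive n & xi1 = sqr_class n + Q1 kappa.

Let a_xi1 : Sq 1 xi1 = 0. Proof. exact: Sq1_Sq1. Qed.
Let a_xi2 : Sq 1 xi2 = 0. Proof. by rewrite /xi2 /xi1 -Sq2_Sq2 b_xi Sq_0. Qed.
Let b_xi2 : Sq 2 xi2 = 0. Proof. exact: Sq2_Sq2_Sq1. Qed.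
Let q_xi : Q1 xi = xi2. Proof. by rewrite Q1E b_xi Sq_0 add0r. Qed.
Let q_xi1 : Q1 xi1 = 0. Proof. by rewrite Q1E a_xi1 Sq_0 addr0 a_xi2. Qed.
Let q_xi2 : Q1 xi2 = 0. Proof. by rewrite Q1E a_xi2 b_xi2 !Sq_0 addr0. Qed.
Let s := [:: xi; xi1; xi2].
Let s_cases k : k \in s -> [\/ k = xi, k = xi1 | k = xi2].
Proof.
rewrite !inE => /or3P[] /eqP; [exact: Or31 | exact: Or32 | exact: Or33].
Qed.
Let s0 : xi \in span_pred s. Proof. by rewrite mem_span // mem_head. Qed.
Let s1 : xi1 \in span_pred s. Proof. by rewrite mem_span // !inE eqxx orbT. Qed.
Let s2 : xi2 \in span_pred s. Proof. by rewrite mem_span // !inE eqxx !orbT. Qed.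

Lemma question_mark_model : q1_model s xi1.
Proof.
split=> //.
- by move=> k /s_cases[] ->; rewrite ?positive_Sq.
- move=> k /s_cases[] ->; first by exists d.
    by exists (d + 1)%N; apply: hom_Sq.
  by exists (d + 1 + 2)%N; do 2!apply: hom_Sq.
- by move=> k /s_cases[] ->; rewrite ?a_xi1 ?a_xi2 ?span0.
- by move=> k /s_cases[] ->; rewrite ?b_xi ?b_xi2 ?span0.
move=> e /span_consE[c0 [y /span_consE[c1 [z /span_consE[c2 [v]]]]]].
rewrite span_nil => /eqP -> -> -> ->; rewrite addr0 !Q1D !Q1Z q_xi q_xi1 q_xi2.
rewrite !scaler0 !addr0 => /scale_eq0/(_ xi2_neq0) ->; rewrite scale0r add0r.
exists (c2 *: xi); first exact: spanZ.
by rewrite Q1Z q_xi; case: (F2_cases c1) => ->; [left | right];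
   rewrite ?scale0r ?scale1r ?add0r // addrC.
Qed.

(** For x = xi (x) f0 + xi1 (x) f1 + xi2 (x) f2, the components of Sq^3 x = 0
    along xi1 and xi2 read Sq^2 f0 = Sq^3 f1 and Sq^1 f1 = Sq^3 f2. The first
    forces Sq^2 f0 = 0, and the second shows that x is xi (x) f0 modulo hit
    elements. *)
Lemma question_mark_ker_sq3 x : x \in ext s -> Sq 1 (Sq 2 x) = 0 ->
  exists p q (c : 'F_2), [/\ p \in ext s, q \in ext s &
    x = Sq 1 p + Sq 2 q + c *: tens xi 'X].
Proof.
have n0 : xi \notin span_pred [:: xi1; xi2].
  apply: (notin_span (phi := @Q1 n)); [exact: Q1D | exact: Q1_0 | by rewrite q_xi |].
  by rewrite /= q_xi1 q_xi2 eqxx.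
have n1 : xi1 \notin span_pred [:: xi2].
  apply: (notin_span (phi := @Sq n 2)) => //; [exact: SqD | exact: Sq_0 |].
  by rewrite /= b_xi2 eqxx.
have n2 : xi2 \notin span_pred [::] by rewrite span_nil.
case/ext_cons => f0 f00 [_ /ext_cons[f1 f10 [_ /ext_cons[f2 f20 [_ /ext_nil -> ->]]]] -> ->].
rewrite addr0 => E.
have {E} : tens xi (sq1_poly (sq2_poly f0)) +
    (tens xi1 (sq2_poly f0 + sq1_poly (sq2_poly f1)) + tens xi2 (sq1_poly f1 + sq1_poly (sq2_poly f2))) = 0.
  rewrite -E !SqD !Sq12_tens -/xi1 -/xi2 b_xi a_xi1 a_xi2 b_xi2 !Sq_0 !tens0l !tensDr.
  by cancel_pairs (@mpoly_char2 n.+1).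
case/(tens_inj n0) => [|_]; first by in_ext.
case/(tens_inj n1) => [|E1]; first by in_ext.
rewrite -[tens _ _]addr0 => /(tens_inj n2 (ext0 _)) [E2 _].
have bf0 : sq2_poly f0 = 0.
  by apply: (sq2_poly_eq_sq3_poly (g := f1)); apply: addr_pair_eq polyF2_char2 _ _ E1.
have [g g0 Df0] := ker_sq2_poly f00 bf0.
exists (tens xi (f1 + sq2_poly f2 + sq1_poly g)), (tens xi1 f2 + tens xi g), f0`_1.
split; try by in_ext.
rewrite -tensZr SqD !Sq1_tens !Sq2_tens -/xi1 -/xi2 b_xi a_xi1 !tens0l !sq1_polyD sq1_sq1_poly.
rewrite {1}Df0 !tensDr.
have : tens xi (sq1_poly f1 + sq1_poly (sq2_poly f2)) = 0 by rewrite E2 tens0r.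
rewrite tensDr => E3; rewrite -[LHS]addr0 -E3 tens0r.
by cancel_pairs (@mpoly_char2 n.+1).
Qed.
End QuestionMark.

Section Joker.
Hypothesis ab_xi : Sq 1 (Sq 2 xi) = 0.
Let xi1 := Sq 1 xi.
Let xi2 := Sq 2 xi.
Let xi3 := Sq 2 xi1.
Let xi4 := Sq 2 xi2.
Hypothesis xi4_neq0 : xi4 != 0.
Hypothesis xi_sqr : exists2 kappa, kappa \in positive n & xi2 = sqr_class n + Q1 kappa.

Let a_xi1 : Sq 1 xi1 = 0. Proof. exact: Sq1_Sq1. Qed.
Let a_xi3 : Sq 1 xi3 = xi4. Proof. by rewrite /xi3 /xi1 -Sq2_Sq2. Qed.
Let a_xi4 : Sq 1 xi4 = 0. Proof. exact: Sq1_Sq2_Sq2. Qed.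
Let b_xi3 : Sq 2 xi3 = 0. Proof. exact: Sq2_Sq2_Sq1. Qed.
Let b_xi4 : Sq 2 xi4 = 0. Proof. by rewrite /xi4 Sq2_Sq2_Sq2 ab_xi !Sq_0. Qed.
Let q_xi : Q1 xi = xi3. Proof. by rewrite Q1E ab_xi add0r. Qed.
Let q_xi1 : Q1 xi1 = xi4. Proof. by rewrite Q1E a_xi1 Sq_0 addr0 -/xi3 a_xi3. Qed.
Let q_xi2 : Q1 xi2 = 0. Proof. by rewrite Q1E ab_xi -/xi4 a_xi4 Sq_0 addr0. Qed.
Let q_xi3 : Q1 xi3 = 0. Proof. by rewrite Q1E b_xi3 a_xi3 b_xi4 Sq_0 addr0. Qed.
Let q_xi4 : Q1 xi4 = 0. Proof. by rewrite Q1E a_xi4 b_xi4 !Sq_0 addr0. Qed.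
Let s := [:: xi; xi1; xi2; xi3; xi4].
Let s_cases k : k \in s -> k = xi \/ [\/ k = xi1, k = xi2, k = xi3 | k = xi4].
Proof.
rewrite inE => /orP[/eqP ->|]; first by left.
rewrite !inE => /or4P[] /eqP ->; right;
  [exact: Or41 | exact: Or42 | exact: Or43 | exact: Or44].
Qed.
Let s0 : xi \in span_pred s. Proof. by rewrite mem_span // mem_head. Qed.
Let s1 : xi1 \in span_pred s. Proof. by rewrite mem_span // !inE eqxx !orbT. Qed.
Let s2 : xi2 \in span_pred s. Proof. by rewrite mem_span // !inE eqxx !orbT. Qed.
Let s3 : xi3 \in span_pred s. Proof. by rewrite mem_span // !inE eqxx !orbT. Qed.
Let s4 : xi4 \in span_pred s. Proof. by rewrite mem_span // !inE eqxx !orbT. Qed.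

Lemma joker_model : q1_model s xi2.
Proof.
split=> //.
- by move=> k /s_cases[|[]] ->; rewrite ?positive_Sq.
- move=> k /s_cases[|[]] ->; first by exists d.
  + by exists (d + 1)%N; apply: hom_Sq.
  + by exists (d + 2)%N; apply: hom_Sq.
  + by exists (d + 1 + 2)%N; do 2!apply: hom_Sq.
  by exists (d + 2 + 2)%N; do 2!apply: hom_Sq.
- by move=> k /s_cases[|[]] ->; rewrite ?a_xi1 ?ab_xi ?a_xi3 ?a_xi4 ?span0.
- by move=> k /s_cases[|[]] ->; rewrite ?b_xi3 ?b_xi4 ?span0.
move=> e /span_consE[c0 [y0 /span_consE[c1 [y1 /span_consE[c2 [y2 /span_consE[c3 [y3
  /span_consE[c4 [y4]]]]]]]]]].
rewrite span_nil => /eqP -> -> -> -> -> ->; rewrite addr0 !Q1D !Q1Z.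
rewrite q_xi q_xi1 q_xi2 q_xi3 q_xi4 !scaler0 !addr0 => E.
have c00 : c0 = 0.
  apply: scale_eq0 xi4_neq0; have := congr1 (@Sq n 1) E.
  by rewrite SqD !SqZ a_xi3 a_xi4 scaler0 addr0 Sq_0.
have c10 : c1 = 0.
  by move: E; rewrite c00 scale0r add0r => /scale_eq0; apply.
exists (c3 *: xi + c4 *: xi1); first by apply: spanD; apply: spanZ.
rewrite c00 c10 !scale0r !add0r Q1D !Q1Z q_xi q_xi1.
by case: (F2_cases c2) => ->; [left | right];
   rewrite ?scale0r ?scale1r ?add0r // addrC.
Qed.

(** Modulo hit elements x is xi (x) f with f = f0 + Sq^2 f2, since the antipode of
    A(1) fixes Sq^1 and Sq^2, and Sq^2 Sq^2 vanishes on F_2[t]. Conversely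
    xi (x) Sq^2 Sq^1 g is hit, as Sq^1 Sq^2 xi = 0. The components of Sq^3 x = 0
    yield Sq^1 f = 0 = Sq^2 f, which makes f a value of Sq^2 Sq^1. *)
Lemma joker_ker_sq3 x : x \in ext s -> Sq 1 (Sq 2 x) = 0 ->
  exists p q, [/\ p \in ext s, q \in ext s & x = Sq 1 p + Sq 2 q].
Proof.
have n0 : xi \notin span_pred [:: xi1; xi2; xi3; xi4].
  apply: (notin_span (phi := fun k => Sq 2 (Sq 2 k))) => //.
  - by move=> u v; rewrite !SqD.
  - by rewrite !Sq_0.
  by rewrite /= -/xi3 b_xi3 -/xi4 b_xi4 !Sq_0 eqxx.
have n1 : xi1 \notin span_pred [:: xi2; xi3; xi4].
  apply: (notin_span (phi := @Q1 n)); [exact: Q1D | exact: Q1_0 | by rewrite q_xi1 |].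
  by rewrite /= q_xi2 q_xi3 q_xi4 eqxx.
have n2 : xi2 \notin span_pred [:: xi3; xi4].
  apply: (notin_span (phi := @Sq n 2)) => //; [exact: SqD | exact: Sq_0 |].
  by rewrite /= b_xi3 b_xi4 eqxx.
have n3 : xi3 \notin span_pred [:: xi4].
  apply: (notin_span (phi := @Sq n 1)); [exact: SqD | exact: Sq_0 | by rewrite a_xi3 |].
  by rewrite /= a_xi4 eqxx.
have n4 : xi4 \notin span_pred [::] by rewrite span_nil.
case/ext_cons => f0 f00 [_ /ext_cons[f1 f10 [_ /ext_cons[f2 f20 [_ /ext_cons[f3 f30 [_
  /ext_cons[f4 f40 [_ /ext_nil -> ->]]]]]]]] -> -> -> ->].
rewrite addr0 => E.
have {E} : tens xi (sq1_poly (sq2_poly f0)) + (tens xi1 (sq2_poly f0 + sq1_poly (sq2_poly f1)) +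
    (tens xi2 (sq1_poly f0 + sq1_poly (sq2_poly f2)) + (tens xi3 (sq1_poly f1 + sq1_poly (sq2_poly f3)) +
     tens xi4 (f1 + sq1_poly f2 + sq2_poly f3 + sq1_poly (sq2_poly f4))))) = 0.
  rewrite -E !SqD !Sq12_tens -/xi1 -/xi2 -/xi3 -/xi4 ab_xi a_xi1 a_xi3 a_xi4.
  rewrite b_xi3 b_xi4 !Sq_0 !tens0l !tensDr.
  by cancel_pairs (@mpoly_char2 n.+1).
case/(tens_inj n0) => [|_]; first by in_ext.
case/(tens_inj n1) => [|E1]; first by in_ext.
case/(tens_inj n2) => [|E2]; first by in_ext.
case/(tens_inj n3) => [|_]; first by in_ext.
rewrite -[tens _ _]addr0 => /(tens_inj n4 (ext0 _)) [E4 _].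
have bf0 : sq2_poly f0 = 0.
  by apply: (sq2_poly_eq_sq3_poly (g := f1)); apply: addr_pair_eq polyF2_char2 _ _ E1.
have [||| g g0 Dg] := @ker_sq1_ker_sq2_poly (f0 + sq2_poly f2).
- by rewrite coefD f00 coef_sq2_poly0 addr0.
- by rewrite sq1_polyD.
- by rewrite sq2_polyD bf0 sq2_sq2_poly addr0.
exists (tens xi2 g), (tens xi2 f4 + tens xi1 f3 + tens xi (f2 + sq2_poly f4 + sq1_poly g)).
split; try by in_ext.
rewrite !SqD !Sq1_tens !Sq2_tens -/xi1 -/xi2 -/xi3 -/xi4 ab_xi a_xi1 !tens0l.
rewrite !sq2_polyD !sq1_polyD sq1_sq1_poly sq2_sq2_poly -Dg !tensDr !tens0r.
have : tens xi1 (f1 + sq1_poly f2 + sq2_poly f3 + sq1_poly (sq2_poly f4)) = 0 by rewrite E4 tens0r.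
rewrite !tensDr => E5; rewrite -[LHS]addr0 -[X in _ + X = _]E5.
by cancel_pairs (@mpoly_char2 n.+1).
Qed.
End Joker.

Section DualQuestionMark.
Hypotheses (a_xi : Sq 1 xi = 0) (bab_xi : Sq 2 (Sq 1 (Sq 2 xi)) = 0).
Let xi1 := Sq 2 xi.
Let xi2 := Sq 1 xi1.
Hypothesis xi2_neq0 : xi2 != 0.
Hypothesis xi_sqr : exists2 kappa, kappa \in positive n & xi1 = sqr_class n + Q1 kappa.

Let a_xi2 : Sq 1 xi2 = 0. Proof. exact: Sq1_Sq1. Qed.
Let b_xi1 : Sq 2 xi1 = 0. Proof. by rewrite /xi1 Sq2_Sq2 a_xi !Sq_0. Qed.
Let b_xi2 : Sq 2 xi2 = 0. Proof. exact: bab_xi. Qed.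
Let q_xi : Q1 xi = xi2. Proof. by rewrite Q1E a_xi Sq_0 addr0. Qed.
Let q_xi1 : Q1 xi1 = 0. Proof. by rewrite Q1E b_xi1 -/xi2 b_xi2 Sq_0 addr0. Qed.
Let q_xi2 : Q1 xi2 = 0. Proof. by rewrite Q1E a_xi2 b_xi2 !Sq_0 addr0. Qed.
Let s := [:: xi; xi1; xi2].
Let s_cases k : k \in s -> [\/ k = xi, k = xi1 | k = xi2].
Proof.
rewrite !inE => /or3P[] /eqP; [exact: Or31 | exact: Or32 | exact: Or33].
Qed.
Let s0 : xi \in span_pred s. Proof. by rewrite mem_span // mem_head. Qed.
Let s1 : xi1 \in span_pred s. Proof. by rewrite mem_span // !inE eqxx orbT. Qed.
Let s2 : xi2 \in span_pred s. Proof. by rewrite mem_span // !inE eqxx !orbT. Qed.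

Lemma dual_question_mark_model : q1_model s xi1.
Proof.
split=> //.
- by move=> k /s_cases[] ->; rewrite ?positive_Sq.
- move=> k /s_cases[] ->; first by exists d.
    by exists (d + 2)%N; apply: hom_Sq.
  by exists (d + 2 + 1)%N; do 2!apply: hom_Sq.
- by move=> k /s_cases[] ->; rewrite ?a_xi ?a_xi2 ?span0.
- by move=> k /s_cases[] ->; rewrite ?b_xi1 ?b_xi2 ?span0.
move=> e /span_consE[c0 [y /span_consE[c1 [z /span_consE[c2 [v]]]]]].
rewrite span_nil => /eqP -> -> -> ->; rewrite addr0 !Q1D !Q1Z q_xi q_xi1 q_xi2.
rewrite !scaler0 !addr0 => /scale_eq0/(_ xi2_neq0) ->; rewrite scale0r add0r.
exists (c2 *: xi); first exact: spanZ.
by rewrite Q1Z q_xi; case: (F2_cases c1) => ->; [left | right];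
   rewrite ?scale0r ?scale1r ?add0r // addrC.
Qed.

(** Modulo hit elements x is xi (x) f with f = f0 + Sq^2 f1 + Sq^2 Sq^1 f2. The last
    component of Sq^3 x = 0 turns f into Sq^1 Sq^2 f2 + Sq^2 Sq^1 f2, which is
    in the image of Sq^1, and xi (x) Sq^1 g = Sq^1 (xi (x) g). *)
Lemma dual_question_mark_ker_sq3 x : x \in ext s -> Sq 1 (Sq 2 x) = 0 ->
  exists p q, [/\ p \in ext s, q \in ext s & x = Sq 1 p + Sq 2 q].
Proof.
have n0 : xi \notin span_pred [:: xi1; xi2].
  apply: (notin_span (phi := @Q1 n)); [exact: Q1D | exact: Q1_0 | by rewrite q_xi |].
  by rewrite /= q_xi1 q_xi2 eqxx.
have n1 : xi1 \notin span_pred [:: xi2].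
  apply: (notin_span (phi := @Sq n 1)) => //; [exact: SqD | exact: Sq_0 |].
  by rewrite /= a_xi2 eqxx.
have n2 : xi2 \notin span_pred [::] by rewrite span_nil.
case/ext_cons => f0 f00 [_ /ext_cons[f1 f10 [_ /ext_cons[f2 f20 [_ /ext_nil -> ->]]]] -> ->].
rewrite addr0 => E.
have {E} : tens xi (sq1_poly (sq2_poly f0)) +
    (tens xi1 (sq1_poly f0 + sq1_poly (sq2_poly f1)) + tens xi2 (f0 + sq2_poly f1 + sq1_poly (sq2_poly f2))) = 0.
  rewrite -E !SqD !Sq12_tens -/xi1 -/xi2 a_xi b_xi1 a_xi2 b_xi2 !Sq_0 !tens0l !tensDr.
  by cancel_pairs (@mpoly_char2 n.+1).
case/(tens_inj n0) => [|_]; first by in_ext.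
case/(tens_inj n1) => [|_]; first by in_ext.
rewrite -[tens _ _]addr0 => /(tens_inj n2 (ext0 _)) [E2 _].
have [||g g0 Dg] := @ker_sq1_poly (sq2_poly (sq1_poly f2)); rewrite ?coef_sq2_poly0 ?sq1_sq2_sq1_poly //.
exists (tens xi1 f2 + tens xi (sq2_poly f2 + g)), (tens xi (f1 + sq1_poly f2)).
split; try by in_ext.
rewrite !SqD !Sq1_tens !Sq2_tens -/xi1 -/xi2 a_xi !tens0l !sq2_polyD !sq1_polyD -Dg !tensDr.
have : tens xi (f0 + sq2_poly f1 + sq1_poly (sq2_poly f2)) = 0 by rewrite E2 tens0r.
rewrite !tensDr => E3; rewrite -[LHS]addr0 -[X in _ + X = _]E3.
by cancel_pairs (@mpoly_char2 n.+1).
Qed.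
End DualQuestionMark.
End Cases.

(** * An invariant of degree 8 *)

(** In characteristic 2 the term counted four times disappears, and the Moore
    determinant is the product of the nonzero linear forms in y, z, u. *)
Lemma moore_det_factor (R : comNzRingType) (y z u : R) :
  (y ^+ 2 * z + y * z ^+ 2) ^+ 2 * u + (y ^+ 2 * u + y * u ^+ 2) ^+ 2 * z +
    (z ^+ 2 * u + z * u ^+ 2) ^+ 2 * y +
    ((y * z * u) ^+ 2 * (y + z + u) *+ 2 + (y * z * u) ^+ 2 * (y + z + u) *+ 2) =
  y * z * u * ((y + z) * (y + u) * (z + u)) * (y + z + u).
Proof. ring. Qed.

Section Bott.
Variable n : nat.
Local Notation K := {mpoly 'F_2[n]}.
Implicit Types p q x y z u : K.

(** The properties of linear forms that determine the action on their products. *)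
Definition linear_like x := Sq 1 x = x ^+ 2 /\ Sq 2 x = 0.

Lemma Sq1_sqrM p q : Sq 1 (p ^+ 2 * q) = p ^+ 2 * Sq 1 q.
Proof. by rewrite Sq1M Sq1_sqr mul0r add0r. Qed.

Lemma Sq2_sqrM p q : Sq 2 (p ^+ 2 * q) = Sq 1 p ^+ 2 * q + p ^+ 2 * Sq 2 q.
Proof. by rewrite Sq2M Sq1_sqr Sq2_sqr mul0r addr0. Qed.

Lemma Q1_sqrM p q : Q1 (p ^+ 2 * q) = p ^+ 2 * Q1 q.
Proof. by rewrite Q1M Q1_sqr mul0r add0r. Qed.

Section Elements.
Variables x y z u : K.
Hypotheses (x_lin : linear_like x) (y_lin : linear_like y).
Hypotheses (z_lin : linear_like z) (u_lin : linear_like u).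
Let ax : Sq 1 x = x ^+ 2. Proof. by case: x_lin. Qed.
Let ay : Sq 1 y = y ^+ 2. Proof. by case: y_lin. Qed.
Let az : Sq 1 z = z ^+ 2. Proof. by case: z_lin. Qed.
Let au : Sq 1 u = u ^+ 2. Proof. by case: u_lin. Qed.
Let bx : Sq 2 x = 0. Proof. by case: x_lin. Qed.
Let b_y : Sq 2 y = 0. Proof. by case: y_lin. Qed.
Let bz : Sq 2 z = 0. Proof. by case: z_lin. Qed.
Let bu : Sq 2 u = 0. Proof. by case: u_lin. Qed.

Lemma Sq2_prod2 : Sq 2 (y * z) = y ^+ 2 * z ^+ 2.
Proof. by rewrite Sq2M ay az b_y bz mul0r mulr0 add0r addr0. Qed.

Lemma Sq12_prod2 : Sq 1 (Sq 2 (y * z)) = 0.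
Proof. by rewrite Sq2_prod2 -exprMn Sq1_sqr. Qed.

Lemma Sq22_prod2 : Sq 2 (Sq 2 (y * z)) = (y * z * (y + z)) ^+ 2.
Proof.
rewrite Sq2_prod2 -exprMn Sq2_sqr Sq1M ay az; congr (_ ^+ 2); ring.
Qed.

Lemma Sq2_prod3 : Sq 2 (y * z * u) =
  (y * z) ^+ 2 * u + (y * u) ^+ 2 * z + (z * u) ^+ 2 * y.
Proof. by rewrite Sq2M Sq2_prod2 Sq1M ay az au bu; ring. Qed.

Lemma Sq22_prod3 : Sq 2 (Sq 2 (y * z * u)) =
  (y ^+ 2 * z + y * z ^+ 2) ^+ 2 * u + (y ^+ 2 * u + y * u ^+ 2) ^+ 2 * z +
  (z ^+ 2 * u + z * u ^+ 2) ^+ 2 * y.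
Proof.
by rewrite Sq2_prod3 !SqD !Sq2_sqrM !Sq1M ay az au b_y bz bu !mulr0 !addr0.
Qed.

(** Sq^2 Sq^2 (yzu) is the Moore determinant, the sum of the six y^4 z^2 u; Sq^2
    sends two of these terms to each y^4 z^4 u. *)
Lemma Sq222_prod3 : Sq 2 (Sq 2 (Sq 2 (y * z * u))) = 0.
Proof.
have D v1 v2 : linear_like v1 -> linear_like v2 -> Sq 1 (v1 ^+ 2 * v2 + v1 * v2 ^+ 2) = 0.
  move=> [a1 _] [a2 _]; rewrite SqD Sq1_sqrM [v1 * _]mulrC Sq1_sqrM a1 a2.
  by rewrite [v2 ^+ 2 * _]mulrC mpoly_char2.
by rewrite Sq22_prod3 !SqD !Sq2_sqrM !D // expr0n !mul0r b_y bz bu !mulr0 !addr0.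
Qed.

(** The generator y^2 z u + y z^2 u + y z u^2 of the upside-down question mark. Its
    middle class [prod3_1] represents (yzu)^2 in Q1-homology, and its top class
    [prod3_2] is the Moore determinant of y, z, u. *)
Definition prod3_0 := Sq 1 (y * z * u).
Definition prod3_1 := Sq 2 prod3_0.
Definition prod3_2 := Sq 1 prod3_1.

Lemma Sq2_prod3_2 : Sq 2 prod3_2 = 0.
Proof. by rewrite /prod3_2 /prod3_1 /prod3_0 Sq2_Sq1_Sq2_Sq1 Sq222_prod3. Qed.

Lemma prod3_2E : prod3_2 = Sq 2 (Sq 2 (y * z * u)).
Proof. by rewrite /prod3_2 /prod3_1 /prod3_0 -Sq2_Sq2. Qed.

Lemma prod3_1E : prod3_1 = (y * z * u) ^+ 2 + Q1 (y * z * u).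
Proof.
rewrite Q1E -/prod3_0 -/prod3_1 Sq2_prod3 !SqD !Sq1_sqrM ay az au.
rewrite !exprMn; set v := y ^+ 2 * z ^+ 2 * u ^+ 2.
have -> : y ^+ 2 * u ^+ 2 * z ^+ 2 = v by rewrite mulrAC.
have -> : z ^+ 2 * u ^+ 2 * y ^+ 2 = v by rewrite mulrC mulrA.
by rewrite !addrA mpoly_char2 add0r mpoly_char2 add0r.
Qed.

(** The pairing of the question mark x, x^2, x^4 with the upside-down question mark
    on y, z, u. Duality makes it invariant, and its middle term represents the
    product of the squares. *)
Definition bott := x * prod3_2 + x ^+ 2 * prod3_1 + x ^+ 2 ^+ 2 * prod3_0.

Lemma Sq1_bott : Sq 1 bott = 0.
Proof.
rewrite /bott !SqD !Sq1_sqrM Sq1M ax -/prod3_2.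
rewrite [Sq 1 prod3_2]Sq1_Sq1 [Sq 1 prod3_0]Sq1_Sq1 !mulr0 !addr0.
exact: mpoly_char2.
Qed.

Lemma Sq2_bott : Sq 2 bott = 0.
Proof.
rewrite /bott !SqD !Sq2_sqrM Sq2M ax bx Sq2_prod3_2 Sq1_sqr -/prod3_1.
rewrite [Sq 1 prod3_2]Sq1_Sq1 [Sq 2 prod3_1]Sq2_Sq2_Sq1 expr0n !mul0r !mulr0 !addr0 !add0r.
exact: mpoly_char2.
Qed.

Lemma bott_Q1 :
  bott = (x * (y * z * u)) ^+ 2 + Q1 (x * prod3_0 + x ^+ 2 * (y * z * u)).
Proof.
have Qx : Q1 x = x ^+ 2 ^+ 2 by rewrite Q1E bx ax Sq2_sqr ax Sq_0 add0r.
have Q0 : Q1 prod3_0 = prod3_2 by rewrite Q1E [Sq 1 prod3_0]Sq1_Sq1 Sq_0 addr0.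
have E (R : comNzRingType) (r v p0 p2 q : R) :
    r * p2 + r ^+ 2 * (v ^+ 2 + q) + r ^+ 2 ^+ 2 * p0 =
    (r * v) ^+ 2 + (r ^+ 2 ^+ 2 * p0 + r * p2 + r ^+ 2 * q) by ring.
by rewrite Q1D Q1_sqrM Q1M Qx Q0 /bott prod3_1E E.
Qed.

Lemma prod3_2_factor : prod3_2 =
  y * z * u * ((y + z) * (y + u) * (z + u)) * (y + z + u).
Proof.
rewrite prod3_2E Sq22_prod3.
have D := mpoly_char2 (((y * z * u) ^+ 2 * (y + z + u)) *+ 2).
by rewrite -[LHS]addr0 -[X in _ + X = _]D; apply: moore_det_factor.
Qed.
End Elements.
End Bott.

(** * Products over blocks of variables *)

Section Generators.
Variable n : nat.
Local Notation K := {mpoly 'F_2[n]}.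
Implicit Types p q x y : K.

(** The k-th variable, or 0 if there is none. Since 0 is as good as a linear form,
    identities between variables need no bound on k. *)
Definition var (k : nat) : K := if insub k is Some i then 'X_i else 0.

Lemma var_ord (i : 'I_n) : var i = 'X_i.
Proof. by rewrite /var valK. Qed.

Lemma var_lin k : linear_like (var k).
Proof.
rewrite /var /linear_like; case: insub => [i|]; first by rewrite Sq1X Sq2X.
by rewrite !Sq_0 expr0n.
Qed.

Lemma var_homog k : var k \is 1.-homog.
Proof.
rewrite /var; case: insub => [i|]; first by rewrite dhomogX /= mdeg1.
exact: dhomog0.
Qed.

Definition dvd k p := exists q, p = var k * q.

Lemma dvd_var k : dvd k (var k). Proof. by exists 1; rewrite mulr1. Qed.
Lemma dvdD k p q : dvd k p -> dvd k q -> dvd k (p + q).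
Proof. by move=> [p' ->] [q' ->]; exists (p' + q'); rewrite mulrDr. Qed.
Lemma dvdl k p q : dvd k p -> dvd k (p * q).
Proof. by move=> [p' ->]; exists (p' * q); rewrite mulrA. Qed.
Lemma dvdr k p q : dvd k q -> dvd k (p * q).
Proof. by rewrite mulrC; apply: dvdl. Qed.
Lemma dvdX k p e : dvd k p -> dvd k (p ^+ e.+1).
Proof. by rewrite exprS; apply: dvdl. Qed.
Lemma dvd_Sq1 k p : dvd k p -> dvd k (Sq 1 p).
Proof.
move=> [q ->]; rewrite Sq1M; have [-> _] := var_lin k.
by apply: dvdD; apply: dvdl; [apply: dvdX|]; apply: dvd_var.
Qed.
Lemma dvd_Sq2 k p : dvd k p -> dvd k (Sq 2 p).
Proof.
move=> [q ->]; rewrite Sq2M; have [-> ->] := var_lin k; rewrite mul0r add0r.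
by apply: dvdD; apply: dvdl; [apply: dvdX|]; apply: dvd_var.
Qed.
Lemma dvd_Q1 k p : dvd k p -> dvd k (Q1 p).
Proof.
by move=> dp; rewrite Q1E; apply: dvdD; [apply/dvd_Sq1/dvd_Sq2 | apply/dvd_Sq2/dvd_Sq1].
Qed.

Lemma dvd_positive p : (forall k, (k < n)%N -> dvd k p) -> p \in positive n.
Proof.
move=> dp; apply: positive_dvd => i; have [q ->] := dp i (ltn_ord i).
by exists q; rewrite var_ord.
Qed.

Definition sqr_prod lo hi : K := \prod_(lo <= i < hi) var i ^+ 2.

Lemma sqr_prodE lo hi : sqr_prod lo hi = (\prod_(lo <= i < hi) var i) ^+ 2.
Proof. by rewrite /sqr_prod prodrXl. Qed.

Lemma Q1_sqr_prod lo hi : Q1 (sqr_prod lo hi) = 0.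
Proof. by rewrite sqr_prodE Q1_sqr. Qed.

Lemma dvd_sqr_prod lo hi k : (lo <= k < hi)%N -> dvd k (sqr_prod lo hi).
Proof.
move=> /andP[lo_k k_hi]; rewrite /sqr_prod (big_cat_nat _ (n := k)) //=; last exact: ltnW.
by apply: dvdr; rewrite big_ltn //; apply/dvdl/dvdX/dvd_var.
Qed.

(** The element x represents the product of the squares of the variables with index
    from lo to hi - 1; the correction term involves all of these variables. *)
Definition sqr_rep lo hi (x : K) :=
  exists2 kappa, forall k, (lo <= k < hi)%N -> dvd k kappa & x = sqr_prod lo hi + Q1 kappa.

(** The Kunneth formula, for disjoint blocks of variables. *)
Lemma sqr_repM lo mid hi x y : (lo <= mid <= hi)%N ->
  sqr_rep lo mid x -> sqr_rep mid hi y -> sqr_rep lo hi (x * y).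
Proof.
move=> /andP[lo_mid mid_hi] [r dr ->] [s ds ->].
exists (r * sqr_prod mid hi + sqr_prod lo mid * s + r * Q1 s) => [k /andP[lo_k k_hi]|].
  case: (ltnP k mid) => [k_mid|mid_k].
    have rk : dvd k r by apply: dr; rewrite lo_k.
    have ck : dvd k (sqr_prod lo mid) by apply: dvd_sqr_prod; rewrite lo_k.
    by do 2?apply: dvdD; apply: dvdl.
  have sk : dvd k s by apply: ds; rewrite mid_k.
  have ck : dvd k (sqr_prod mid hi) by apply: dvd_sqr_prod; rewrite mid_k.
  by do 2?apply: dvdD; apply: dvdr => //; apply: dvd_Q1.
rewrite !Q1D !Q1M !Q1_sqr_prod Q1_Q1 !mulr0 !mul0r !addr0 add0r.
have -> : sqr_prod lo hi = sqr_prod lo mid * sqr_prod mid hi.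
  by rewrite /sqr_prod (big_cat_nat _ (n := mid)).
by rewrite mulrDl !mulrDr -!addrA; congr (_ + _); rewrite addrCA.
Qed.

Lemma sqr_rep1 k : sqr_rep k k 1.
Proof.
exists 0 => [l /andP[kl lk]|]; first by rewrite leqNgt lk in kl.
by rewrite Q1_0 addr0 /sqr_prod big_geq.
Qed.

Lemma sqr_rep_full x : sqr_rep 0 n x ->
  exists2 kappa, kappa \in positive n & x = sqr_class n + Q1 kappa.
Proof.
move=> [r dr ->]; exists r; first exact: dvd_positive.
congr (_ + _); rewrite /sqr_prod /sqr_class big_mkord.
by apply: eq_bigr => i _; rewrite var_ord.
Qed.

Definition bott_at k := bott (var k) (var k.+1) (var k.+2) (var k.+3).
Definition moore_at k := prod3_0 (var k) (var k.+1) (var k.+2).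

Lemma dvd_prod3 k l : (k <= l < k.+3)%N -> dvd l (var k * var k.+1 * var k.+2).
Proof.
move=> kl; have : [\/ l = k, l = k.+1 | l = k.+2].
  case: (ltngtP l k.+1) => [lk|kl'|->]; [constructor 1 | constructor 3 | by constructor 2];
  by lia.
by case=> ->; [do 2!apply: dvdl|apply: dvdl; apply: dvdr|apply: dvdr]; apply: dvd_var.
Qed.

Lemma sqr_rep_moore k : sqr_rep k k.+3 (Sq 2 (moore_at k)).
Proof.
exists (var k * var k.+1 * var k.+2) => [l|]; first exact: dvd_prod3.
rewrite -/(prod3_1 _ _ _) prod3_1E; try exact: var_lin; congr (_ + _).
by rewrite /sqr_prod !big_nat_recr ?big_geq //= ?mul1r ?exprMn //; lia.
Qed.

Lemma dvd_bott_part k l : (k <= l < k.+4)%N ->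
  dvd l (var k * prod3_0 (var k.+1) (var k.+2) (var k.+3) +
         var k ^+ 2 * (var k.+1 * var k.+2 * var k.+3)).
Proof.
case: (eqVneq l k) => [-> _|ne_lk kl].
  by apply: dvdD; apply: dvdl; [|apply: dvdX]; apply: dvd_var.
have dl : dvd l (var k.+1 * var k.+2 * var k.+3) by apply: dvd_prod3; lia.
by apply: dvdD; apply: dvdr => //; apply: dvd_Sq1.
Qed.

Lemma sqr_rep_bott k : sqr_rep k k.+4 (bott_at k).
Proof.
exists (var k * prod3_0 (var k.+1) (var k.+2) (var k.+3) +
         var k ^+ 2 * (var k.+1 * var k.+2 * var k.+3)) => [l|]; first exact: dvd_bott_part.
rewrite /bott_at bott_Q1; try exact: var_lin; congr (_ + _).
rewrite /sqr_prod !big_nat_recr ?big_geq //= ?mul1r; try lia.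
have E (R : comNzRingType) (r s t v : R) :
    (r * (s * t * v)) ^+ 2 = r ^+ 2 * s ^+ 2 * t ^+ 2 * v ^+ 2 by ring.
exact: E.
Qed.

Lemma dvd_bott k l : (k <= l < k.+4)%N -> dvd l (bott_at k).
Proof.
rewrite /bott_at /bott => kl; case: (eqVneq l k) => [->|ne_lk].
  by do 2?apply: dvdD; apply: dvdl; do ?apply: dvdX; apply: dvd_var.
have dl : dvd l (prod3_0 (var k.+1) (var k.+2) (var k.+3)).
  by apply: dvd_Sq1; apply: dvd_prod3; lia.
by do 2?apply: dvdD; apply: dvdr => //; [apply: dvd_Sq1|]; apply: dvd_Sq2.
Qed.

(** The product of the Bott elements of m consecutive blocks of four variables. *)
Fixpoint bott_pow m : K := if m is m'.+1 then bott_pow m' * bott_at (4 * m') else 1.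

Lemma Sq1_bott_pow m : Sq 1 (bott_pow m) = 0.
Proof.
elim: m => [|m IH] /=; first exact: SqS_1.
by rewrite Sq1M IH mul0r add0r Sq1_bott ?mulr0 //; apply: var_lin.
Qed.

Lemma Sq2_bott_pow m : Sq 2 (bott_pow m) = 0.
Proof.
elim: m => [|m IH] /=; first exact: SqS_1.
by rewrite Sq2M IH Sq1_bott_pow !mul0r !add0r Sq2_bott ?mulr0 //; apply: var_lin.
Qed.

Lemma Sq1_bott_powM m x : Sq 1 (bott_pow m * x) = bott_pow m * Sq 1 x.
Proof. by rewrite Sq1M Sq1_bott_pow mul0r add0r. Qed.

Lemma Sq2_bott_powM m x : Sq 2 (bott_pow m * x) = bott_pow m * Sq 2 x.
Proof. by rewrite Sq2M Sq1_bott_pow Sq2_bott_pow !mul0r !add0r. Qed.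

Lemma dvd_bott_pow m k : (k < 4 * m)%N -> dvd k (bott_pow m).
Proof.
elim: m => [|m IH] /=; first by rewrite muln0.
rewrite mulnS => km; case: (ltnP k (4 * m)) => [/IH dk|mk]; first exact: dvdl.
by apply: dvdr; apply: dvd_bott; rewrite mk.
Qed.

Lemma sqr_rep_bott_pow m : sqr_rep 0 (4 * m) (bott_pow m).
Proof.
elim: m => [|m IH] /=; first exact: sqr_rep1.
rewrite mulnS; apply: sqr_repM IH (sqr_rep_bott (4 * m)).
by lia.
Qed.

Lemma homog_prod3 k : var k * var k.+1 * var k.+2 \is 3.-homog.
Proof. exact: (dhomogM (dhomogM (var_homog _) (var_homog _)) (var_homog _)). Qed.

Lemma homog_bott_pow m : bott_pow m \is (8 * m).-homog.
Proof.
elim: m => [|m IH] /=; first exact: dhomog1.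
rewrite mulnS addnC; apply: dhomogM => //; rewrite /bott_at /bott.
have H0 : prod3_0 (var (4 * m).+1) (var (4 * m).+2) (var (4 * m).+3) \is 4.-homog.
  exact: (dhomog_Sq 1 (homog_prod3 _)).
have H1 := dhomog_Sq 2 H0; have H2 := dhomog_Sq 1 H1.
have Ht e : var (4 * m) ^+ e \is e.-homog.
  by have := dhomogMn e (var_homog (4 * m)); rewrite mul1n.
apply: dhomogD; first apply: dhomogD.
- exact: (dhomogM (var_homog _) H2).
- exact: (dhomogM (Ht 2%N) H1).
by rewrite -exprM; apply: (dhomogM (Ht 4%N) H0).
Qed.
End Generators.

(** * Hit elements *)

(** The elements of A(1)^+ V_n. *)
Definition hit n (x : {mpoly 'F_2[n]}) :=
  exists p q, [/\ p \in positive n, q \in positive n & x = Sq 1 p + Sq 2 q].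

Lemma hitD n (x y : {mpoly 'F_2[n]}) : hit x -> hit y -> hit (x + y).
Proof.
move=> [p [q [Pp Pq ->]]] [p' [q' [Pp' Pq' ->]]]; exists (p + p'), (q + q').
by rewrite !SqD addrACA; split=> //; apply: rpredD.
Qed.

Lemma hit0 n : hit (0 : {mpoly 'F_2[n]}).
Proof. by exists 0, 0; rewrite !Sq_0 addr0; split=> //; apply: rpred0. Qed.

Lemma ker_sq1_hit n (x : {mpoly 'F_2[n.+1]}) :
  x \in positive n.+1 -> Sq 1 x = 0 -> hit x.
Proof.
move=> Px ax; have [x0 _] := positive_cfP _ Px.
exists (shift_odd 1 x), 0; split; [exact: positive_shift_odd | exact: rpred0 |].
rewrite Sq_0 addr0 -[LHS](sq1_homotopy x0) ax; rewrite [X in _ + X](_ : _ = 0) ?addr0 //.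
by apply: cf_inj => j; rewrite cf_shift_odd !cf0 if_same.
Qed.

Lemma ext_hit n (s : seq {mpoly 'F_2[n]}) c p q : q1_model s c ->
  p \in ext s -> q \in ext s -> hit (Sq 1 p + Sq 2 q).
Proof. by move=> M Ep Eq; exists p, q; split=> //; apply: (ext_positive M). Qed.

Lemma solved_hit n (s : seq {mpoly 'F_2[n]}) c : q1_model s c ->
    (forall x, x \in ext s -> Sq 1 (Sq 2 x) = 0 ->
      exists p q, [/\ p \in ext s, q \in ext s & x = Sq 1 p + Sq 2 q]) ->
  forall x, x \in positive n.+1 -> Sq 1 (Sq 2 x) = 0 -> hit x.
Proof.
move=> M solve x Px Kx; have [y Py Ey] := model_ker_sq3 M Px Kx.
have [|p [q [Ep Eq Dx]]] := solve _ Ey; first by rewrite !SqD Kx Sq1_Sq2_Sq2 addr0.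
rewrite -[x]addr0 -(mpoly_char2 (Sq 2 y)) addrA Dx.
apply: hitD; first exact: ext_hit M Ep Eq.
by exists 0, y; rewrite Sq_0 add0r; split=> //; apply: rpred0.
Qed.

(** The class xi (x) t cannot be hit: in E (x) V_1 its coefficient xi would be a sum of
    values of Sq^1 and Sq^2 in E, as t is neither in the image of Sq^1 nor in
    that of Sq^2, but these values lie in the span of the other generators. *)
Lemma solved_class n xi (s' : seq {mpoly 'F_2[n]}) c d (s := xi :: s') : q1_model s c ->
    (forall x, x \in ext s -> Sq 1 (Sq 2 x) = 0 ->
      exists p q (e : 'F_2), [/\ p \in ext s, q \in ext s &
        x = Sq 1 p + Sq 2 q + e *: tens xi 'X]) ->
    homogeneous d xi -> Sq 2 xi = 0 ->
    (forall k, k \in s -> Sq 1 k \in span_pred s') ->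
    (forall k, k \in s -> Sq 2 k \in span_pred s') -> xi \notin span_pred s' ->
  exists u, [/\ u \in positive n.+1, homogeneous d.+1 u, Sq 1 (Sq 2 u) = 0, ~ hit u &
    forall x, x \in positive n.+1 -> Sq 1 (Sq 2 x) = 0 -> exists e : 'F_2, hit (x + e *: u)].
Proof.
move=> M solve xi_hom b_xi a_s b_s nxi.
have Eu : tens xi 'X \in ext s.
  by apply: tens_ext; rewrite ?coefX // mem_span ?mem_head.
have bX : sq2_poly 'X = 0 by rewrite -['X]scale1r sq2_polyX.
exists (tens xi 'X); split.
- exact: ext_positive M _ Eu.
- exact: homogeneous_tens_X.
- by rewrite Sq12_tens b_xi bX sq1_poly0 Sq_0 !tens0l !tens0r !addr0.
- move=> [p [q [Pp Pq Du]]].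
  have [p' [q' [/extensionP[_ Ep] /extensionP[_ Eq] {}Du]]] := model_hit M Eu Pp Pq Du.
  case/negP: nxi; have := congr1 (cf 1) Du.
  rewrite cf_tens coefX scale1r cfD cf_Sq1 cf_Sq2 /= !mulr0n !addr0 => ->.
  apply: spanD.
    apply: (span_sub (P := fun k => Sq 1 k \in span_pred s')) (Ep 1%N) => //.
      by rewrite Sq_0 span0.
    by move=> k l Sk Sl; rewrite SqD spanD.
  apply: (span_sub (P := fun k => Sq 2 k \in span_pred s')) (Eq 1%N) => //.
    by rewrite Sq_0 span0.
  by move=> k l Sk Sl; rewrite SqD spanD.
move=> x Px Kx; have [y Py Ey] := model_ker_sq3 M Px Kx.
have [|p [q [e [Ep Eq Dx]]]] := solve _ Ey; first by rewrite !SqD Kx Sq1_Sq2_Sq2 addr0.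
exists e; rewrite -[x]addr0 -(mpoly_char2 (Sq 2 y)) addrA Dx.
rewrite addrAC (addr_pairK (@mpoly_char2 n.+1)).
apply: hitD; first exact: ext_hit M Ep Eq.
by exists 0, y; rewrite Sq_0 add0r; split=> //; apply: rpred0.
Qed.

Lemma sqr_rep_neq0 n (x : {mpoly 'F_2[n]}) : sqr_rep 0 n x -> x != 0.
Proof.
case/sqr_rep_full => kap _ Dx; apply/eqP => x0.
have /eqP[] := sqr_class_not_q1 kap; rewrite -[LHS]add0r -x0 Dx -addrA.
by rewrite mpoly_char2 addr0.
Qed.

Lemma mcoeff_var n k (i : 'I_n) : (var n k)@_U_(i) = (k == i)%:R.
Proof.
rewrite /var; case: insubP => [l _ Dl|ge_k].
  rewrite mcoeffX -Dl; congr (_%:R).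
  congr nat_of_bool; apply/eqP/eqP => [E|/val_inj -> //].
  by have := congr1 (fun m : 'X_{1..n} => m i) E; rewrite !mnm1E eqxx; case: eqP => [->|].
by rewrite mcoeff0; case: eqP => // Dk; rewrite Dk ltn_ord in ge_k.
Qed.

Lemma var_neq0 n k : (k < n)%N -> var n k != 0.
Proof.
move=> lt_k; apply/eqP => /(congr1 (mcoeff U_(Ordinal lt_k))).
by rewrite mcoeff_var mcoeff0 eqxx => /eqP; rewrite oner_eq0.
Qed.

Lemma var_add_neq0 n k l : (k < n)%N -> k != l -> var n k + var n l != 0.
Proof.
move=> lt_k /negbTE ne_kl; apply/eqP => /(congr1 (mcoeff U_(Ordinal lt_k))).
rewrite mcoeffD !mcoeff_var mcoeff0 eqxx /= eq_sym ne_kl addr0 => /eqP.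
by rewrite oner_eq0.
Qed.

Lemma var_add3_neq0 n j k l : (j < n)%N -> j != k -> j != l ->
  var n j + var n k + var n l != 0.
Proof.
move=> lt_j /negbTE ne_jk /negbTE ne_jl.
apply/eqP => /(congr1 (mcoeff U_(Ordinal lt_j))).
rewrite !mcoeffD !mcoeff_var mcoeff0 eqxx /= ![_ == j]eq_sym ne_jk ne_jl !addr0 => /eqP.
by rewrite oner_eq0.
Qed.

Section Classes.
Variable m : nat.
Local Notation y n := (var n (4 * m)).
Local Notation z n := (var n (4 * m).+1).
Local Notation u n := (var n (4 * m).+2).

Lemma dvd_bott_powM n k x : dvd (n := n) k x \/ (k < 4 * m)%N -> dvd k (bott_pow n m * x).
Proof. by case=> [dx|km]; [apply: dvdr | apply: dvdl; apply: dvd_bott_pow]. Qed.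

(** E is spanned by the product of the Bott elements. *)
Lemma unhit_class_mod1 : exists u, [/\ u \in positive (4 * m).+1, homogeneous (8 * m).+1 u,
    Sq 1 (Sq 2 u) = 0, ~ hit u &
  forall x, x \in positive (4 * m).+1 -> Sq 1 (Sq 2 x) = 0 ->
    exists e : 'F_2, hit (x + e *: u)].
Proof.
set n := (4 * m)%N; pose xi := bott_pow n m.
have a_xi : Sq 1 xi = 0 := Sq1_bott_pow n m; have b_xi : Sq 2 xi = 0 := Sq2_bott_pow n m.
have rep_xi : sqr_rep 0 n xi := sqr_rep_bott_pow n m.
have P_xi : xi \in positive n by apply: dvd_positive => k; apply: dvd_bott_pow.
have H_xi : homogeneous (8 * m) xi := dhomog_hom (homog_bott_pow n m).
have M := invariant_model P_xi H_xi a_xi b_xi (sqr_rep_full rep_xi).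
apply: (solved_class M) => //.
- exact: (invariant_ker_sq3 P_xi H_xi a_xi b_xi (sqr_rep_full rep_xi)).
- by move=> k; rewrite inE => /eqP ->; rewrite a_xi span0.
- by move=> k; rewrite inE => /eqP ->; rewrite b_xi span0.
by rewrite span_nil; apply: sqr_rep_neq0.
Qed.

(** E is the question mark generated by one more variable. *)
Lemma unhit_class_mod2 : exists u, [/\ u \in positive (4 * m).+2, homogeneous (8 * m).+2 u,
    Sq 1 (Sq 2 u) = 0, ~ hit u &
  forall x, x \in positive (4 * m).+2 -> Sq 1 (Sq 2 x) = 0 ->
    exists e : 'F_2, hit (x + e *: u)].
Proof.
set n := (4 * m).+1; pose xi := bott_pow n m * y n.
have [ay b_y] := var_lin n (4 * m).
have b_xi : Sq 2 xi = 0 by rewrite Sq2_bott_powM b_y mulr0.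
have Dxi1 : Sq 1 xi = bott_pow n m * y n ^+ 2 by rewrite Sq1_bott_powM ay.
have rep_xi : sqr_rep 0 n (Sq 1 xi).
  rewrite Dxi1; apply: sqr_repM (sqr_rep_bott_pow n m) _; first by rewrite /n; lia.
  exists 0 => [k _|]; first by exists 0; rewrite mulr0.
  by rewrite Q1_0 addr0 /sqr_prod big_nat1.
have P_xi : xi \in positive n.
  apply: dvd_positive => k lt_k; apply: dvd_bott_powM.
  case: (ltngtP k (4 * m)) => [lt|gt|->]; [by right | by move: lt_k gt; rewrite /n; lia |].
  by left; apply: dvd_var.
have H_xi : homogeneous (8 * m).+1 xi.
  by apply: dhomog_hom; have := dhomogM (homog_bott_pow n m) (var_homog n (4 * m)); rewrite addn1.
have om_nz : bott_pow n m != 0.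
  by apply: contraNneq (sqr_rep_neq0 rep_xi) => om0; rewrite Dxi1 om0 mul0r.
have y_nz : y n != 0.
  by apply: contraNneq (sqr_rep_neq0 rep_xi) => y0; rewrite Dxi1 y0 expr0n mulr0.
have top_nz : Sq 2 (Sq 1 xi) != 0.
  by rewrite Dxi1 Sq2_bott_powM Sq2_sqr ay mulf_neq0 // !expf_neq0.
have M := question_mark_model P_xi H_xi b_xi top_nz (sqr_rep_full rep_xi).
have b_xi2 : Sq 2 (Sq 2 (Sq 1 xi)) = 0 := Sq2_Sq2_Sq1 xi.
have a_xi2 : Sq 1 (Sq 2 (Sq 1 xi)) = 0 by rewrite -Sq2_Sq2 b_xi Sq_0.
apply: (solved_class M) => //.
- exact: (question_mark_ker_sq3 b_xi top_nz).
- move=> k; rewrite !in_cons in_nil orbF => /or3P[] /eqP ->; rewrite ?Sq1_Sq1 ?a_xi2 ?span0 //.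
  by rewrite mem_span // mem_head.
- move=> k; rewrite !in_cons in_nil orbF => /or3P[] /eqP ->; rewrite ?b_xi ?b_xi2 ?span0 //.
  by rewrite mem_span // !inE eqxx orbT.
apply: (notin_span (phi := @Q1 n)); [exact: Q1D | exact: Q1_0 | |].
  by rewrite Q1E b_xi Sq_0 add0r.
by rewrite /= !Q1E Sq1_Sq1 a_xi2 b_xi2 !Sq_0 addr0 eqxx.
Qed.

(** E is the joker generated by the product of two more variables. *)
Lemma ker_sq3_hit_mod3 x : x \in positive (4 * m).+3 -> Sq 1 (Sq 2 x) = 0 -> hit x.
Proof.
set n := (4 * m).+2; pose xi := bott_pow n m * (y n * z n).
have Ly := var_lin n (4 * m); have Lz := var_lin n (4 * m).+1.
have ab_xi : Sq 1 (Sq 2 xi) = 0.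
  by rewrite Sq2_bott_powM Sq1_bott_powM Sq12_prod2 ?mulr0.
have Dxi2 : Sq 2 xi = bott_pow n m * (y n ^+ 2 * z n ^+ 2).
  by rewrite Sq2_bott_powM Sq2_prod2.
have rep_xi : sqr_rep 0 n (Sq 2 xi).
  rewrite Dxi2; apply: sqr_repM (sqr_rep_bott_pow n m) _; first by rewrite /n; lia.
  exists 0 => [k _|]; first by exists 0; rewrite mulr0.
  by rewrite Q1_0 addr0 /sqr_prod !big_nat_recr ?big_geq //= mul1r.
have P_xi : xi \in positive n.
  apply: dvd_positive => k lt_k; apply: dvd_bott_powM.
  case: (ltngtP k (4 * m)) => [lt|gt|->]; [by right | |].
    have -> : k = (4 * m).+1 by move: lt_k gt; rewrite /n; lia.
    by left; apply: dvdr; apply: dvd_var.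
  by left; apply: dvdl; apply: dvd_var.
have H_xi : homogeneous (8 * m + 2) xi.
  apply: dhomog_hom; apply: dhomogM (homog_bott_pow n m) _.
  exact: (dhomogM (var_homog n _) (var_homog n _)).
have nz := sqr_rep_neq0 rep_xi.
have om_nz : bott_pow n m != 0 by apply: contraNneq nz => om0; rewrite Dxi2 om0 mul0r.
have y_nz : y n != 0 by apply: var_neq0; rewrite /n; lia.
have z_nz : z n != 0 by apply: var_neq0; rewrite /n; lia.
have yz_nz : y n + z n != 0 by apply: var_add_neq0; rewrite /n; lia.
have top_nz : Sq 2 (Sq 2 xi) != 0.
  by rewrite 2!Sq2_bott_powM Sq22_prod2 // mulf_neq0 // expf_neq0 // !mulf_neq0.
have M := joker_model P_xi H_xi ab_xi top_nz (sqr_rep_full rep_xi).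
exact: (solved_hit M (joker_ker_sq3 ab_xi top_nz)).
Qed.

(** E is the upside-down question mark on three more variables; its top class is a
    Moore determinant, a product of nonzero linear forms. *)
Lemma ker_sq3_hit_mod0 x : x \in positive (4 * m).+4 -> Sq 1 (Sq 2 x) = 0 -> hit x.
Proof.
set n := (4 * m).+3; pose xi := bott_pow n m * moore_at n (4 * m).
have Ly := var_lin n (4 * m); have Lz := var_lin n (4 * m).+1; have Lu := var_lin n (4 * m).+2.
have a_xi : Sq 1 xi = 0 by rewrite Sq1_bott_powM [Sq 1 (moore_at _ _)]Sq1_Sq1 mulr0.
have Dxi1 : Sq 2 xi = bott_pow n m * Sq 2 (moore_at n (4 * m)) by rewrite Sq2_bott_powM.
have Dxi2 : Sq 1 (Sq 2 xi) = bott_pow n m * prod3_2 (y n) (z n) (u n).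
  by rewrite Dxi1 Sq1_bott_powM.
have bab_xi : Sq 2 (Sq 1 (Sq 2 xi)) = 0 by rewrite Dxi2 Sq2_bott_powM Sq2_prod3_2 ?mulr0.
have rep_xi : sqr_rep 0 n (Sq 2 xi).
  rewrite Dxi1; apply: sqr_repM (sqr_rep_bott_pow n m) (sqr_rep_moore n (4 * m)).
  by lia.
have P_xi : xi \in positive n.
  apply: dvd_positive => k lt_k; apply: dvd_bott_powM.
  case: (ltnP k (4 * m)) => [lt|ge]; [by right | left].
  by apply: dvd_Sq1; apply: dvd_prod3; rewrite ge.
have H_xi : homogeneous (8 * m + 4) xi.
  apply: dhomog_hom; apply: dhomogM (homog_bott_pow n m) _.
  exact: (dhomog_Sq 1 (homog_prod3 n _)).
have nz := sqr_rep_neq0 rep_xi.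
have om_nz : bott_pow n m != 0 by apply: contraNneq nz => om0; rewrite Dxi1 om0 mul0r.
have top_nz : Sq 1 (Sq 2 xi) != 0.
  rewrite Dxi2 prod3_2_factor // !mulf_neq0 //;
    by [apply: var_neq0; rewrite /n; lia | apply: var_add_neq0; rewrite /n; lia
       | apply: var_add3_neq0; rewrite /n; lia].
have M := dual_question_mark_model P_xi H_xi a_xi bab_xi top_nz (sqr_rep_full rep_xi).
exact: (solved_hit M (dual_question_mark_ker_sq3 a_xi bab_xi top_nz)).
Qed.
End Classes.

(** * Graded pieces *)

Lemma tensor_homogE n d (p : {mpoly 'F_2[n]}) :
  p \in @tensor_homog n d <-> p \in positive n /\ homogeneous d p.
Proof.
split=> [/tensor_homogP Hp | [/positiveP Pp Hp]].
  split.
    by apply/positiveP => m /Hp /andP[_ /forallP].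
  move=> e; apply/mpolyP => m; rewrite mcoeff_trunc.
  have [pm0|/Hp /andP[/eqP -> _]] := eqVneq p@_m 0.
    by do 2?case: ifP => _; rewrite ?mcoeff0 ?pm0.
  by case: ifP; rewrite ?mcoeff0.
apply/tensor_homogP => m nz; rewrite /tensor_mon.
apply/andP; split; last by apply/forallP; apply: Pp.
have := congr1 (mcoeff m) (Hp d.+1); have := congr1 (mcoeff m) (Hp d).
rewrite !mcoeff_trunc ltnSn ltnn mcoeff0 => H1 H2; rewrite eqn_leq; apply/andP; split.
  by rewrite -ltnS; apply: contraNT nz => /negbTE ge_d; rewrite -H2 ge_d.
by rewrite leqNgt; apply: contraNN nz => lt_d; rewrite -H1 lt_d.
Qed.

(** The sign is immaterial in characteristic 2. *)
Definition homog_part n d (p : {mpoly 'F_2[n]}) := trunc d.+1 p + trunc d p.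

Lemma mcoeff_homog_part n d (p : {mpoly 'F_2[n]}) m :
  (homog_part d p)@_m = if mdeg m == d then p@_m else 0.
Proof.
rewrite mcoeffD !mcoeff_trunc ltnS; case: ltngtP => _; rewrite ?addr0 //.
by case: (F2_cases p@_m) => ->; apply: val_inj.
Qed.

Lemma homog_part_tensor n d p : p \in positive n -> homog_part d p \in @tensor_homog n d.
Proof.
move=> /positiveP Pp; apply/tensor_homogP => m; rewrite mcoeff_homog_part /tensor_mon.
have [_|] := eqVneq (mdeg m) d; last by rewrite eqxx.
by move=> nz; apply/forallP; apply: Pp nz.
Qed.

Lemma homog_partD n d (p q : {mpoly 'F_2[n]}) : homog_part d (p + q) = homog_part d p + homog_part d q.
Proof. by rewrite /homog_part !linearD addrACA. Qed.

Lemma homog_part_hom n d e (p : {mpoly 'F_2[n]}) : homogeneous d p -> homog_part e p = if e == d then p else 0.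
Proof.
move=> Hp; rewrite /homog_part !Hp ltnS.
by case: ltngtP; rewrite ?addr0 ?add0r ?mpoly_char2.
Qed.

Lemma homog_part_Sq n d j (p : {mpoly 'F_2[n]}) :
  homog_part d (Sq j p) = if (j <= d)%N then Sq j (homog_part (d - j) p) else 0.
Proof.
rewrite /homog_part !trunc_Sq; case: leqP => [le_jd|lt_dj].
  by rewrite subSn // SqD.
have [-> ->] : (d.+1 - j = 0 /\ d - j = 0)%N by lia.
by rewrite trunc0 Sq_0 addr0.
Qed.

(** Hit elements form a graded subspace because Sq^1 and Sq^2 are homogeneous. *)
Lemma homog_part_hit n d (x : {mpoly 'F_2[n]}) : hit x -> hit (homog_part d x).
Proof.
have Pc e p : p \in positive n -> homog_part e p \in positive n.
  by move=> Pp; rewrite rpredD ?positive_trunc.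
move=> [p [q [Pp Pq ->]]]; rewrite homog_partD !homog_part_Sq; apply: hitD; case: ifP => _; try exact: hit0.
  by exists (homog_part (d - 1) p), 0; rewrite Sq_0 addr0 Pc ?rpred0.
by exists 0, (homog_part (d - 2) q); rewrite Sq_0 add0r Pc ?rpred0.
Qed.

Lemma tensorP_positive n d (x : tensorP n d) : val x \in positive n.
Proof. by case/tensor_homogE: (valP x). Qed.

Lemma tensorP_hom n d (x : tensorP n d) : homogeneous d (val x).
Proof. by case/tensor_homogE: (valP x). Qed.

Section Bidegree.
Variables n d : nat.
Implicit Types x y : tensorP n d.

Lemma mem_IsubP x : reflect (hit (val x)) (x \in Isub 1 n d).
Proof.
apply: (iffP idP) => [/memv_sumP[v Iv ->] | [p [q [Pp Pq Dx]]]].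
  rewrite raddf_sum; elim/big_ind: _ => [|y z|i le_i]; [exact: hit0 | exact: hitD |].
  have [p Pp Dp] : exists2 p, p \in positive n & val (v i) = Sq (2 ^ i) p.
    have /memv_imgP[w _ ->] := Iv i le_i.
    by exists (val w); [apply: tensorP_positive | rewrite sq_homE ?subnK // SqE].
  rewrite [X in hit X]Dp; case: (nat_of_ord i) (ltn_ord i) => [|[|//]] _ {Dp le_i}.
    by exists p, 0; rewrite Sq_0 addr0 rpred0.
  by exists 0, p; rewrite Sq_0 add0r rpred0.
pose X : tensorP n (d - 1) := TensorP (homog_part_tensor (d - 1) Pp).
pose Y : tensorP n (d - 2) := TensorP (homog_part_tensor (d - 2) Pq).
have -> : x = (if (1 <= d)%N then sq_hom n 1 (d - 1) d X else 0) +
    (if (2 <= d)%N then sq_hom n 2 (d - 2) d Y else 0).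
  apply: val_inj; rewrite raddfD /=.
  have := homog_part_hom d (tensorP_hom x); rewrite eqxx {1}Dx homog_partD !homog_part_Sq => <-.
  by congr (_ + _); case: ifP => // le_d; rewrite sq_homE ?subnK // SqE.
by apply: rpredD; case: ifP => [le_d|_]; rewrite ?mem0v //;
  [apply: (subvP (sumv_sup (ord0 : 'I_2) le_d (subvv _)))
  | apply: (subvP (sumv_sup (ord_max : 'I_2) le_d (subvv _)))]; apply: memv_img; apply: memvf.
Qed.

Lemma Dsub_ker x : x \in Dsub 1 n d ->
  exists y z, [/\ x = y + z, Sq 1 (val y) = 0 & Sq 1 (Sq 2 (val z)) = 0].
Proof.
rewrite /Dsub !big_ord_recl big_ord0 addv0 => /memv_addP[y Ky [z Kz ->]].
exists y, z; split=> //.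
  move: Ky; rewrite memv_ker => /eqP /(congr1 val); rewrite sq_homE //= -SqE //.
move: Kz; rewrite memv_ker => /eqP /(congr1 val); rewrite sq_homE //= -SqE Sq3_Sq1_Sq2 //.
Qed.

Lemma ker_Dsub x : Sq 1 (Sq 2 (val x)) = 0 -> x \in Dsub 1 n d.
Proof.
move=> Kx; apply: (subvP (sumv_sup (ord_max : 'I_2) isT (subvv _))).
rewrite memv_ker; apply/eqP/val_inj; rewrite sq_homE // -SqE.
exact: etrans (Sq3_Sq1_Sq2 _) Kx.
Qed.
End Bidegree.

(** * The quotient U *)

Section Quotv.
Variables (K : fieldType) (vT : vectType K) (D I : {vspace vT}).

Lemma quotv_eq0 : (D <= I)%VS -> forall q : quotv D I, q = 0.
Proof.
move=> /subvP sDI q; rewrite -(quotv_reprK q); apply/eqP.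
by rewrite quotv_pi_eq0; apply/sDI/subvsP.
Qed.

Lemma quotv_dim0 : (D <= I)%VS -> \dim {: quotv D I} = 0%N.
Proof. by move/capv_idPl => DI; rewrite dim_quotv DI subnn. Qed.

Variable u : vT.
Hypotheses (Du : u \in D) (nIu : u \notin I).
Hypothesis gen_u : forall x, x \in D -> exists c : K, x + c *: u \in I.

Let q0 : quotv D I := quotv_pi I (Subvs Du).

Let q0_neq0 : q0 != 0. Proof. by rewrite quotv_pi_eq0. Qed.

Let gen_q q : exists c, q = c *: q0.
Proof.
rewrite -(quotv_reprK q); set x := repr _.
have [c Ic] := gen_u (subvsP x); exists (- c); apply/eqP.
rewrite -subr_eq0 scaleNr opprK.
suff -> : quotv_pi I x + c *: q0 = quotv_pi I (x + c *: Subvs Du).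
  by rewrite quotv_pi_eq0.
by rewrite linearD linearZ.
Qed.

Lemma quotv_dim1 : \dim {: quotv D I} = 1%N.
Proof.
have -> : fullv = <[q0]>%VS; last by rewrite dim_vline q0_neq0.
apply/vspaceP => q; rewrite memvf; apply/esym/vlineP.
exact: gen_q.
Qed.

Lemma quotv_line : exists f : {linear quotv D I -> K^o}, bijective f.
Proof.
exists (coord [tuple q0] ord0 : {linear quotv D I -> K^o}).
have f1 : coord [tuple q0] ord0 q0 = 1.
  have fr : free [tuple q0] by rewrite /= seq1_free q0_neq0.
  by have := coord_free ord0 ord0 fr; rewrite eqxx.
exists (fun c : K => c *: q0) => [q|c].
  by have [c ->] := gen_q q; rewrite linearZ /= f1 [_ *: 1]mulr1.
by rewrite linearZ /= f1 [_ *: 1]mulr1.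
Qed.
End Quotv.

(** Only ker Sq^3 matters, since the kernel of Sq^1 on V_n is its image. The
    predicate P describes the representatives of the classes. *)
Lemma Dsub_hit n d (x : tensorP n.+1 d) (P : {mpoly 'F_2[n.+1]} -> Prop) :
    (forall y, y \in positive n.+1 -> Sq 1 (Sq 2 y) = 0 -> exists2 z, P z & hit (y + z)) ->
  x \in Dsub 1 n.+1 d -> exists2 z, P z & hit (val x + z).
Proof.
move=> H /Dsub_ker[y [z [-> Ky Kz]]].
have [t Pt Ht] := H _ (tensorP_positive z) Kz; exists t => //.
rewrite raddfD -addrA; apply: hitD => //.
exact: ker_sq1_hit (tensorP_positive y) Ky.
Qed.

Lemma Dsub_sub_Isub n d :
    (forall y, y \in positive n.+1 -> Sq 1 (Sq 2 y) = 0 -> hit y) ->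
  (Dsub 1 n.+1 d <= Isub 1 n.+1 d)%VS.
Proof.
move=> H; apply/subvP => x Dx; apply/mem_IsubP.
have [|z -> ] := @Dsub_hit n d x (fun z => z = 0) _ Dx; last by rewrite addr0.
by move=> y Py Ky; exists 0; rewrite // addr0; apply: H.
Qed.

(** U(V_(n+1)) is a line, spanned by the class of an element of degree e. *)
Definition class_at n e := exists u : {mpoly 'F_2[n.+1]}, [/\ u \in positive n.+1, homogeneous e u,
    Sq 1 (Sq 2 u) = 0, ~ hit u &
  forall x, x \in positive n.+1 -> Sq 1 (Sq 2 x) = 0 ->
    exists c : 'F_2, hit (x + c *: u)].

Lemma Dsub_sub_Isub_off_class n e d : class_at n e -> d != e ->
  (Dsub 1 n.+1 d <= Isub 1 n.+1 d)%VS.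
Proof.
move=> [u [Pu Hu _ _ gen]] ne_de; apply/subvP => x Dx; apply/mem_IsubP.
have [|z [c ->] ] := @Dsub_hit n d x (fun z => exists c : 'F_2, z = c *: u) _ Dx.
  by move=> y Py Ky; have [c Hc] := gen y Py Ky; exists (c *: u) => //; exists c.
move/(homog_part_hit d); rewrite homog_partD (homog_part_hom _ (tensorP_hom x)) eqxx.
have -> : homog_part d (c *: u) = 0; last by rewrite addr0.
case: (F2_cases c) => ->; last by rewrite scale1r (homog_part_hom _ Hu) (negbTE ne_de).
by rewrite scale0r /homog_part !linear0 addr0.
Qed.

Lemma Dsub_class n e : class_at n e -> exists u : tensorP n.+1 e,
  [/\ u \in Dsub 1 n.+1 e, u \notin Isub 1 n.+1 e &
    forall x, x \in Dsub 1 n.+1 e -> exists c : 'F_2, x + c *: u \in Isub 1 n.+1 e].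
Proof.
move=> [u [Pu Hu Ku nhit gen]].
have Tu : u \in @tensor_homog n.+1 e by apply/tensor_homogE.
exists (TensorP Tu); split.
- exact: ker_Dsub.
- by apply/mem_IsubP.
move=> x Dx.
have [|z [c ->] Hc] := @Dsub_hit n e x (fun z => exists c : 'F_2, z = c *: u) _ Dx.
  by move=> y Py Ky; have [c Hc] := gen y Py Ky; exists (c *: u) => //; exists c.
by exists c; apply/mem_IsubP; rewrite raddfD.
Qed.

Lemma class_at_mod1 m : class_at (4 * m) (8 * m).+1. Proof. exact: unhit_class_mod1. Qed.
Lemma class_at_mod2 m : class_at (4 * m).+1 (8 * m).+2. Proof. exact: unhit_class_mod2. Qed.

(** The bidegrees (4m + 1, 8m + 1) and (4m + 2, 8m + 2). *)
Definition class_degree (n d : nat) : bool :=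
  ((n %% 4 == 1) || (n %% 4 == 2))%N && (d == 2 * n - n %% 4)%N.

Lemma bidegree_cases n d : (0 < n)%N ->
  if class_degree n d then class_at n.-1 d else is_true (Dsub 1 n d <= Isub 1 n d)%VS.
Proof.
case: n => // n _; rewrite /class_degree.
pose m := (n %/ 4)%N.
have : [\/ n = 4 * m, n = (4 * m).+1, n = (4 * m).+2 | n = (4 * m).+3]%N.
  rewrite /m; have : (n %% 4 < 4)%N by rewrite ltn_mod.
  case: (n %% 4)%N (divn_eq n 4) => [|[|[|[|//]]]] E _;
    [constructor 1 | constructor 2 | constructor 3 | constructor 4]; lia.
case=> ->.
- have -> : ((4 * m).+1 %% 4 = 1)%N by lia.
  have -> : (2 * (4 * m).+1 - 1 = (8 * m).+1)%N by lia.
  have [->|ne] := eqVneq d (8 * m).+1; first exact: class_at_mod1.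
  exact: Dsub_sub_Isub_off_class (class_at_mod1 m) ne.
- have -> : ((4 * m).+2 %% 4 = 2)%N by lia.
  have -> : (2 * (4 * m).+2 - 2 = (8 * m).+2)%N by lia.
  have [->|ne] := eqVneq d (8 * m).+2; first exact: class_at_mod2.
  exact: Dsub_sub_Isub_off_class (class_at_mod2 m) ne.
- have -> : ((4 * m).+3 %% 4 = 3)%N by lia.
  exact: Dsub_sub_Isub (@ker_sq3_hit_mod3 m).
have -> : ((4 * m).+4 %% 4 = 0)%N by lia.
exact: Dsub_sub_Isub (@ker_sq3_hit_mod0 m).
Qed.

Lemma poincareUE n d :
  poincareU 1 n d = (((0 < n)%N && class_degree n d : nat))%:Z.
Proof.
rewrite /poincareU; case: (posnP n) => // n_gt0.
have := bidegree_cases d n_gt0; case: class_degree => /=.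
  case: n n_gt0 => // n _ /Dsub_class[u [Du nIu gen]].
  by rewrite (quotv_dim1 Du nIu gen).
by move/quotv_dim0 ->.
Qed.

(** * The Poincare series *)

Lemma class_degreeP n d : (0 < n)%N ->
  reflect (exists m r : nat, [/\ r \in [:: 1%N; 2%N], n = (4 * m + r)%N & d = (8 * m + r)%N])
    (class_degree n d).
Proof.
move=> n_gt0; apply: (iffP andP) => [[r12 /eqP ->]|[m [r [r12 -> ->]]]].
  exists (n %/ 4)%N, (n %% 4)%N; rewrite !inE r12; split=> //; first by lia.
  by have := divn_eq n 4; lia.
have r4 : ((4 * m + r) %% 4 = r)%N by move: r12; rewrite !inE => /orP[] /eqP ->; lia.
rewrite r4; split; first by move: r12; rewrite !inE.
by apply/eqP; lia.
Qed.

Lemma sum_ord_shift (F : nat -> int) n k :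
  \sum_(i < n.+1) F i * (n - i == k)%N%:R = if (k <= n)%N then F (n - k)%N else 0.
Proof.
case: leqP => [le_kn|lt_nk].
  have lt_k : (n - k < n.+1)%N by lia.
  rewrite (bigD1 (Ordinal lt_k)) //= big1 ?addr0 => [|i ne_i].
    by rewrite subKn // eqxx mulr1.
  case: eqP => [E|]; last by rewrite mulr0.
  by case/eqP: ne_i; apply: val_inj => /=; have := ltn_ord i; lia.
rewrite big1 // => i _; case: eqP => [E|]; last by rewrite mulr0.
by move: lt_nk; rewrite -E; lia.
Qed.

Lemma series2_mul_mon (f : series2) (g : series2) k l n d :
    (forall i j, g i j = (i == k)%:R * (j == l)%:R) ->
  series2_mul f g n d = if (k <= n)%N && (l <= d)%N then f (n - k)%N (d - l)%N else 0.
Proof.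
move=> Dg; rewrite /series2_mul.
transitivity (\sum_(i < n.+1) (if (l <= d)%N then f i (d - l)%N else 0) * (n - i == k)%N%:R).
  apply: eq_bigr => i _; rewrite -(sum_ord_shift (f i)) mulr_suml.
  by apply: eq_bigr => j _; rewrite Dg mulrA mulrAC.
rewrite (sum_ord_shift (fun i => if (l <= d)%N then f i (d - l)%N else 0)).
by case: (k <= n)%N; case: (l <= d)%N.
Qed.

Lemma coef_monomial k l n d :
  (('X ^+ k * 'X%:P ^+ l : {poly {poly int}})`_n)`_d = (n == k)%:R * (d == l)%:R.
Proof.
rewrite mulrC -rmorphXn /= mul_polyC coefZ coefXn.
by case: eqP => _; rewrite ?mulr1 ?mulr0 ?mul1r ?mul0r ?coefXn ?coef0.
Qed.

(** The support is invariant under the shift by (4, 8), and only (1, 1) and (2, 2)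
    are not obtained by such a shift. *)
Lemma class_degree_step n d :
  ((0 < n)%N && class_degree n d : nat)%:Z -
    (if (4 <= n)%N && (8 <= d)%N then
      ((0 < n - 4)%N && class_degree (n - 4) (d - 8) : nat)%:Z else 0) =
  ((n == 1)%N && (d == 1)%N : nat)%:Z + ((n == 2)%N && (d == 2)%N : nat)%:Z.
Proof.
case: (ltnP n 4) => [lt_n4|le_4n].
  rewrite subr0; case: n lt_n4 => [|[|[|[|//]]]] _ //=.
  by rewrite addr0.
have -> : ((n == 1) = false)%N by lia.
have -> : ((n == 2) = false)%N by lia.
rewrite (ltn_trans _ le_4n) //= addr0; apply/eqP; rewrite subr_eq0; apply/eqP.
have mod4 : ((n - 4) %% 4 = n %% 4)%N by rewrite -{2}(subnK le_4n) modnDr.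
rewrite /class_degree mod4.
have [n4|n4] := boolP ((n %% 4 == 1) || (n %% 4 == 2))%N; last by rewrite /= andbF if_same.
have n_gt : (0 < n - 4)%N by move: n4; lia.
rewrite n_gt /=; case: (leqP 8 d) => [le_8d|lt_d8].
  have -> // : (d - 8 == 2 * (n - 4) - n %% 4)%N = (d == 2 * n - n %% 4)%N.
  by apply/eqP/eqP; lia.
by have -> // : (d == 2 * n - n %% 4)%N = false; apply/eqP; lia.
Qed.

Theorem theorem19 :
  [/\ forall n d : nat, (1 <= n)%N -> (exists u : U 1 n d, u != 0) ->
        exists m r : nat,
          [/\ r \in [:: 1%N; 2%N], n = (4 * m + r)%N & d = (8 * m + r)%N],
      forall m r : nat, r \in [:: 1%N; 2%N] ->
        exists f : {linear U 1 (4 * m + r) (8 * m + r) -> ('F_2)^o}, bijective f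
    & let s : {poly {poly int}} := 'X in
      let t : {poly {poly int}} := 'X%:P in
      series2_mul (poincareU 1) (series2_of_poly (1 - s ^+ 4 * t ^+ 8))
        =2 series2_of_poly (s * t * (1 + s * t))].
Proof.
split=> [n d n_gt0 [u u_neq0]|m r r12|s t n d].
- apply/class_degreeP => //; apply: contraNT u_neq0 => /negbTE ndeg.
  by have := bidegree_cases d n_gt0; rewrite ndeg => /quotv_eq0/(_ u) ->.
- have n_gt0 : (0 < 4 * m + r)%N by move: r12; rewrite !inE => /orP[] /eqP ->; lia.
  have deg : class_degree (4 * m + r) (8 * m + r) by apply/class_degreeP => //; exists m, r.
  have := bidegree_cases (8 * m + r) n_gt0; rewrite deg.
  case: (4 * m + r)%N n_gt0 => // k _ /Dsub_class[u [Du nIu gen]].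
  exact: quotv_line Du nIu gen.
pose mon k l : series2 := series2_of_poly ('X ^+ k * 'X%:P ^+ l).
have Dl i j : series2_of_poly (1 - s ^+ 4 * t ^+ 8) i j = mon 0 0 i j - mon 4 8 i j.
  by rewrite /mon /series2_of_poly !expr0 mulr1 !coefB.
have Dr i j : series2_of_poly (s * t * (1 + s * t)) i j = mon 1 1 i j + mon 2 2 i j.
  rewrite /mon /series2_of_poly !expr1 mulrDr mulr1 !coefD; congr (_ + _).
  by rewrite mulrACA -!expr2.
have mul_mon := fun k l => @series2_mul_mon (poincareU 1) (mon k l) k l n d (@coef_monomial k l).
have -> : series2_mul (poincareU 1) (series2_of_poly (1 - s ^+ 4 * t ^+ 8)) n d =
    series2_mul (poincareU 1) (mon 0 0) n d - series2_mul (poincareU 1) (mon 4 8) n d.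
  rewrite /series2_mul -sumrB; apply: eq_bigr => i _; rewrite -sumrB.
  by apply: eq_bigr => j _; rewrite Dl mulrBr.
rewrite !mul_mon Dr /mon /series2_of_poly !coef_monomial !leq0n !subn0 /=.
rewrite !poincareUE class_degree_step.
by congr (_ + _); case: eqP; case: eqP.
Qed.
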